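(* Let $\mu,a_{11},a_{21},a_{40},a_{50}\in\mathbb{R}$ and consider the system $$\dot x=-y+\mu x^3+a_{11}xy+a_{21}x^2y+a_{40}x^4+a_{50}x^5,\qquad \dot y=x^5+3\mu x^2y,$$ which has a nilpotent monodromic singular point at the origin with Andreev number $3$. The origin is a nilpotent center if and only if $\mu=a_{11}a_{40}=a_{50}=0$.
   Context: The origin is a center if all orbits in some punctured neighborhood of it are periodic and surround it. A singular point is nilpotent if the Jacobian matrix there is nonzero with both eigenvalues zero, and monodromic if nearby orbits turn around it so that a Poincaré first return map is defined. For a system that a linear change of variables brings to the form $\dot x=y+P(x,y)$, $\dot y=Q(x,y)$ with $P,Q$ analytic with vanishing $1$-jets at the origin, let $y=F(x)$ be the solution of $y+P(x,y)=0$ near the origin; the Andreev number of a monodromic singular point at the origin is the integer $n$ such that $Q(x,F(x))=ax^{2n-1}+O(x^{2n})$ with $a\neq0$. *)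

(* Defs.v *)
From Stdlib Require Export Reals.
From Coquelicot Require Export Coquelicot.

Open Scope R_scope.

(** A planar vector field is given by its components [f g : R -> R -> R]; a
    curve by its coordinates [x y : R -> R]. *)

(** Derivatives at the end points are two-sided: for the smooth fields under
    consideration a solution on [[0, T]] extends past both end points. *)
Definition solution_on (f g : R -> R -> R) (T : R) (x y : R -> R) : Prop :=
  forall t, 0 <= t <= T ->
    is_derive x t (f (x t) (y t)) /\ is_derive y t (g (x t) (y t)).

Definition solution (f g : R -> R -> R) (x y : R -> R) : Prop :=
  forall t, is_derive x t (f (x t) (y t)) /\ is_derive y t (g (x t) (y t)).

(** [th] is a continuous determination of the polar angle along the part of
    the curve with parameters in [D], which has to avoid the origin. *)
Definition polar_angle (D : R -> Prop) (x y th : R -> R) : Prop :=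
  forall t, D t ->
    0 < x t ^ 2 + y t ^ 2 /\ continuous th t /\
    x t = sqrt (x t ^ 2 + y t ^ 2) * cos (th t) /\
    y t = sqrt (x t ^ 2 + y t ^ 2) * sin (th t).

(** ** Centers *)

(** The least-period condition makes the orbit a simple closed curve (never a
    singular point); it surrounds the origin when its winding number about the
    origin is 1 or -1. *)
Definition periodic_orbit_around_origin (f g : R -> R -> R) (x0 y0 : R) : Prop :=
  exists (x y th : R -> R) (T : R),
    0 < T /\
    solution f g x y /\ x 0 = x0 /\ y 0 = y0 /\
    (forall t, x (t + T) = x t /\ y (t + T) = y t) /\
    (forall t, 0 < t < T -> (x t, y t) <> (x0, y0)) /\
    polar_angle (fun t => 0 <= t <= T) x y th /\
    Rabs (th T - th 0) = 2 * PI.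

Definition is_center (f g : R -> R -> R) : Prop :=
  locally_2d (fun x0 y0 =>
    (x0, y0) <> (0, 0) -> periodic_orbit_around_origin f g x0 y0) 0 0.

(** ** Nilpotent singular points *)

(** [l] is an eigenvalue of the real matrix with rows [(a, b)] and [(c, d)]. *)
Definition is_eigenvalue2 (a b c d : R) (l : C) : Prop :=
  exists u v : C, (u, v) <> (RtoC 0, RtoC 0) /\
    (RtoC a * u + RtoC b * v = l * u)%C /\
    (RtoC c * u + RtoC d * v = l * v)%C.

Definition nilpotent_singular_point (f g : R -> R -> R) : Prop :=
  f 0 0 = 0 /\ g 0 0 = 0 /\
  exists a b c d : R,
    differentiable_pt_lim f 0 0 a b /\ differentiable_pt_lim g 0 0 c d /\
    ~ (a = 0 /\ b = 0 /\ c = 0 /\ d = 0) /\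
    (forall l : C, is_eigenvalue2 a b c d l -> l = RtoC 0).

Definition nilpotent_center (f g : R -> R -> R) : Prop :=
  nilpotent_singular_point f g /\ is_center f g.

(** ** Monodromic singular points *)

(** A regular C^1 arc issuing from the origin, transversal to the field
    elsewhere: the section on which the return map is defined. *)
Definition transversal_section (f g : R -> R -> R) (r : R) (sx sy : R -> R) : Prop :=
  0 < r /\ sx 0 = 0 /\ sy 0 = 0 /\
  (forall s, 0 <= s <= r ->
    ex_derive sx s /\ ex_derive sy s /\
    continuous (Derive sx) s /\ continuous (Derive sy) s) /\
  (Derive sx 0, Derive sy 0) <> (0, 0) /\
  (forall s s', 0 <= s <= r -> 0 <= s' <= r ->
    sx s = sx s' -> sy s = sy s' -> s = s') /\
  (forall s, 0 < s <= r ->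
    f (sx s) (sy s) * Derive sy s - g (sx s) (sy s) * Derive sx s <> 0).

Definition stays_within (eta T : R) (x y : R -> R) : Prop :=
  forall t, 0 <= t <= T -> x t ^ 2 + y t ^ 2 < eta ^ 2.

(** The orbit of the point of the section with parameter [s] comes back to the
    section for the first time at the parameter [s'], after one turn around
    the origin ([e] = 1 or -1 is the orientation), without leaving the ball of
    radius [eta].  The turn is measured against a continuous determination
    [al] of the polar angle along the section. *)
Definition first_return (f g : R -> R -> R) (r : R) (sx sy al : R -> R)
    (e eta s s' : R) : Prop :=
  exists (x y th : R -> R) (T : R),
    0 < T /\ solution_on f g T x y /\
    x 0 = sx s /\ y 0 = sy s /\ x T = sx s' /\ y T = sy s' /\
    (forall t u, 0 < t < T -> 0 < u <= r -> (x t, y t) <> (sx u, sy u)) /\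
    stays_within eta T x y /\
    polar_angle (fun t => 0 <= t <= T) x y th /\
    th 0 = al s /\ th T = al s' + e * (2 * PI).

(** The ball of arbitrary radius [eta] makes the notion local; without it, a
    node or a saddle whose orbits come back after a long excursion would
    qualify. *)
Definition is_monodromic (f g : R -> R -> R) : Prop :=
  exists (r : R) (sx sy al : R -> R) (e : R),
    (e = 1 \/ e = -1) /\
    transversal_section f g r sx sy /\
    polar_angle (fun s => 0 < s <= r) sx sy al /\
    forall eta, 0 < eta ->
      exists delta, 0 < delta <= r /\
        (forall s, 0 < s < delta ->
          exists s', 0 < s' <= r /\ first_return f g r sx sy al e eta s s') /\
        locally_2d (fun x0 y0 => (x0, y0) <> (0, 0) ->
          exists (x y : R -> R) (T s : R),
            0 <= T /\ 0 < s < delta /\ solution_on f g T x y /\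
            x 0 = x0 /\ y 0 = y0 /\ x T = sx s /\ y T = sy s /\
            stays_within eta T x y) 0 0.

(** ** The Andreev number *)

(** [h] is near the origin the sum of an absolutely convergent double power
    series, summed by homogeneous parts. *)
Definition analytic_at_origin (h : R -> R -> R) : Prop :=
  exists c : nat -> nat -> R,
    locally_2d (fun x y =>
      ex_series (fun n =>
        sum_f_R0 (fun k => Rabs (c k (n - k)%nat * x ^ k * y ^ (n - k))) n) /\
      is_series (fun n =>
        sum_f_R0 (fun k => c k (n - k)%nat * x ^ k * y ^ (n - k)) n) (h x y)) 0 0.

Definition vanishing_1jet (h : R -> R -> R) : Prop :=
  h 0 0 = 0 /\ differentiable_pt_lim h 0 0 0 0.

(** In the coordinates [X = p x + q y], [Y = r x + s y] the field [(f, g)] is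
    [(Y + P(X, Y), Q(X, Y))] near the origin. *)
Definition linear_normal_form (f g P Q : R -> R -> R) : Prop :=
  exists p q r s : R, p * s - q * r <> 0 /\
    locally_2d (fun x y =>
      p * f x y + q * g x y = (r * x + s * y) + P (p * x + q * y) (r * x + s * y) /\
      r * f x y + s * g x y = Q (p * x + q * y) (r * x + s * y)) 0 0.

(** Continuity at 0 and [F 0 = 0] select the solution of [y + P(x, y) = 0]
    given by the implicit function theorem. *)
Definition has_andreev_number (f g : R -> R -> R) (n : nat) : Prop :=
  (1 <= n)%nat /\
  exists (P Q : R -> R -> R) (F : R -> R) (a : R),
    analytic_at_origin P /\ analytic_at_origin Q /\
    vanishing_1jet P /\ vanishing_1jet Q /\
    linear_normal_form f g P Q /\
    F 0 = 0 /\ continuous F 0 /\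
    locally 0 (fun x => F x + P x (F x) = 0) /\
    a <> 0 /\
    exists M : R, locally 0 (fun x =>
      Rabs (Q x (F x) - a * x ^ (2 * n - 1)) <= M * Rabs x ^ (2 * n)).

(** ** The family of systems *)

Definition xdot (mu a11 a21 a40 a50 x y : R) : R :=
  - y + mu * x ^ 3 + a11 * x * y + a21 * x ^ 2 * y + a40 * x ^ 4 + a50 * x ^ 5.

Definition ydot (mu x y : R) : R := x ^ 5 + 3 * mu * x ^ 2 * y.

(* Main.v *)
(** In the weighted coordinates [x = r cos t], [y = r^3 sin t] the system becomes
    a scalar equation for [u = ln r] as a function of the angle [t]; the angular
    speed is [r^2] times a quantity bounded below by a positive constant, whatever
    [mu] is.  After a cut-off this equation has global solutions, so every orbit
    near the origin turns around it: this is monodromy, and the origin is a center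
    if and only if the small solutions [u] are [2 PI]-periodic.

    Under the conditions on the coefficients the system is reversible, by
    [t -> - t] if [a40 = 0] and by [t -> PI - t] if [a11 = 0], which forces [u] to
    be periodic.

    Conversely, [x^6 / 6 + y^2 / 2] is strictly monotone along small orbits if
    [mu <> 0].  If [mu = 0], dividing by [q = 1 - a11 x - a21 x^2] gives a Lienard
    system [x' = phi x - y], [y' = x^5 / q].  With [G' = x^5 / q], both halves of a
    closed orbit satisfy [dG/dy = phi - y], so they cannot close up if
    [phi x1 - phi x2] has a constant sign whenever [G x1 = G x2], [x1 > 0 > x2].
    In the coordinate [z] with [G = z^6 / 6], this sign is that of the first
    nonzero odd coefficient of [phi]; the coefficients of [z^5], [z^7], [z^9] do
    not all vanish unless [a11 a40 = a50 = 0]. *)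

Require Import Defs.
From Stdlib Require Import ZArith Lra Lia Psatz ClassicalEpsilon Ranalysis5 List.
Import ListNotations.

Open Scope R_scope.

(** The weights (1, 3) make [-y + mu x^3] and [x^5 + 3 mu x^2 y] homogeneous. This leading part is
    the rotation [(-y, x^5)], which preserves [x^6 / 6 + y^2 / 2], plus [mu x^2] times the Euler
    field [(x, 3 y)] of these weights. The Euler field has no quasi-polar angular component, so [mu]
    cannot stop the rotation; it is purely radial, so [mu <> 0] forces a drift of the preserved
    function at the rate [mu x^2 (x^6 + 3 y^2)].

    Comparing the two halves of a closed orbit meets an obstacle: the sign condition only concerns
    points with equal values of [G], and the arcs meet on the [y] axis, where [x^5 / q] vanishes and
    the differential inequality for the difference of the [G] values is singular. The inequality is
    therefore proved from the lower end point with a weight, and transferred to the upper one by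
    reflection.

    Three odd coefficients of [phi] are required because the first two can vanish together with
    [a11 <> 0]; the third is then a nonzero multiple of [a11^5]. The sign is thus decided at order 9
    at the latest, which is why the expansions are carried up to errors of order 10. *)

(** * Consequences of the mean value theorem *)

Lemma is_derive_continuity_pt (f : R -> R) (x l : R) :
  is_derive f x l -> continuity_pt f x.
Proof.
  intros H. apply derivable_continuous_pt. exists l.
  now apply is_derive_Reals.
Qed.

Lemma is_derive_continuous (f : R -> R) (x l : R) :
  is_derive f x l -> continuous f x.
Proof.
  intros H. apply (ex_derive_continuous (V := R_NormedModule)). now exists l.
Qed.

Lemma is_derive_eq (f : R -> R) (x l l' : R) :
  is_derive f x l -> l = l' -> is_derive f x l'.
Proof. now intros H <-. Qed.

Lemma derive_nonneg_le (f df : R -> R) (a b : R) :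
  a <= b ->
  (forall x, a < x < b -> is_derive f x (df x)) ->
  (forall x, a <= x <= b -> continuity_pt f x) ->
  (forall x, a < x < b -> 0 <= df x) ->
  f a <= f b.
Proof.
  intros Hab Hd Hc Hp.
  (* [MVT_gen] may return an end point, where nothing is known of [df]. *)
  set (df' x := match Rlt_dec a x with
                | left _ => match Rlt_dec x b with left _ => df x | right _ => 0 end
                | right _ => 0 end).
  destruct (MVT_gen f a b df') as [c [_ Hm]].
  - rewrite Rmin_left, Rmax_right by lra. intros x Hx. unfold df'.
    destruct (Rlt_dec a x); [destruct (Rlt_dec x b)|]; try lra. now apply Hd.
  - rewrite Rmin_left, Rmax_right by lra. exact Hc.
  - assert (0 <= df' c).
    { unfold df'. destruct (Rlt_dec a c); [destruct (Rlt_dec c b)|]; try lra.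
      now apply Hp. }
    nra.
Qed.

Lemma derive_pos_lt (f df : R -> R) (a b : R) :
  a < b ->
  (forall x, a < x < b -> is_derive f x (df x)) ->
  (forall x, a <= x <= b -> continuity_pt f x) ->
  (forall x, a < x < b -> 0 < df x) ->
  f a < f b.
Proof.
  intros Hab Hd Hc Hp.
  (* The default value is 1 here: an end point returned by [MVT_gen] must still give a strict
     increase. *)
  set (df' x := match Rlt_dec a x with
                | left _ => match Rlt_dec x b with left _ => df x | right _ => 1 end
                | right _ => 1 end).
  destruct (MVT_gen f a b df') as [c [_ Hm]].
  - rewrite Rmin_left, Rmax_right by lra. intros x Hx. unfold df'.
    destruct (Rlt_dec a x); [destruct (Rlt_dec x b)|]; try lra. now apply Hd.
  - rewrite Rmin_left, Rmax_right by lra. exact Hc.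
  - assert (0 < df' c).
    { unfold df'. destruct (Rlt_dec a c); [destruct (Rlt_dec c b)|]; try lra.
      now apply Hp. }
    nra.
Qed.

Lemma derive_zero_const (f : R -> R) (a b : R) :
  (forall x, is_derive f x 0) -> f a = f b.
Proof.
  intros H.
  destruct (MVT_gen f a b (fun _ => 0)) as [c [_ Hm]].
  - intros; apply H.
  - intros; eapply is_derive_continuity_pt, H.
  - lra.
Qed.

(** Both [g - f] and [g + f] are nondecreasing. The end points come in any order, since the Picard
    iterates are estimated on both sides of [t0]. *)
Lemma derive_dominated (f df g dg : R -> R) (a b : R) :
  (forall x, is_derive f x (df x)) -> (forall x, is_derive g x (dg x)) ->
  (forall x, Rabs (df x) <= dg x) ->
  Rabs (f b - f a) <= Rabs (g b - g a).
Proof.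
  intros Hf Hg Hle.
  assert (K : forall s, s = 1 \/ s = -1 -> forall u v, u <= v ->
            g u - s * f u <= g v - s * f v).
  { intros s Hs u v Huv.
    apply (derive_nonneg_le (fun x => g x - s * f x) (fun x => dg x - s * df x));
      [exact Huv | | |]; intros x _.
    - apply (is_derive_minus (V := R_NormedModule)); [apply Hg|].
      apply is_derive_scal, Hf.
    - eapply is_derive_continuity_pt, (is_derive_minus (V := R_NormedModule));
        [apply Hg | apply is_derive_scal, Hf].
    - specialize (Hle x). apply Rabs_le_between in Hle.
      destruct Hs; subst s; lra. }
  pose proof (K 1 (or_introl eq_refl)) as K1.
  pose proof (K (-1) (or_intror eq_refl)) as K2.
  destruct (Rle_dec a b) as [Hab|Hab].
  - specialize (K1 a b Hab). specialize (K2 a b Hab).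
    rewrite (Rabs_right (g b - g a)) by lra. apply Rabs_le. lra.
  - specialize (K1 b a ltac:(lra)). specialize (K2 b a ltac:(lra)).
    rewrite (Rabs_left1 (g b - g a)) by lra. apply Rabs_le. lra.
Qed.

Lemma derive_bounded_lipschitz (f df : R -> R) (K a b : R) :
  (forall x, is_derive f x (df x)) -> (forall x, Rabs (df x) <= K) ->
  Rabs (f b - f a) <= K * Rabs (b - a).
Proof.
  intros Hf HK.
  assert (0 <= K) by (specialize (HK 0); pose proof (Rabs_pos (df 0)); lra).
  rewrite <- (Rabs_right K) by lra. rewrite <- Rabs_mult.
  replace (K * (b - a)) with (K * b - K * a) by ring.
  apply (derive_dominated f df (fun x => K * x) (fun _ => K)); auto.
  intros x. auto_derive; [auto | ring].
Qed.

Lemma is_derive_RInt_continuous (f : R -> R) (a x : R) :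
  (forall t, continuous f t) -> is_derive (RInt f a) x (f x).
Proof.
  intros Hf. apply (is_derive_RInt f (RInt f a) a x); [|apply Hf].
  exists (mkposreal 1 Rlt_0_1). intros y _.
  apply (RInt_correct (V := R_CompleteNormedModule)).
  apply (ex_RInt_continuous (V := R_CompleteNormedModule)). intros; apply Hf.
Qed.

(** * Scalar differential equations *)

Section Picard.

Variables (F : R -> R -> R) (K L t0 u0 : R).
Hypothesis L_pos : 0 < L.
(** Continuity along continuous curves is the form in which the integrands [F s (v s)] use it. *)
Hypothesis F_continuous :
  forall v, (forall t, continuous v t) -> forall t, continuous (fun s => F s (v s)) t.
Hypothesis F_bounded : forall t u, Rabs (F t u) <= K.
Hypothesis F_lipschitz : forall t u v, Rabs (F t u - F t v) <= L * Rabs (u - v).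

Fixpoint picard (n : nat) (t : R) : R :=
  match n with
  | O => u0
  | S m => u0 + RInt (fun s => F s (picard m s)) t0 t
  end.

Lemma picard_continuous n t : continuous (picard n) t.
Proof.
  revert t. induction n as [|n IH]; intros t; simpl.
  - apply continuous_const.
  - apply (continuous_plus (V := R_NormedModule)); [apply continuous_const|].
    eapply is_derive_continuous, is_derive_RInt_continuous.
    now apply F_continuous.
Qed.

Lemma picard_derive n t : is_derive (picard (S n)) t (F t (picard n t)).
Proof.
  simpl. eapply is_derive_eq.
  - apply (is_derive_plus (V := R_NormedModule)); [apply is_derive_const|].
    apply (is_derive_RInt_continuous (fun s => F s (picard n s))).
    apply F_continuous, picard_continuous.
  - unfold plus, zero; simpl; ring.
Qed.

Lemma picard_init n : picard n t0 = u0.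
Proof. destruct n; simpl; [easy|]. rewrite RInt_point. unfold zero; simpl; ring. Qed.

(* Bielecki's weight: differences of iterates shrink geometrically when
   measured against [weight], on the whole line at once. *)
Definition weight (t : R) : R := exp (2 * L * (t - t0)) + exp (- (2 * L * (t - t0))).
Definition weight_prim (t : R) : R := exp (2 * L * (t - t0)) - exp (- (2 * L * (t - t0))).

Lemma weight_ge1 t : 1 <= weight t.
Proof.
  unfold weight. pose proof (exp_ineq1_le (2 * L * (t - t0))).
  pose proof (exp_ineq1_le (- (2 * L * (t - t0)))). lra.
Qed.

Lemma weight_prim_le t : Rabs (weight_prim t - weight_prim t0) <= weight t.
Proof.
  unfold weight_prim, weight. replace (2 * L * (t0 - t0)) with 0 by ring.
  rewrite Ropp_0, exp_0.
  pose proof (exp_pos (2 * L * (t - t0))). pose proof (exp_pos (- (2 * L * (t - t0)))).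
  apply Rabs_le. lra.
Qed.

(** [weight_prim] has derivative [2 * L * weight], so one integration gains the factor
    [1 / (2 * L)]. After a Lipschitz estimate with constant [L] this is the contraction factor
    [1 / 2]. *)
Lemma dominated_by_weight (f df : R -> R) (c t : R) :
  0 <= c -> f t0 = 0 -> (forall x, is_derive f x (df x)) ->
  (forall x, Rabs (df x) <= c * weight x) ->
  Rabs (f t) <= c / (2 * L) * weight t.
Proof.
  intros Hc H0 Hf Hle.
  replace (f t) with (f t - f t0) by (rewrite H0; ring).
  eapply Rle_trans.
  - apply (derive_dominated f df (fun x => c / (2 * L) * weight_prim x)
             (fun x => c * weight x)); auto.
    intros x. unfold weight_prim, weight. auto_derive; [auto|]. unfold Rminus. field. lra.
  - replace (c / (2 * L) * weight_prim t - c / (2 * L) * weight_prim t0)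
      with (c / (2 * L) * (weight_prim t - weight_prim t0)) by ring.
    assert (0 <= c / (2 * L)) by (apply Rle_mult_inv_pos; lra).
    rewrite Rabs_mult, (Rabs_right (c / (2 * L))) by lra.
    apply Rmult_le_compat_l; [lra | apply weight_prim_le].
Qed.

Lemma bound_nonneg : 0 <= K.
Proof. pose proof (F_bounded 0 0). pose proof (Rabs_pos (F 0 0)). lra. Qed.

Lemma picard_step n t :
  Rabs (picard (S n) t - picard n t) <= K / (2 * L) * (/ 2) ^ n * weight t.
Proof.
  pose proof bound_nonneg as HK.
  assert (HC : 0 <= K / (2 * L)) by (apply Rle_mult_inv_pos; lra).
  revert t. induction n as [|n IH]; intros t.
  - replace (K / (2 * L) * (/ 2) ^ 0) with (K / (2 * L)) by (simpl; ring).
    apply (dominated_by_weight (fun t => picard 1 t - picard 0 t) (fun t => F t u0)); auto.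
    + rewrite !picard_init. ring.
    + intros x. eapply is_derive_eq.
      * apply (is_derive_minus (V := R_NormedModule)); [apply picard_derive|].
        apply is_derive_const.
      * unfold minus, plus, opp, zero; simpl; ring.
    + intros x. pose proof (F_bounded x u0). pose proof (weight_ge1 x). nra.
  - replace (K / (2 * L) * (/ 2) ^ S n)
      with (L * (K / (2 * L) * (/ 2) ^ n) / (2 * L)) by (simpl; field; lra).
    apply (dominated_by_weight (fun t => picard (S (S n)) t - picard (S n) t)
             (fun t => F t (picard (S n) t) - F t (picard n t))).
    + assert (0 <= (/ 2) ^ n) by (apply pow_le; lra). repeat (lra || apply Rmult_le_pos).
    + rewrite !picard_init. ring.
    + intros x. apply (is_derive_minus (V := R_NormedModule)); apply picard_derive.
    + intros x. eapply Rle_trans; [apply F_lipschitz|].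
      rewrite Rmult_assoc. apply Rmult_le_compat_l; [lra | apply IH].
Qed.

Lemma picard_tail n p t :
  Rabs (picard (n + p) t - picard n t) <= K / L * (/ 2) ^ n * weight t.
Proof.
  assert (HC : 0 <= K / (2 * L)) by (apply Rle_mult_inv_pos; [apply bound_nonneg | lra]).
  assert (W := weight_ge1 t).
  (* The exact geometric partial sum, rather than its upper bound, lets the induction on [p]
     close. *)
  assert (A : Rabs (picard (n + p) t - picard n t)
          <= 2 * (K / (2 * L)) * ((/ 2) ^ n - (/ 2) ^ (n + p)) * weight t).
  { induction p as [|p IH].
    - rewrite Nat.add_0_r, !Rminus_diag, Rabs_R0. lra.
    - rewrite Nat.add_succ_r.
      replace (picard (S (n + p)) t - picard n t)
        with ((picard (S (n + p)) t - picard (n + p) t) + (picard (n + p) t - picard n t))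
        by ring.
      eapply Rle_trans; [apply Rabs_triang|].
      pose proof (picard_step (n + p) t). simpl ((/ 2) ^ S (n + p)). lra. }
  eapply Rle_trans; [exact A|].
  assert (0 <= (/ 2) ^ (n + p)) by (apply pow_le; lra).
  replace (K / L * (/ 2) ^ n * weight t)
    with (2 * (K / (2 * L)) * (/ 2) ^ n * weight t) by (field; lra).
  apply Rmult_le_compat_r; [lra|]. apply Rmult_le_compat_l; lra.
Qed.

Lemma geometric_squeeze (x c : R) : (forall n, Rabs x <= c * (/ 2) ^ n) -> x = 0.
Proof.
  intros H.
  assert (A : is_lim_seq (fun n => c * (/ 2) ^ n) 0).
  { replace (Finite 0) with (Rbar_mult c 0) by (simpl; now rewrite Rmult_0_r).
    apply is_lim_seq_scal_l, is_lim_seq_geom. rewrite Rabs_right; lra. }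
  assert (B : Rbar_le (Rabs x) 0).
  { apply (is_lim_seq_le (fun _ => Rabs x) (fun n => c * (/ 2) ^ n)); auto.
    apply is_lim_seq_const. }
  simpl in B. pose proof (Rabs_pos x).
  destruct (Req_dec x 0) as [|N]; [easy|]. apply Rabs_no_R0 in N. lra.
Qed.

Lemma picard_limit t : exists l, forall n,
  Rabs (l - picard n t) <= K / L * (/ 2) ^ n * weight t.
Proof.
  assert (HK : 0 <= K / L) by (apply Rle_mult_inv_pos; [apply bound_nonneg | lra]).
  assert (W := weight_ge1 t).
  destruct (Rcomplete.R_complete (fun n => picard n t)) as [l Hl].
  - intros eps Heps.
    assert (A : is_lim_seq (fun n => K / L * weight t * (/ 2) ^ n) 0).
    { replace (Finite 0) with (Rbar_mult (K / L * weight t) 0)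
        by (simpl; now rewrite Rmult_0_r).
      apply is_lim_seq_scal_l, is_lim_seq_geom. rewrite Rabs_right; lra. }
    apply is_lim_seq_spec in A. destruct (A (mkposreal (eps / 2) ltac:(lra))) as [N HN].
    simpl in HN. exists N. intros n m Hn Hm. unfold R_dist.
    specialize (HN N (Nat.le_refl N)). rewrite Rminus_0_r in HN.
    apply Rabs_lt_between in HN.
    pose proof (picard_tail N (n - N) t) as Pn. pose proof (picard_tail N (m - N) t) as Pm.
    replace (N + (n - N))%nat with n in Pn by lia.
    replace (N + (m - N))%nat with m in Pm by lia.
    apply Rabs_le_between in Pn, Pm. apply Rabs_lt_between. lra.
  - exists l. intros n.
    apply is_lim_seq_Reals in Hl.
    apply (is_lim_seq_le (fun p => Rabs (picard (p + n) t - picard n t))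
             (fun _ => K / L * (/ 2) ^ n * weight t)
             (Rabs (l - picard n t)) (K / L * (/ 2) ^ n * weight t)).
    + intros p. rewrite Nat.add_comm. apply picard_tail.
    + apply (is_lim_seq_abs _ (l - picard n t)).
      apply is_lim_seq_minus'; [|apply is_lim_seq_const].
      now apply (is_lim_seq_incr_n (fun p => picard p t) n).
    + apply is_lim_seq_const.
Qed.

Theorem ode_existence : exists u : R -> R,
  u t0 = u0 /\ forall t, is_derive u t (F t (u t)).
Proof.
  assert (HK := bound_nonneg).
  assert (HKL : 0 <= K / L) by (apply Rle_mult_inv_pos; lra).
  set (u t := proj1_sig (constructive_indefinite_description _ (picard_limit t))).
  assert (Hu : forall t n, Rabs (u t - picard n t) <= K / L * (/ 2) ^ n * weight t).
  { intros t. unfold u. apply proj2_sig. }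
  (* All iterates are [K]-Lipschitz because [F] is bounded by [K]; the pointwise limit inherits
     this, which yields its continuity directly. *)
  assert (Hlip : forall s t, Rabs (u s - u t) <= K * Rabs (s - t)).
  { intros s t.
    assert (A : forall n, Rabs (u s - u t) - K * Rabs (s - t)
        <= K / L * (weight s + weight t) * (/ 2) ^ n).
    { intros n. pose proof (Hu s (S n)) as A1. pose proof (Hu t (S n)) as A2.
      assert (A3 : Rabs (picard (S n) s - picard (S n) t) <= K * Rabs (s - t)).
      { apply (derive_bounded_lipschitz _ (fun x => F x (picard n x)));
          [intros; apply picard_derive | intros; apply F_bounded]. }
      pose proof (weight_ge1 s). pose proof (weight_ge1 t).
      assert (0 <= (/ 2) ^ n) by (apply pow_le; lra).
      assert (0 <= K / L * (/ 2) ^ n * (weight s + weight t))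
        by (repeat (lra || apply Rmult_le_pos)).
      simpl ((/ 2) ^ S n) in A1, A2. apply Rabs_le_between in A1, A2, A3.
      enough (Rabs (u s - u t)
        <= K * Rabs (s - t) + K / L * (weight s + weight t) * (/ 2) ^ n) by lra.
      apply Rabs_le. lra. }
    destruct (Rle_dec (Rabs (u s - u t) - K * Rabs (s - t)) 0) as [|N]; [lra|].
    assert (Rabs (u s - u t) - K * Rabs (s - t) = 0); [|lra].
    apply (geometric_squeeze _ (K / L * (weight s + weight t))).
    intros n. rewrite Rabs_right by lra. apply A. }
  assert (Hc : forall t, continuous u t).
  { intros t. apply continuity_pt_filterlim. intros eps Heps.
    exists (eps / (K + 1)). split; [apply Rdiv_lt_0_compat; lra|].
    intros x [_ Hx]. simpl in *. unfold R_dist in *.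
    apply Rle_lt_trans with (K * Rabs (x - t)); [apply Hlip|].
    apply Rle_lt_trans with ((K + 1) * Rabs (x - t)).
    - pose proof (Rabs_pos (x - t)). nra.
    - apply Rlt_le_trans with ((K + 1) * (eps / (K + 1))).
      + apply Rmult_lt_compat_l; lra.
      + right. field. lra. }
  (* The Picard image of [u]. It is approached by the same iterates as [u], hence equals [u] and
     brings the derivative. *)
  set (v t := u0 + RInt (fun s => F s (u s)) t0 t).
  assert (Hv : forall t, is_derive v t (F t (u t))).
  { intros t. eapply is_derive_eq.
    - apply (is_derive_plus (V := R_NormedModule)); [apply is_derive_const|].
      apply (is_derive_RInt_continuous (fun s => F s (u s))). now apply F_continuous.
    - unfold plus, zero; simpl; ring. }
  assert (Hv0 : v t0 = u0).
  { unfold v. rewrite RInt_point. unfold zero; simpl; ring. }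
  assert (Huv : forall t, v t = u t).
  { intros t. apply Rminus_diag_uniq.
    apply (geometric_squeeze _ (K / L * weight t)). intros n.
    assert (A : Rabs (v t - picard (S n) t) <= L * (K / L * (/ 2) ^ n) / (2 * L) * weight t).
    { apply (dominated_by_weight (fun t => v t - picard (S n) t)
               (fun t => F t (u t) - F t (picard n t))).
      - assert (0 <= (/ 2) ^ n) by (apply pow_le; lra). repeat (lra || apply Rmult_le_pos).
      - rewrite picard_init, Hv0. ring.
      - intros x. apply (is_derive_minus (V := R_NormedModule)); [apply Hv | apply picard_derive].
      - intros x. eapply Rle_trans; [apply F_lipschitz|].
        rewrite Rmult_assoc. apply Rmult_le_compat_l; [lra | apply Hu]. }
    replace (L * (K / L * (/ 2) ^ n) / (2 * L) * weight t)
      with (K / L * weight t * (/ 2) ^ n / 2) in A by (field; lra).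
    pose proof (Hu t (S n)) as B.
    replace (K / L * (/ 2) ^ S n * weight t)
      with (K / L * weight t * (/ 2) ^ n / 2) in B by (simpl; field; lra).
    apply Rabs_le_between in A, B. apply Rabs_le. lra. }
  exists u. split; [now rewrite <- Huv|].
  intros t. apply (is_derive_ext v); auto.
Qed.

End Picard.

Lemma gronwall_zero (E dE : R -> R) (C a b t0 : R) :
  a <= t0 <= b -> E t0 = 0 ->
  (forall t, a <= t <= b -> is_derive E t (dE t)) ->
  (forall t, a <= t <= b -> 0 <= E t) ->
  (forall t, a <= t <= b -> Rabs (dE t) <= C * E t) ->
  forall t, a <= t <= b -> E t = 0.
Proof.
  intros Ht0 H0 HE Hpos HC t Ht.
  (* With [k = 1] the function [exp (C s) * E s] is nondecreasing, which handles times before [t0];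
     with [k = -1] the function [exp (- C s) * E s] is nonincreasing, which handles later times. *)
  assert (D : forall k x, a <= x <= b ->
    is_derive (fun s => k * exp (k * C * s) * E s) x
      (exp (k * C * x) * (k * k * C * E x + k * dE x))).
  { intros k x Hx. eapply is_derive_eq.
    - apply (is_derive_mult (fun s => k * exp (k * C * s)) E);
        [auto_derive; reflexivity | now apply HE | intros; apply Rmult_comm].
    - unfold plus, mult; simpl. ring. }
  assert (M : forall k, k * k = 1 -> forall u v, a <= u -> u <= v -> v <= b ->
    k * exp (k * C * u) * E u <= k * exp (k * C * v) * E v).
  { intros k Hk u v Hu Huv Hv.
    apply (derive_nonneg_le (fun s => k * exp (k * C * s) * E s)
       (fun x => exp (k * C * x) * (k * k * C * E x + k * dE x))); [easy| | |].
    - intros; apply D; lra.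
    - intros; eapply is_derive_continuity_pt, D; lra.
    - intros x Hx. apply Rmult_le_pos; [left; apply exp_pos|].
      specialize (HC x ltac:(lra)). apply Rabs_le_between in HC.
      rewrite Hk. assert (k = 1 \/ k = -1) as [->| ->] by
        (destruct (Rle_dec 0 k); [left | right]; nra); lra. }
  pose proof (Hpos t Ht).
  destruct (Rle_dec t0 t).
  - pose proof (M (-1) ltac:(ring) t0 t ltac:(lra) ltac:(lra) ltac:(lra)) as A.
    rewrite H0 in A. pose proof (exp_pos (-1 * C * t)). nra.
  - pose proof (M 1 ltac:(ring) t t0 ltac:(lra) ltac:(lra) ltac:(lra)) as A.
    rewrite H0 in A. pose proof (exp_pos (1 * C * t)). nra.
Qed.

Lemma ode_uniqueness (F : R -> R -> R) (L t0 : R) (u v : R -> R) :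
  (forall t x y, Rabs (F t x - F t y) <= L * Rabs (x - y)) ->
  (forall t, is_derive u t (F t (u t))) -> (forall t, is_derive v t (F t (v t))) ->
  u t0 = v t0 -> forall t, u t = v t.
Proof.
  intros HL Hu Hv H0 t.
  assert (A : (u t - v t) ^ 2 = 0).
  { apply (gronwall_zero (fun s => (u s - v s) ^ 2)
      (fun s => 2 * (u s - v s) * (F s (u s) - F s (v s))) (2 * L)
      (Rmin t t0) (Rmax t t0) t0); try (intros s _).
    - split; [apply Rmin_r | apply Rmax_r].
    - rewrite H0. ring.
    - eapply is_derive_eq.
      + apply (is_derive_pow (fun s => u s - v s) 2).
        apply (is_derive_minus (V := R_NormedModule)); [apply Hu | apply Hv].
      + unfold minus, plus, opp; simpl. ring.
    - apply pow2_ge_0.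
    - rewrite !Rabs_mult, (Rabs_right 2) by lra. rewrite <- pow2_abs.
      pose proof (HL s (u s) (v s)). pose proof (Rabs_pos (u s - v s)). nra.
    - split; [apply Rmin_l | apply Rmax_l]. }
  assert (u t - v t = 0); [|lra]. nra.
Qed.

(** * Inverse functions *)

Lemma ivt_interval (f : R -> R) (a b y : R) :
  a <= b -> (forall x, a <= x <= b -> continuity_pt f x) -> f a <= y <= f b ->
  exists x, a <= x <= b /\ f x = y.
Proof.
  intros Hab Hc Hy.
  destruct (Req_dec (f a) y) as [E|E]; [exists a; lra|].
  destruct (Req_dec (f b) y) as [E'|E']; [exists b; lra|].
  assert (a < b) by (destruct (Rle_lt_or_eq_dec a b Hab); [easy | subst; lra]).
  destruct (IVT_interv (fun x => f x - y) a b) as [x [Hx Hf]]; try lra.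
  - intros x Hx. apply continuity_pt_minus; [now apply Hc|].
    apply continuity_pt_const. now intros ? ?.
  - exists x. split; lra.
Qed.

Lemma inverse_continuity_pt (f g : R -> R) (a b y : R) :
  (forall u v, a <= u -> u < v -> v <= b -> f u < f v) ->
  (forall z, f a <= z <= f b -> a <= g z <= b /\ f (g z) = z) ->
  f a < y < f b -> continuity_pt g y.
Proof.
  intros Hf Hg Hy eps Heps.
  assert (Hm : forall u v, a <= u <= b -> a <= v <= b -> f u < f v -> u < v).
  { intros u v Hu Hv Huv. destruct (Rlt_dec u v) as [|N]; [easy|].
    destruct (Req_dec u v) as [->|]; [lra|].
    pose proof (Hf v u ltac:(lra) ltac:(lra) ltac:(lra)). lra. }
  destruct (Hg y ltac:(lra)) as [Gy Fy].
  assert (Gy' : a < g y < b).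
  { split; [destruct (Req_dec a (g y)) as [E|] | destruct (Req_dec (g y) b) as [E|]]; try lra.
    - rewrite E in Hy at 1. lra.
    - rewrite <- E in Hy. lra. }
  set (e := Rmin eps (Rmin (g y - a) (b - g y)) / 2).
  assert (He : 0 < e /\ e < eps /\ a < g y - e /\ g y + e < b).
  { unfold e, Rmin. destruct (Rle_dec (g y - a) (b - g y));
      (destruct (Rle_dec eps _); lra). }
  pose proof (Hf (g y - e) (g y) ltac:(lra) ltac:(lra) ltac:(lra)).
  pose proof (Hf (g y) (g y + e) ltac:(lra) ltac:(lra) ltac:(lra)).
  pose proof (Hf a (g y - e) ltac:(lra) ltac:(lra) ltac:(lra)).
  pose proof (Hf (g y + e) b ltac:(lra) ltac:(lra) ltac:(lra)).
  exists (Rmin (f (g y + e) - f (g y)) (f (g y) - f (g y - e))).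
  split; [apply Rmin_glb_lt; lra|].
  intros z [_ Hz]. simpl in *. unfold R_dist in *.
  apply Rmin_Rgt in Hz. destruct Hz as [Hz1 Hz2]. unfold Rgt in *.
  apply Rabs_lt_between in Hz1, Hz2.
  destruct (Hg z ltac:(lra)) as [Gz Fz].
  assert (g z < g y + e) by (apply Hm; lra).
  assert (g y - e < g z) by (apply Hm; lra).
  apply Rabs_lt_between. lra.
Qed.

Lemma is_derive_inverse (f g : R -> R) (y l : R) :
  continuity_pt g y -> locally y (fun z => f (g z) = z) ->
  is_derive f (g y) l -> l <> 0 -> is_derive g y (/ l).
Proof.
  intros Hc Hloc Hf Hl. apply is_derive_Reals. apply is_derive_Reals in Hf.
  assert (Hy := locally_singleton _ _ Hloc). simpl in Hy.
  intros eps Heps.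
  assert (Hl' : 0 < Rabs l) by now apply Rabs_pos_lt.
  (* The first bound keeps the difference quotient [h / k] of [f] above [Rabs l / 2] in absolute
     value; the second then makes the error of its inverse smaller than [eps]. *)
  set (e := Rmin (Rabs l / 2) (eps * (Rabs l * Rabs l) / 2)).
  assert (He : 0 < e).
  { unfold e. apply Rmin_glb_lt; [lra|].
    apply Rdiv_lt_0_compat; [|lra]. repeat apply Rmult_lt_0_compat; lra. }
  destruct (Hf e He) as [d Hd].
  destruct (Hc d (cond_pos d)) as [d1 [Hd1 Hg]].
  destruct Hloc as [d2 Hd2].
  exists (mkposreal (Rmin d1 d2) (Rmin_stable_in_posreal (mkposreal d1 Hd1) d2)).
  intros h Hh0 Hh. simpl in Hh. apply Rmin_Rgt in Hh as [Hh1 Hh2]. unfold Rgt in *.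
  assert (E1 : f (g (y + h)) = y + h).
  { apply Hd2. unfold ball; simpl; unfold AbsRing_ball, abs, minus, plus, opp; simpl.
    now replace (y + h + - y) with h by ring. }
  set (k := g (y + h) - g y).
  assert (Hk0 : k <> 0).
  { unfold k. intros E. assert (g (y + h) = g y) as E' by lra. rewrite E' in E1. lra. }
  assert (Hkd : Rabs k < d).
  { unfold k. apply Hg. split; [split; [exact I | lra]|].
    simpl. unfold R_dist. now replace (y + h - y) with h by ring. }
  specialize (Hd k Hk0 Hkd).
  replace (g y + k) with (g (y + h)) in Hd by (unfold k; ring).
  rewrite E1, Hy in Hd. replace (y + h - y) with h in Hd by ring.
  fold k.
  assert (Hq : Rabs l / 2 < Rabs (h / k)).
  { pose proof (Rmin_l (Rabs l / 2) (eps * (Rabs l * Rabs l) / 2)). fold e in H.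
    pose proof (Rabs_triang_inv l (l - h / k)) as T.
    replace (l - (l - h / k)) with (h / k) in T by ring.
    rewrite <- Rabs_Ropp in Hd. replace (- (h / k - l)) with (l - h / k) in Hd by ring.
    lra. }
  replace (k / h - / l) with ((l - h / k) * / (h / k) * / l) by (field; auto).
  rewrite !Rabs_mult, !Rabs_inv.
  rewrite <- Rabs_Ropp in Hd. replace (- (h / k - l)) with (l - h / k) in Hd by ring.
  pose proof (Rmin_r (Rabs l / 2) (eps * (Rabs l * Rabs l) / 2)) as M. fold e in M.
  apply Rle_lt_trans with (Rabs (l - h / k) * / (Rabs l / 2) * / Rabs l).
  - apply Rmult_le_compat_r; [left; now apply Rinv_0_lt_compat|].
    apply Rmult_le_compat_l; [apply Rabs_pos|].
    apply Rinv_le_contravar; lra.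
  - apply Rmult_lt_reg_r with (Rabs l * Rabs l / 2); [nra|].
    replace (Rabs (l - h / k) * / (Rabs l / 2) * / Rabs l * (Rabs l * Rabs l / 2))
      with (Rabs (l - h / k)) by (field; lra).
    lra.
Qed.

(** The lower bound [m] on the derivative makes [f] unbounded in both directions, so the inverse is
    defined on the whole line. This is what gives orbits for all times. *)
Lemma increasing_inverse (f df : R -> R) (m : R) :
  0 < m -> (forall x, is_derive f x (df x)) -> (forall x, m <= df x) ->
  exists g : R -> R, (forall y, f (g y) = y) /\ (forall x, g (f x) = x) /\
    forall y, is_derive g y (/ df (g y)).
Proof.
  intros Hm Hf Hdf.
  assert (Hc : forall x, continuity_pt f x)
    by (intros x; eapply is_derive_continuity_pt, Hf).
  assert (Hmono : forall u v, u < v -> f u < f v).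
  { intros u v Huv. apply (derive_pos_lt f df); auto.
    intros x _. specialize (Hdf x). lra. }
  assert (Hgrow : forall u v, u <= v -> m * (v - u) <= f v - f u).
  { intros u v Huv.
    enough (f u - m * u <= f v - m * v) by lra.
    apply (derive_nonneg_le (fun x => f x - m * x) (fun x => df x - m)); auto.
    - intros x _. apply (is_derive_minus (V := R_NormedModule)); [apply Hf|].
      auto_derive; [auto | ring].
    - intros x _. apply continuity_pt_minus; [apply Hc|].
      apply (is_derive_continuity_pt _ _ m). auto_derive; [auto | ring].
    - intros x _. specialize (Hdf x). lra. }
  assert (Hsurj : forall y, exists x, f x = y).
  { intros y. set (k := Rabs (y - f 0) / m).
    assert (Hk : 0 <= k) by (apply Rle_mult_inv_pos; [apply Rabs_pos | easy]).
    assert (Hmk : m * k = Rabs (y - f 0)) by (unfold k; field; lra).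
    pose proof (Hgrow 0 k Hk). pose proof (Hgrow (- k) 0 ltac:(lra)).
    pose proof (Rle_abs (y - f 0)). pose proof (Rabs_maj2 (y - f 0)).
    destruct (ivt_interval f (- k) k y) as [x [_ Hx]]; [lra | auto | lra | now exists x]. }
  set (g y := proj1_sig (constructive_indefinite_description _ (Hsurj y))).
  assert (Hg : forall y, f (g y) = y) by (intros y; unfold g; apply proj2_sig).
  assert (Hinj : forall u v, f u = f v -> u = v).
  { intros u v E. destruct (Rtotal_order u v) as [H|[H|H]]; [|easy|];
      apply Hmono in H; lra. }
  exists g. split; [exact Hg|]. split; [intros x; apply Hinj, Hg|].
  intros y. apply (is_derive_inverse f).
  - apply (inverse_continuity_pt f g (g y - 1) (g y + 1)).
    + intros; now apply Hmono.
    + intros z Hz. split; [|apply Hg].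
      assert (N : forall u v, f u <= f v -> u <= v).
      { intros u v H. destruct (Rle_dec u v) as [|C]; [easy|].
        pose proof (Hmono v u ltac:(lra)). lra. }
      split; apply N; rewrite Hg; lra.
    + pose proof (Hmono (g y - 1) (g y) ltac:(lra)).
      pose proof (Hmono (g y) (g y + 1) ltac:(lra)). rewrite Hg in *. lra.
  - exists (mkposreal 1 Rlt_0_1). intros z _. apply Hg.
  - apply Hf.
  - specialize (Hdf (g y)). lra.
Qed.

(** * Angles *)

Lemma angle_exists (a b : R) : a ^ 2 + b ^ 2 = 1 ->
  exists t, 0 < t <= 2 * PI /\ cos t = a /\ sin t = b.
Proof.
  intros H. assert (Ha : -1 <= a <= 1) by nra.
  pose proof PI_RGT_0. pose proof (acos_bound a) as Hb.
  assert (Hs : sqrt (1 - Rsqr a) = Rabs b).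
  { replace (1 - Rsqr a) with (Rsqr b) by (unfold Rsqr; lra). apply sqrt_Rsqr_abs. }
  destruct (Rle_dec 0 b) as [Hb0|Hb0].
  - rewrite Rabs_right in Hs by lra.
    destruct (Req_dec (acos a) 0) as [E|E].
    (* The angle 0 is recorded as [2 * PI], to stay in the half-open range of the statement. *)
    + exists (2 * PI). rewrite cos_2PI, sin_2PI. split; [lra|].
      rewrite <- (cos_acos a), <- Hs, <- (sin_acos a), E, cos_0, sin_0 by easy. easy.
    + exists (acos a). rewrite cos_acos, sin_acos by easy. split; [lra | easy].
  - rewrite Rabs_left in Hs by lra.
    exists (2 * PI - acos a). split; [lra|].
    rewrite cos_minus, sin_minus, cos_2PI, sin_2PI, cos_acos, sin_acos, Hs by easy.
    split; ring.
Qed.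

Lemma angle_unique (s t : R) : cos s = cos t -> sin s = sin t ->
  exists k : Z, s = t + IZR k * (2 * PI).
Proof.
  intros Hc Hs.
  assert (H : sin ((s - t) / 2) = 0).
  { pose proof (cos_2a_sin ((s - t) / 2)) as D.
    replace (2 * ((s - t) / 2)) with (s - t) in D by field.
    rewrite cos_minus, Hc, Hs in D. pose proof (sin2_cos2 t). unfold Rsqr in *. nra. }
  apply sin_eq_0_0 in H as [k Hk]. exists k. lra.
Qed.

Lemma turns_exist (x : R) : 0 <= x ->
  exists n : nat, 0 <= x - INR n * (2 * PI) <= 2 * PI.
Proof.
  intros Hx. pose proof PI_RGT_0.
  destruct (nfloor_ex (x / (2 * PI))) as [n Hn]; [apply Rle_mult_inv_pos; lra|].
  exists n. destruct Hn as [H1 H2].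
  apply Rle_div_r in H1; [|lra]. apply Rlt_div_l in H2; [|lra]. lra.
Qed.

(** * Planar systems *)

(** The bound [M] accompanies the constant [L] because the product rule needs it. *)
Definition loc_lipschitz (f : R -> R -> R) : Prop :=
  forall B, exists M L, 0 <= M /\ 0 <= L /\
    forall x y x' y', Rabs x <= B -> Rabs y <= B -> Rabs x' <= B -> Rabs y' <= B ->
      Rabs (f x y) <= M /\ Rabs (f x y - f x' y') <= L * (Rabs (x - x') + Rabs (y - y')).

Lemma loc_lipschitz_const (c : R) : loc_lipschitz (fun _ _ => c).
Proof.
  intros B. exists (Rabs c), 0. split; [apply Rabs_pos|]. split; [lra|].
  intros. rewrite Rminus_diag, Rabs_R0. lra.
Qed.

Lemma loc_lipschitz_fst : loc_lipschitz (fun x _ => x).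
Proof.
  intros B. exists (Rabs B), 1. split; [apply Rabs_pos|]. split; [lra|].
  intros. pose proof (Rle_abs B). pose proof (Rabs_pos (y - y')). lra.
Qed.

Lemma loc_lipschitz_snd : loc_lipschitz (fun _ y => y).
Proof.
  intros B. exists (Rabs B), 1. split; [apply Rabs_pos|]. split; [lra|].
  intros. pose proof (Rle_abs B). pose proof (Rabs_pos (x - x')). lra.
Qed.

Lemma loc_lipschitz_plus (f g : R -> R -> R) :
  loc_lipschitz f -> loc_lipschitz g -> loc_lipschitz (fun x y => f x y + g x y).
Proof.
  intros Hf Hg B. destruct (Hf B) as [M [L [HM [HL H]]]].
  destruct (Hg B) as [M' [L' [HM' [HL' H']]]].
  exists (M + M'), (L + L'). split; [lra|]. split; [lra|].
  intros x y x' y' h1 h2 h3 h4.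
  destruct (H x y x' y' h1 h2 h3 h4) as [B1 D1].
  destruct (H' x y x' y' h1 h2 h3 h4) as [B2 D2].
  split.
  - eapply Rle_trans; [apply Rabs_triang | lra].
  - replace (f x y + g x y - (f x' y' + g x' y'))
      with ((f x y - f x' y') + (g x y - g x' y')) by ring.
    eapply Rle_trans; [apply Rabs_triang | lra].
Qed.

Lemma loc_lipschitz_mult (f g : R -> R -> R) :
  loc_lipschitz f -> loc_lipschitz g -> loc_lipschitz (fun x y => f x y * g x y).
Proof.
  intros Hf Hg B. destruct (Hf B) as [M [L [HM [HL H]]]].
  destruct (Hg B) as [M' [L' [HM' [HL' H']]]].
  exists (M * M'), (L * M' + M * L').
  split; [now apply Rmult_le_pos|].
  split; [apply Rplus_le_le_0_compat; now apply Rmult_le_pos|].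
  intros x y x' y' h1 h2 h3 h4.
  destruct (H x y x' y' h1 h2 h3 h4) as [B1 D1].
  destruct (H x' y' x y h3 h4 h1 h2) as [B1' _].
  destruct (H' x y x' y' h1 h2 h3 h4) as [B2 D2].
  split.
  - rewrite Rabs_mult. apply Rmult_le_compat; auto using Rabs_pos.
  - replace (f x y * g x y - f x' y' * g x' y')
      with ((f x y - f x' y') * g x y + f x' y' * (g x y - g x' y')) by ring.
    eapply Rle_trans; [apply Rabs_triang|]. rewrite !Rabs_mult.
    set (D := Rabs (x - x') + Rabs (y - y')) in *.
    replace ((L * M' + M * L') * D) with ((L * D) * M' + M * (L' * D)) by ring.
    apply Rplus_le_compat; apply Rmult_le_compat; auto using Rabs_pos.
Qed.

Lemma loc_lipschitz_opp (f : R -> R -> R) :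
  loc_lipschitz f -> loc_lipschitz (fun x y => - f x y).
Proof.
  intros Hf B. destruct (Hf B) as [M [L [HM [HL H]]]].
  exists M, L. split; [easy|]. split; [easy|]. intros x y x' y' h1 h2 h3 h4.
  destruct (H x y x' y' h1 h2 h3 h4) as [B1 D1].
  rewrite Rabs_Ropp. split; [easy|].
  replace (- f x y - - f x' y') with (- (f x y - f x' y')) by ring.
  now rewrite Rabs_Ropp.
Qed.

Lemma continuous_bounded (f : R -> R) (a b : R) : a <= b ->
  (forall t, a <= t <= b -> continuity_pt f t) ->
  exists M, forall t, a <= t <= b -> Rabs (f t) <= M.
Proof.
  intros Hab Hf.
  destruct (continuity_ab_maj f a b Hab Hf) as [p [Hp _]].
  destruct (continuity_ab_min f a b Hab Hf) as [q [Hq _]].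
  exists (Rabs (f p) + Rabs (f q)). intros t Ht.
  specialize (Hp t Ht). specialize (Hq t Ht).
  pose proof (Rle_abs (f p)). pose proof (Rabs_maj2 (f q)).
  pose proof (Rabs_pos (f p)). pose proof (Rabs_pos (f q)).
  apply Rabs_le. lra.
Qed.

(** A center supplies its periodic orbits as arbitrary curves; this identifies them with those built
    in quasi-polar form. The squared distance of two solutions satisfies the hypotheses of
    [gronwall_zero]. *)
Lemma planar_uniqueness (f g : R -> R -> R) (a b t0 : R) (x y x' y' : R -> R) :
  loc_lipschitz f -> loc_lipschitz g -> a <= t0 <= b ->
  (forall t, a <= t <= b ->
     is_derive x t (f (x t) (y t)) /\ is_derive y t (g (x t) (y t))) ->
  (forall t, a <= t <= b ->
     is_derive x' t (f (x' t) (y' t)) /\ is_derive y' t (g (x' t) (y' t))) ->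
  x t0 = x' t0 -> y t0 = y' t0 ->
  forall t, a <= t <= b -> x t = x' t /\ y t = y' t.
Proof.
  intros Hf Hg Ht0 H H' Ex Ey.
  assert (Hab : a <= b) by lra.
  destruct (continuous_bounded x a b Hab) as [B1 HB1];
    [intros t Ht; exact (is_derive_continuity_pt _ _ _ (proj1 (H t Ht)))|].
  destruct (continuous_bounded y a b Hab) as [B2 HB2];
    [intros t Ht; exact (is_derive_continuity_pt _ _ _ (proj2 (H t Ht)))|].
  destruct (continuous_bounded x' a b Hab) as [B3 HB3];
    [intros t Ht; exact (is_derive_continuity_pt _ _ _ (proj1 (H' t Ht)))|].
  destruct (continuous_bounded y' a b Hab) as [B4 HB4];
    [intros t Ht; exact (is_derive_continuity_pt _ _ _ (proj2 (H' t Ht)))|].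
  set (B := Rmax (Rmax B1 B2) (Rmax B3 B4)).
  assert (HB : B1 <= B /\ B2 <= B /\ B3 <= B /\ B4 <= B).
  { unfold B. pose proof (Rmax_l (Rmax B1 B2) (Rmax B3 B4)).
    pose proof (Rmax_r (Rmax B1 B2) (Rmax B3 B4)).
    pose proof (Rmax_l B1 B2). pose proof (Rmax_r B1 B2).
    pose proof (Rmax_l B3 B4). pose proof (Rmax_r B3 B4). lra. }
  destruct (Hf B) as [M1 [L1 [_ [HL1 F1]]]]. destruct (Hg B) as [M2 [L2 [_ [HL2 F2]]]].
  assert (Z : forall t, a <= t <= b -> (x t - x' t) ^ 2 + (y t - y' t) ^ 2 = 0).
  { apply (gronwall_zero (fun t => (x t - x' t) ^ 2 + (y t - y' t) ^ 2)
      (fun t => 2 * (x t - x' t) * (f (x t) (y t) - f (x' t) (y' t))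
              + 2 * (y t - y' t) * (g (x t) (y t) - g (x' t) (y' t)))
      (4 * (L1 + L2)) a b t0 Ht0).
    - rewrite Ex, Ey. ring.
    - intros t Ht. eapply is_derive_eq.
      + apply (is_derive_plus (V := R_NormedModule)).
        * apply (is_derive_pow (fun t => x t - x' t) 2).
          exact (is_derive_minus (V := R_NormedModule) _ _ _ _ _
            (proj1 (H t Ht)) (proj1 (H' t Ht))).
        * apply (is_derive_pow (fun t => y t - y' t) 2).
          exact (is_derive_minus (V := R_NormedModule) _ _ _ _ _
            (proj2 (H t Ht)) (proj2 (H' t Ht))).
      + unfold minus, plus, opp; simpl. ring.
    - intros t _. pose proof (pow2_ge_0 (x t - x' t)). pose proof (pow2_ge_0 (y t - y' t)). lra.
    - intros t Ht.
      specialize (HB1 t Ht). specialize (HB2 t Ht). specialize (HB3 t Ht). specialize (HB4 t Ht).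
      destruct (F1 (x t) (y t) (x' t) (y' t)) as [_ D1]; try lra.
      destruct (F2 (x t) (y t) (x' t) (y' t)) as [_ D2]; try lra.
      rewrite <- (pow2_abs (x t - x' t)), <- (pow2_abs (y t - y' t)).
      eapply Rle_trans; [apply Rabs_triang|]. rewrite !Rabs_mult, (Rabs_right 2) by lra.
      pose proof (Rabs_pos (x t - x' t)) as P1. pose proof (Rabs_pos (y t - y' t)) as P2.
      set (p := Rabs (x t - x' t)) in *. set (q := Rabs (y t - y' t)) in *.
      apply Rle_trans with (2 * p * (L1 * (p + q)) + 2 * q * (L2 * (p + q))).
      + apply Rplus_le_compat; apply Rmult_le_compat_l; lra.
      + assert (0 <= (p - q) ^ 2) by apply pow2_ge_0.
        assert (p * (p + q) <= 2 * (p ^ 2 + q ^ 2)) by nra.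
        assert (q * (p + q) <= 2 * (p ^ 2 + q ^ 2)) by nra.
        assert (L1 * (p * (p + q)) <= L1 * (2 * (p ^ 2 + q ^ 2)))
          by (apply Rmult_le_compat_l; lra).
        assert (L2 * (q * (p + q)) <= L2 * (2 * (p ^ 2 + q ^ 2)))
          by (apply Rmult_le_compat_l; lra).
        lra. }
  intros t Ht. specialize (Z t Ht).
  pose proof (pow2_ge_0 (x t - x' t)). pose proof (pow2_ge_0 (y t - y' t)).
  split; apply Rminus_diag_uniq, (Rsqr_0_uniq _); unfold Rsqr; lra.
Qed.

(** * Comparison of arcs *)

(** [z] is the supremum of the points where [f] is nonnegative. *)
Lemma last_zero (f : R -> R) (a b : R) : a <= b ->
  (forall x, a <= x <= b -> continuity_pt f x) -> 0 <= f a -> f b < 0 ->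
  exists z, a <= z < b /\ f z = 0 /\ forall x, z < x <= b -> f x < 0.
Proof.
  intros Hab Hc Ha Hb.
  set (E x := a <= x <= b /\ 0 <= f x).
  destruct (completeness E) as [z [Hub Hlub]].
  { exists b. intros x [Hx _]. lra. }
  { exists a. split; [lra | easy]. }
  assert (Haz : a <= z) by (apply Hub; split; [lra | easy]).
  assert (Hzb : z <= b) by (apply Hlub; intros x [Hx _]; lra).
  assert (Hright : forall x, z < x <= b -> f x < 0).
  { intros x Hx. destruct (Rlt_dec (f x) 0) as [|N]; [easy|].
    assert (x <= z) by (apply Hub; split; lra). lra. }
  assert (Hz : 0 <= f z).
  { destruct (Rle_dec 0 (f z)) as [|N]; [easy|]. exfalso.
    destruct (Hc z ltac:(lra) (- f z) ltac:(lra)) as [d [Hd Hnear]].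
    assert (z <= z - d / 2); [|lra].
    apply Hlub. intros x [Hx Hfx]. destruct (Rle_dec x (z - d / 2)) as [|N']; [easy|].
    exfalso. assert (x <= z) by (apply Hub; now split).
    destruct (Req_dec x z) as [->|Hxz]; [lra|].
    specialize (Hnear x). simpl in Hnear. unfold R_dist in Hnear.
    assert (Rabs (f x - f z) < - f z).
    { apply Hnear. split; [split; [exact I | lra]|]. rewrite Rabs_left; lra. }
    apply Rabs_lt_between in H0. lra. }
  assert (Hzb' : z < b) by (destruct Hzb as [|E']; [easy | subst; lra]).
  exists z. split; [lra|]. split; [|exact Hright].
  destruct Hz as [Hz|Hz]; [exfalso | easy].
  destruct (Hc z ltac:(lra) (f z) Hz) as [d [Hd Hnear]].
  set (x := Rmin b (z + d / 2)).
  assert (Hx : z < x <= b /\ x <= z + d / 2).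
  { unfold x. split; [split; [apply Rmin_glb_lt; lra | apply Rmin_l] | apply Rmin_r]. }
  specialize (Hright x ltac:(lra)). specialize (Hnear x). simpl in Hnear.
  unfold R_dist in Hnear.
  assert (Rabs (f x - f z) < f z).
  { apply Hnear. split; [split; [exact I | lra]|]. rewrite Rabs_right; lra. }
  apply Rabs_lt_between in H. lra.
Qed.

Lemma derive_pos_right (f : R -> R) (x l : R) : is_derive f x l -> 0 < l ->
  exists d, 0 < d /\ forall h, 0 < h < d -> f x < f (x + h).
Proof.
  intros Hf Hl. apply is_derive_Reals in Hf.
  destruct (Hf l Hl) as [d Hd]. exists d. split; [apply cond_pos|]. intros h Hh.
  specialize (Hd h ltac:(lra)). rewrite (Rabs_right h) in Hd by lra.
  specialize (Hd ltac:(lra)). apply Rabs_lt_between in Hd.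
  assert (0 < (f (x + h) - f x) / h) by lra.
  assert (0 < (f (x + h) - f x) / h * h) by (apply Rmult_lt_0_compat; lra).
  replace ((f (x + h) - f x) / h * h) with (f (x + h) - f x) in H0 by (field; lra). lra.
Qed.

(* Half of a Lienard system [x' = phi x - y, y' = g x] on [0 <= x <= rho],
   with [g] of the order of [x^5] and [phi] of the order of [x^4]. *)
Record half_lienard (rho : R) (phi dphi g G : R -> R) : Prop := {
  hl_G : forall x, 0 <= x <= rho -> is_derive G x (g x);
  hl_G0 : G 0 = 0;
  hl_g : forall x, 0 < x <= rho -> x ^ 5 / 2 <= g x <= 2 * x ^ 5;
  hl_phi : forall x, 0 <= x <= rho -> is_derive phi x (dphi x);
  hl_phi0 : phi 0 = 0;
  hl_dphi : exists C, forall x, 0 <= x <= rho -> Rabs (dphi x) <= C * x ^ 3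
}.

(* [U] gives [x] as a function of [y]. *)
Record lienard_arc (rho A B : R) (phi g U : R -> R) : Prop := {
  la_cont : forall y, A <= y <= B -> continuity_pt U y;
  la_A : U A = 0;
  la_B : U B = 0;
  la_range : forall y, A < y < B -> 0 < U y <= rho;
  la_derive : forall y, A < y < B -> is_derive U y ((phi (U y) - y) / g (U y))
}.

Lemma half_lienard_G_bounds (rho : R) (phi dphi g G : R -> R) (x : R) :
  half_lienard rho phi dphi g G -> 0 <= x <= rho -> x ^ 6 / 12 <= G x <= x ^ 6 / 3.
Proof.
  intros H Hx.
  (* One monotonicity argument for both bounds: [s = 1], [c = / 2] for the lower one, [s = -1],
     [c = 2] for the upper one. *)
  assert (M : forall s c, 0 <= c -> (forall t, 0 < t <= rho -> 0 <= s * (g t - c * t ^ 5)) ->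
    0 <= s * (G x - c * x ^ 6 / 6)).
  { intros s c Hc Hs.
    replace 0 with (s * (G 0 - c * 0 ^ 6 / 6)) by (rewrite (hl_G0 _ _ _ _ _ H); simpl; field).
    assert (D : forall t, 0 <= t <= x ->
      is_derive (fun t => s * (G t - c * t ^ 6 / 6)) t (s * (g t - c * t ^ 5))).
    { intros t Ht. apply is_derive_scal. apply (is_derive_minus (V := R_NormedModule)).
      - apply (hl_G _ _ _ _ _ H). lra.
      - auto_derive; [auto | field]. }
    apply (derive_nonneg_le (fun t => s * (G t - c * t ^ 6 / 6)) (fun t => s * (g t - c * t ^ 5)));
      [lra | | |].
    - intros; apply D; lra.
    - intros; eapply is_derive_continuity_pt, D; lra.
    - intros; apply Hs; lra. }
  assert (L : 0 <= 1 * (G x - / 2 * x ^ 6 / 6)).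
  { apply M; [lra|]. intros t Ht. pose proof (hl_g _ _ _ _ _ H t Ht). lra. }
  assert (U : 0 <= -1 * (G x - 2 * x ^ 6 / 6)).
  { apply M; [lra|]. intros t Ht. pose proof (hl_g _ _ _ _ _ H t Ht). lra. }
  lra.
Qed.

Section Comparison.

Variables (rho A B : R) (phi1 dphi1 g1 G1 phi2 dphi2 g2 G2 U1 U2 : R -> R).
Hypothesis A_neg : A < 0.
Hypothesis H1 : half_lienard rho phi1 dphi1 g1 G1.
Hypothesis H2 : half_lienard rho phi2 dphi2 g2 G2.
Hypothesis arc1 : lienard_arc rho A B phi1 g1 U1.
Hypothesis arc2 : lienard_arc rho A B phi2 g2 U2.
Hypothesis order : forall x1 x2, 0 < x1 <= rho -> 0 < x2 <= rho -> G1 x1 = G2 x2 ->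
  phi2 x2 < phi1 x1.

(** The arcs are compared through the values of [G] and not of [x], because [order] speaks of points
    with [G1 x1 = G2 x2]: a zero of the gap is exactly a place where [order] makes its derivative
    positive. *)
Definition gap (y : R) : R := G1 (U1 y) - G2 (U2 y).

Lemma arc_G_derive (phi dphi g G U : R -> R) (y : R) :
  half_lienard rho phi dphi g G -> lienard_arc rho A B phi g U -> A < y < B ->
  is_derive (fun y => G (U y)) y (phi (U y) - y).
Proof.
  intros H arc Hy. pose proof (la_range _ _ _ _ _ _ arc y Hy) as R0.
  pose proof (hl_g _ _ _ _ _ H _ R0). assert (0 < U y ^ 5) by (apply pow_lt; lra).
  eapply is_derive_eq.
  - apply (is_derive_comp G U); [apply (hl_G _ _ _ _ _ H); lra | now apply (la_derive _ _ _ _ _ _ arc)].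
  - unfold scal; simpl; unfold mult; simpl. field. lra.
Qed.

Lemma gap_derive (y : R) : A < y < B -> is_derive gap y (phi1 (U1 y) - phi2 (U2 y)).
Proof.
  intros Hy. eapply is_derive_eq.
  - apply (is_derive_minus (V := R_NormedModule));
      [now apply (arc_G_derive phi1 dphi1 g1) | now apply (arc_G_derive phi2 dphi2 g2)].
  - unfold minus, plus, opp; simpl. ring.
Qed.

Lemma arc_range_le (phi dphi g G U : R -> R) (y : R) :
  half_lienard rho phi dphi g G -> lienard_arc rho A B phi g U -> 0 <= rho ->
  A <= y <= B -> 0 <= U y <= rho.
Proof.
  intros H arc Hrho Hy.
  destruct (Req_dec y A) as [->|]; [rewrite (la_A _ _ _ _ _ _ arc); lra|].
  destruct (Req_dec y B) as [->|]; [rewrite (la_B _ _ _ _ _ _ arc); lra|].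
  pose proof (la_range _ _ _ _ _ _ arc y ltac:(lra)). lra.
Qed.

Lemma gap_continuous (y : R) : 0 <= rho -> A <= y <= B -> continuity_pt gap y.
Proof.
  intros Hrho Hy. apply continuity_pt_minus.
  - apply (continuity_pt_comp U1 G1); [now apply (la_cont _ _ _ _ _ _ arc1)|].
    eapply is_derive_continuity_pt, (hl_G _ _ _ _ _ H1).
    now apply (arc_range_le phi1 dphi1 g1 G1).
  - apply (continuity_pt_comp U2 G2); [now apply (la_cont _ _ _ _ _ _ arc2)|].
    eapply is_derive_continuity_pt, (hl_G _ _ _ _ _ H2).
    now apply (arc_range_le phi2 dphi2 g2 G2).
Qed.

Lemma gap_zero_derive_pos (y : R) : A < y < B -> gap y = 0 -> 0 < phi1 (U1 y) - phi2 (U2 y).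
Proof.
  intros Hy E. unfold gap in E.
  pose proof (la_range _ _ _ _ _ _ arc1 y Hy). pose proof (la_range _ _ _ _ _ _ arc2 y Hy).
  pose proof (order (U1 y) (U2 y) H H0 ltac:(lra)). lra.
Qed.

(* Where arc 1 lies inside arc 2, the gap satisfies a differential inequality
   whose coefficient blows up as [1 / U1^2]. *)
Lemma gap_derive_lower : exists C, 0 <= C /\ forall y, A < y < B -> gap y < 0 ->
  8 * C * gap y / U1 y ^ 2 <= phi1 (U1 y) - phi2 (U2 y).
Proof.
  destruct (hl_dphi _ _ _ _ _ H2) as [C0 HC0].
  exists (Rabs C0). split; [apply Rabs_pos|]. intros y Hy Hg.
  set (C := Rabs C0).
  assert (HC : forall x, 0 <= x <= rho -> Rabs (dphi2 x) <= C * x ^ 3).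
  { intros x Hx. eapply Rle_trans; [now apply HC0|].
    apply Rmult_le_compat_r; [apply pow_le; lra | apply Rle_abs]. }
  assert (HCp : 0 <= C) by apply Rabs_pos.
  pose proof (la_range _ _ _ _ _ _ arc1 y Hy) as R1.
  pose proof (la_range _ _ _ _ _ _ arc2 y Hy) as R2.
  unfold gap in *. set (u1 := U1 y) in *. set (u2 := U2 y) in *.
  pose proof (half_lienard_G_bounds _ _ _ _ _ u1 H1 ltac:(lra)) as B1.
  assert (P1 : 0 < u1 ^ 6) by (apply pow_lt; lra).
  assert (G20 : G2 0 = 0) by apply (hl_G0 _ _ _ _ _ H2).
  (* [x] is the point below [u2] at the level of [u1]. There [order] gives [phi2 x < phi1 u1], and
     only the variation of [phi2] between [x] and [u2] remains to be bounded. *)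
  destruct (ivt_interval G2 0 u2 (G1 u1)) as [x [Hx Ex]].
  { lra. }
  { intros z Hz. eapply is_derive_continuity_pt, (hl_G _ _ _ _ _ H2). lra. }
  { lra. }
  assert (Hx0 : 0 < x) by (destruct (Req_dec x 0) as [->|]; lra).
  (* Otherwise [G2 x <= (u1 / 2)^6 / 3], which is less than [u1^6 / 12 <= G1 u1]. *)
  assert (Hxu : u1 / 2 <= x).
  { destruct (Rle_dec (u1 / 2) x) as [|N]; [easy|]. exfalso.
    pose proof (half_lienard_G_bounds _ _ _ _ _ x H2 ltac:(lra)) as B2.
    assert (x ^ 6 <= (u1 / 2) ^ 6) by (apply pow_incr; lra).
    replace ((u1 / 2) ^ 6) with (u1 ^ 6 / 64) in H by field. lra. }
  pose proof (order u1 x ltac:(lra) ltac:(lra) ltac:(lra)) as Ho.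
  (* From [dphi2 t <= C t^3] and [g2 t >= t^5 / 2] follows [dphi2 t <= 2 C / t^2 * g2 t], so beyond
     [x] the function [phi2] grows at most [k] times as fast as [G2]. *)
  set (k := 2 * C / x ^ 2).
  assert (Hk : 0 <= k) by (apply Rle_mult_inv_pos; [lra | now apply pow_lt]).
  assert (M : k * G2 x - phi2 x <= k * G2 u2 - phi2 u2).
  { assert (D : forall t, x <= t <= u2 ->
      is_derive (fun t => k * G2 t - phi2 t) t (k * g2 t - dphi2 t)).
    { intros t Ht. apply (is_derive_minus (V := R_NormedModule)).
      - apply is_derive_scal, (hl_G _ _ _ _ _ H2). lra.
      - apply (hl_phi _ _ _ _ _ H2). lra. }
    apply (derive_nonneg_le (fun t => k * G2 t - phi2 t) (fun t => k * g2 t - dphi2 t)).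
    - lra.
    - intros; apply D; lra.
    - intros; eapply is_derive_continuity_pt, D; lra.
    - intros t Ht. pose proof (hl_g _ _ _ _ _ H2 t ltac:(lra)) as Gt.
      pose proof (HC t ltac:(lra)) as Dt. pose proof (Rle_abs (dphi2 t)).
      assert (C * t ^ 3 <= k * g2 t); [|lra].
      apply Rle_trans with (k * (t ^ 5 / 2)); [|apply Rmult_le_compat_l; lra].
      unfold k. replace (2 * C / x ^ 2 * (t ^ 5 / 2)) with (C * t ^ 3 * (t ^ 2 / x ^ 2))
        by (field; lra).
      rewrite <- (Rmult_1_r (C * t ^ 3)) at 1. apply Rmult_le_compat_l.
      + apply Rmult_le_pos; [easy | apply pow_le; lra].
      + apply Rle_div_r; [now apply pow_lt|]. rewrite Rmult_1_l. apply pow_incr. lra. }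
  assert (Hk8 : k <= 8 * C / u1 ^ 2).
  { unfold k. apply (Rmult_le_reg_r (u1 ^ 2)); [apply pow_lt; lra|].
    replace (2 * C / x ^ 2 * u1 ^ 2) with (2 * C * (u1 ^ 2 / x ^ 2)) by (field; lra).
    replace (8 * C / u1 ^ 2 * u1 ^ 2) with (2 * C * 4) by (field; lra). apply Rmult_le_compat_l; [lra|].
    apply Rle_div_l; [now apply pow_lt|].
    assert (u1 ^ 2 <= (2 * x) ^ 2) by (apply pow_incr; lra). lra. }
  replace (8 * C * (G1 u1 - G2 u2) / u1 ^ 2)
    with (8 * C / u1 ^ 2 * (G1 u1 - G2 u2)) by (field; lra).
  nra.
Qed.

(** A negative value would come after a last zero of the gap. An interior zero is impossible, since
    the gap increases through it; the last zero would be the end point [A], where the differential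
    inequality is singular. *)
Lemma gap_nonneg (y : R) : A < y < B -> 0 <= gap y.
Proof.
  intros Hy. destruct (Rle_dec 0 (gap y)) as [|N]; [easy|]. exfalso.
  assert (Hrho : 0 <= rho) by (pose proof (la_range _ _ _ _ _ _ arc1 y Hy); lra).
  assert (GA : gap A = 0).
  { unfold gap. rewrite (la_A _ _ _ _ _ _ arc1), (la_A _ _ _ _ _ _ arc2),
      (hl_G0 _ _ _ _ _ H1), (hl_G0 _ _ _ _ _ H2). ring. }
  destruct (last_zero gap A y) as [z [Hz [Gz Hneg]]];
    [lra | intros; apply gap_continuous; lra | lra | lra |].
  assert (z = A) as ->.
  { destruct (Req_dec z A) as [|Hne]; [easy|]. exfalso.
    assert (Hz' : A < z < B) by lra.
    destruct (derive_pos_right gap z _ (gap_derive z Hz') (gap_zero_derive_pos z Hz' Gz))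
      as [d [Hd Hinc]].
    set (h := Rmin (d / 2) (y - z)).
    assert (Hh : 0 < h /\ h <= d / 2 /\ h <= y - z).
    { unfold h. split; [apply Rmin_glb_lt; lra | split; [apply Rmin_l | apply Rmin_r]]. }
    specialize (Hinc h ltac:(lra)). specialize (Hneg (z + h) ltac:(lra)). lra. }
  (* Close to the end point [A] the arc leaves the axis fast enough for the
     weight [exp (- K U1^4)] to absorb the singular coefficient. *)
  destruct gap_derive_lower as [C [HC Hlow]].
  assert (Hphi : continuity_pt (fun y => phi1 (U1 y)) A).
  { apply (continuity_pt_comp U1 phi1); [apply (la_cont _ _ _ _ _ _ arc1); lra|].
    rewrite (la_A _ _ _ _ _ _ arc1).
    eapply is_derive_continuity_pt, (hl_phi _ _ _ _ _ H1). lra. }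
  destruct (Hphi (- A / 4) ltac:(lra)) as [d [Hd Hnear]].
  (* Up to [b] one has [- t >= - A / 2] and [phi1 (U1 t)] below [- A / 4] in absolute value, so that
     [phi1 (U1 t) - t >= - A / 4]. *)
  set (b := Rmin y (Rmin (A / 2) (A + d / 2))).
  assert (Hb : A < b /\ b <= y /\ b <= A / 2 /\ b <= A + d / 2).
  { unfold b. pose proof (Rmin_r y (Rmin (A / 2) (A + d / 2))).
    pose proof (Rmin_l (A / 2) (A + d / 2)). pose proof (Rmin_r (A / 2) (A + d / 2)).
    split; [repeat apply Rmin_glb_lt; lra|]. split; [apply Rmin_l | lra]. }
  assert (Hphi4 : forall t, A < t <= b -> - A / 4 <= phi1 (U1 t) - t).
  { intros t Ht. specialize (Hnear t). simpl in Hnear. unfold R_dist in Hnear.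
    rewrite (la_A _ _ _ _ _ _ arc1), (hl_phi0 _ _ _ _ _ H1) in Hnear.
    assert (N' : Rabs (phi1 (U1 t) - 0) < - A / 4).
    { apply Hnear. split; [split; [exact I | lra]|]. rewrite Rabs_right; lra. }
    apply Rabs_lt_between in N'. lra. }
  (* Since the derivative of [U1] is at least [- A / 4 / (2 * U1^5)], this choice makes the
     derivative of [K * U1^4] at least [8 * C / U1^2], the coefficient found in
     [gap_derive_lower]. *)
  set (K := 16 * C / (- A)).
  assert (HK : 0 <= K) by (apply Rle_mult_inv_pos; lra).
  assert (D : forall t, A < t < B ->
    is_derive (fun t => gap t * exp (- (K * U1 t ^ 4))) t
      (exp (- (K * U1 t ^ 4)) * ((phi1 (U1 t) - phi2 (U2 t))
        - 4 * K * U1 t ^ 3 * ((phi1 (U1 t) - t) / g1 (U1 t)) * gap t))).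
  { intros t Ht. eapply is_derive_eq.
    - apply (is_derive_mult gap (fun t => exp (- (K * U1 t ^ 4)))).
      + now apply gap_derive.
      + apply (is_derive_comp exp (fun t => - (K * U1 t ^ 4))); [apply is_derive_exp|].
        apply (is_derive_opp (V := R_NormedModule)), is_derive_scal, is_derive_pow.
        now apply (la_derive _ _ _ _ _ _ arc1).
      + intros; apply Rmult_comm.
    - unfold plus, scal, opp; simpl; unfold mult; simpl. ring. }
  assert (W : gap A * exp (- (K * U1 A ^ 4)) <= gap b * exp (- (K * U1 b ^ 4))).
  { apply (derive_nonneg_le (fun t => gap t * exp (- (K * U1 t ^ 4)))
      (fun t => exp (- (K * U1 t ^ 4)) * ((phi1 (U1 t) - phi2 (U2 t))
        - 4 * K * U1 t ^ 3 * ((phi1 (U1 t) - t) / g1 (U1 t)) * gap t))).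
    - lra.
    - intros; apply D; lra.
    - intros t Ht. apply continuity_pt_mult; [apply gap_continuous; lra|].
      apply (continuity_pt_comp (fun t => - (K * U1 t ^ 4)) exp);
        [|apply derivable_continuous_pt, derivable_pt_exp].
      apply continuity_pt_opp, continuity_pt_scal.
      apply (continuity_pt_comp U1 (fun x => x ^ 4));
        [apply (la_cont _ _ _ _ _ _ arc1); lra | apply derivable_continuous_pt; reg].
    - intros t Ht. apply Rmult_le_pos; [left; apply exp_pos|].
      specialize (Hneg t ltac:(lra)). specialize (Hlow t ltac:(lra) Hneg).
      specialize (Hphi4 t ltac:(lra)).
      pose proof (la_range _ _ _ _ _ _ arc1 t ltac:(lra)) as R1.
      pose proof (hl_g _ _ _ _ _ H1 _ R1) as Gt.
      set (u := U1 t) in *. assert (U5 : 0 < u ^ 5) by (apply pow_lt; lra).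
      assert (Hq : - A / 4 / (2 * u ^ 5) <= (phi1 u - t) / g1 u).
      { apply (Rmult_le_reg_r (g1 u)); [lra|].
        replace (- A / 4 / (2 * u ^ 5) * g1 u) with (- A / 4 * (g1 u / (2 * u ^ 5)))
          by (field; lra).
        replace ((phi1 u - t) / g1 u * g1 u) with (phi1 u - t) by (field; lra).
        assert (0 <= g1 u / (2 * u ^ 5) <= 1).
        { split; [apply Rle_mult_inv_pos; lra | apply Rle_div_l; lra]. }
        nra. }
      assert (Hsing : 4 * K * u ^ 3 * (- A / 4 / (2 * u ^ 5)) * - gap t = 8 * C * - gap t / u ^ 2).
      { unfold K. field. lra. }
      assert (0 <= 4 * K * u ^ 3).
      { apply Rmult_le_pos; [lra | apply pow_le; lra]. }
      assert (4 * K * u ^ 3 * (- A / 4 / (2 * u ^ 5)) * - gap t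
        <= 4 * K * u ^ 3 * ((phi1 u - t) / g1 u) * - gap t).
      { apply Rmult_le_compat_r; [lra|]. now apply Rmult_le_compat_l. }
      replace (8 * C * - gap t / u ^ 2) with (- (8 * C * gap t / u ^ 2)) in Hsing by (field; lra).
      lra. }
  rewrite GA in W. specialize (Hneg b ltac:(lra)).
  pose proof (exp_pos (- (K * U1 b ^ 4))). nra.
Qed.

End Comparison.

(** [gap_nonneg] started from [A] gives a nonnegative gap, and applied to the reflected arcs in
    exchanged roles, thus started from [B], a nonpositive one. The gap would vanish identically,
    although its derivative is positive at each zero; the contradiction is read off at [y = 0]. *)
Lemma lienard_arcs_incompatible (rho A B : R) (phi1 dphi1 g1 G1 phi2 dphi2 g2 G2 U1 U2 : R -> R) :
  A < 0 < B ->
  half_lienard rho phi1 dphi1 g1 G1 -> half_lienard rho phi2 dphi2 g2 G2 ->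
  lienard_arc rho A B phi1 g1 U1 -> lienard_arc rho A B phi2 g2 U2 ->
  ~ (forall x1 x2, 0 < x1 <= rho -> 0 < x2 <= rho -> G1 x1 = G2 x2 -> phi2 x2 < phi1 x1).
Proof.
  intros HAB H1 H2 arc1 arc2 order.
  assert (Hle := gap_nonneg rho A B phi1 dphi1 g1 G1 phi2 dphi2 g2 G2 U1 U2
    ltac:(lra) H1 H2 arc1 arc2 order).
  (* The reflection [y -> - y] changes the sign of [phi]. *)
  assert (Hopp : forall phi dphi g G, half_lienard rho phi dphi g G ->
    half_lienard rho (fun x => - phi x) (fun x => - dphi x) g G).
  { intros phi dphi g G [HG HG0 Hg Hphi Hphi0 [C HC]]. split; auto.
    - intros x Hx. apply (is_derive_opp (V := R_NormedModule)). auto.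
    - rewrite Hphi0. ring.
    - exists C. intros x Hx. rewrite Rabs_Ropp. auto. }
  assert (Harc : forall phi g U, lienard_arc rho A B phi g U ->
    lienard_arc rho (- B) (- A) (fun x => - phi x) g (fun y => U (- y))).
  { intros phi g U [Hc HA HB Hr Hd]. split.
    - intros y Hy. apply (continuity_pt_comp (fun y => - y) U).
      + apply continuity_pt_opp, derivable_continuous_pt, derivable_pt_id.
      + apply Hc. lra.
    - now rewrite Ropp_involutive.
    - now rewrite Ropp_involutive.
    - intros y Hy. apply Hr. lra.
    - intros y Hy. eapply is_derive_eq.
      + apply (is_derive_comp U (fun y => - y)); [apply Hd; lra|].
        auto_derive; [auto | reflexivity].
      + unfold scal; simpl; unfold mult; simpl. unfold Rdiv. ring. }
  assert (Hge := gap_nonneg rho (- B) (- A) _ _ g2 G2 _ _ g1 G1 _ _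
    ltac:(lra) (Hopp _ _ _ _ H2) (Hopp _ _ _ _ H1) (Harc _ _ _ arc2) (Harc _ _ _ arc1)).
  assert (Hzero : forall y, A < y < B -> gap G1 G2 U1 U2 y = 0).
  { intros y Hy. specialize (Hle y Hy). specialize (Hge) with (y := - y).
    unfold gap in *. rewrite Ropp_involutive in Hge. apply Rle_antisym; [|easy].
    assert (0 <= G2 (U2 y) - G1 (U1 y)); [|lra]. apply Hge; [|lra].
    intros x1 x2 h1 h2 E. specialize (order x2 x1 h2 h1 ltac:(lra)). lra. }
  assert (H0 : A < 0 < B) by lra.
  pose proof (gap_zero_derive_pos rho A B phi1 g1 G1 phi2 g2 G2 U1 U2
    arc1 arc2 order 0 H0 (Hzero 0 H0)) as Hpos.
  destruct (derive_pos_right _ _ _ (gap_derive rho A B phi1 dphi1 g1 G1 phi2 dphi2 g2 G2 U1 U2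
    H1 H2 arc1 arc2 0 H0) Hpos) as [d [Hd Hinc]].
  set (h := Rmin (d / 2) (B / 2)).
  assert (Hh : 0 < h /\ h <= d / 2 /\ h <= B / 2).
  { unfold h. split; [apply Rmin_glb_lt; lra | split; [apply Rmin_l | apply Rmin_r]]. }
  specialize (Hinc h ltac:(lra)). rewrite (Hzero 0), (Hzero (0 + h)) in Hinc by lra. lra.
Qed.

(** The derivative of [q] may vanish at the end points, as it does where an orbit crosses the [y]
    axis; there the graph is only claimed to be continuous. *)
Lemma curve_as_graph (p q P Q : R -> R) (a b : R) : a < b ->
  (forall t, a <= t <= b -> continuity_pt p t) ->
  (forall t, a <= t <= b -> continuity_pt q t) ->
  (forall t, a < t < b -> is_derive p t (P t) /\ is_derive q t (Q t) /\ 0 < Q t) ->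
  exists U, (forall y, q a <= y <= q b -> continuity_pt U y) /\ U (q a) = p a /\ U (q b) = p b /\
    forall y, q a < y < q b ->
      exists t, a < t < b /\ q t = y /\ U y = p t /\ is_derive U y (P t / Q t).
Proof.
  intros Hab Hp Hq Hd.
  set (cl t := Rmax a (Rmin b t)).
  assert (Hcl : forall t, a <= cl t <= b).
  { intros t. unfold cl. split; [apply Rmax_l|]. apply Rmax_lub; [lra | apply Rmin_l]. }
  assert (Hclin : forall t, a <= t <= b -> cl t = t).
  { intros t Ht. unfold cl. rewrite Rmin_right, Rmax_right; lra. }
  assert (Hclc : forall t, continuity_pt cl t).
  { intros t e He. exists e. split; [easy|]. intros s [_ Hs]. simpl in *. unfold R_dist in *.
    eapply Rle_lt_trans; [|exact Hs]. unfold cl, Rmax, Rmin.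
    destruct (Rle_dec b t), (Rle_dec b s), (Rle_dec a b); try lra;
      repeat destruct (Rle_dec a _); unfold Rabs; repeat destruct (Rcase_abs _); lra. }
  (* [q] is prolonged to an increasing function past the end points, so that
     the inverse is continuous there. *)
  set (qe t := q (cl t) + (t - cl t)).
  assert (Hqe : forall t, a <= t <= b -> qe t = q t).
  { intros t Ht. unfold qe. rewrite (Hclin t Ht). ring. }
  assert (Hqmono : forall s t, a <= s -> s < t -> t <= b -> q s < q t).
  { intros s t Hs Hst Ht. apply (derive_pos_lt q Q); auto.
    - intros x Hx. apply Hd. lra.
    - intros x Hx. apply Hq. lra.
    - intros x Hx. apply Hd. lra. }
  assert (Hqec : forall t, continuity_pt qe t).
  { intros t. apply continuity_pt_plus.
    - apply (continuity_pt_comp cl q); [apply Hclc | apply Hq, Hcl].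
    - apply continuity_pt_minus; [apply derivable_continuous_pt, derivable_pt_id | apply Hclc]. }
  assert (Hqemono : forall s t, s < t -> qe s < qe t).
  { intros s t Hst. unfold qe.
    assert (M : cl s <= cl t /\ s - cl s <= t - cl t /\ (cl s < cl t \/ s - cl s < t - cl t)).
    { unfold cl, Rmax, Rmin. destruct (Rle_dec b s), (Rle_dec b t);
        repeat destruct (Rle_dec a _); lra. }
    destruct M as [M1 [M2 M3]]. destruct (Req_dec (cl s) (cl t)) as [E|E].
    - rewrite E in *. lra.
    - pose proof (Hqmono (cl s) (cl t) (proj1 (Hcl s)) ltac:(lra) (proj2 (Hcl t))). lra. }
  assert (Hsurj : forall y, exists t, qe (a - 1) <= y <= qe (b + 1) -> a - 1 <= t <= b + 1 /\ qe t = y).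
  { intros y. destruct (Rle_dec (qe (a - 1)) y) as [L|N]; [|exists 0; lra].
    destruct (Rle_dec y (qe (b + 1))) as [L'|N]; [|exists 0; lra].
    destruct (ivt_interval qe (a - 1) (b + 1) y) as [t Ht]; [lra | auto | lra | now exists t]. }
  set (inv y := proj1_sig (constructive_indefinite_description _ (Hsurj y))).
  assert (Hinv : forall y, qe (a - 1) <= y <= qe (b + 1) -> a - 1 <= inv y <= b + 1 /\ qe (inv y) = y)
    by (intros y; unfold inv; apply proj2_sig).
  assert (Ea : qe a = q a) by (apply Hqe; lra). assert (Eb : qe b = q b) by (apply Hqe; lra).
  pose proof (Hqemono (a - 1) a ltac:(lra)) as La. pose proof (Hqemono b (b + 1) ltac:(lra)) as Lb.
  pose proof (Hqmono a b ltac:(lra) Hab ltac:(lra)) as Lab.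
  assert (Hinj : forall s t, qe s = qe t -> s = t).
  { intros s t E. destruct (Rtotal_order s t) as [L|[L|L]]; [|easy|];
      apply Hqemono in L; lra. }
  assert (Hinvc : forall y, q a <= y <= q b -> continuity_pt inv y).
  { intros y Hy. apply (inverse_continuity_pt qe inv (a - 1) (b + 1)); auto. lra. }
  assert (Hinvq : forall t, a <= t <= b -> inv (q t) = t).
  { intros t Ht. apply Hinj. rewrite (Hqe t Ht). apply Hinv.
    assert (q a <= q t <= q b).
    { split; [destruct (Req_dec a t) as [->|]; [lra|] | destruct (Req_dec t b) as [->|]; [lra|]];
        left; apply Hqmono; lra. }
    lra. }
  exists (fun y => p (cl (inv y))). split; [|split; [|split]].
  - intros y Hy. apply (continuity_pt_comp inv (fun t => p (cl t))); [now apply Hinvc|].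
    apply (continuity_pt_comp cl p); [apply Hclc | apply Hp, Hcl].
  - rewrite Hinvq by lra. now rewrite Hclin by lra.
  - rewrite Hinvq by lra. now rewrite Hclin by lra.
  - intros y Hy. destruct (Hinv y ltac:(lra)) as [_ Hy2].
    assert (Ht : a < inv y < b).
    { split.
      - destruct (Rlt_dec a (inv y)) as [|N]; [easy|].
        destruct (Req_dec (inv y) a) as [E|E]; [rewrite E in Hy2; lra|].
        pose proof (Hqemono (inv y) a ltac:(lra)). lra.
      - destruct (Rlt_dec (inv y) b) as [|N]; [easy|].
        destruct (Req_dec (inv y) b) as [E|E]; [rewrite E in Hy2; lra|].
        pose proof (Hqemono b (inv y) ltac:(lra)). lra. }
    set (t := inv y) in *.
    assert (Hqt : q t = y) by (rewrite <- (Hqe t); lra).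
    exists t. split; [easy|]. split; [easy|]. split; [now rewrite Hclin by lra|].
    destruct (Hd t Ht) as [DP [DQ HQ]].
    assert (Hloc : forall c f, 0 < c -> a < t - c -> t + c < b ->
      (forall z, q (t - c) < z < q (t + c) -> f z) -> locally y f).
    { intros c f Hc Hac Hbc Hf.
      pose proof (Hqmono (t - c) t ltac:(lra) ltac:(lra) ltac:(lra)).
      pose proof (Hqmono t (t + c) ltac:(lra) ltac:(lra) ltac:(lra)).
      assert (He : 0 < Rmin (y - q (t - c)) (q (t + c) - y)) by (apply Rmin_glb_lt; lra).
      exists (mkposreal _ He). intros z Hz.
      unfold ball in Hz; simpl in Hz; unfold AbsRing_ball, abs, minus, plus, opp in Hz; simpl in Hz.
      pose proof (Rmin_l (y - q (t - c)) (q (t + c) - y)).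
      pose proof (Rmin_r (y - q (t - c)) (q (t + c) - y)).
      apply Rabs_lt_between in Hz. apply Hf. lra. }
    set (c := Rmin (t - a) (b - t) / 2).
    assert (Hc : 0 < c /\ a < t - c /\ t + c < b).
    { unfold c, Rmin. destruct (Rle_dec (t - a) (b - t)); lra. }
    destruct Hc as [Hc1 [Hc2 Hc3]].
    assert (Hwin : forall z, q (t - c) < z < q (t + c) -> a < inv z < b /\ q (inv z) = z).
    { intros z Hz.
      pose proof (Hqmono a (t - c) ltac:(lra) ltac:(lra) ltac:(lra)).
      pose proof (Hqmono (t + c) b ltac:(lra) ltac:(lra) ltac:(lra)).
      destruct (ivt_interval q a b z) as [s [Hs Es]]; [lra | auto | lra |].
      rewrite <- Es, Hinvq by easy. split; [|easy].
      destruct (Req_dec s a) as [->|]; [lra|]. destruct (Req_dec s b) as [->|]; [lra|]. lra. }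
    apply (is_derive_ext_loc (fun z => p (inv z))).
    { apply (Hloc c); auto. intros z Hz. destruct (Hwin z Hz) as [W _].
      now rewrite Hclin by lra. }
    eapply is_derive_eq.
    + apply (is_derive_comp p inv); [exact DP|].
      apply (is_derive_inverse q inv y (Q t)); [apply Hinvc; lra | | exact DQ | lra].
      apply (Hloc c); auto. intros z Hz. now apply Hwin.
    + unfold scal; simpl; unfold mult; simpl. unfold Rdiv. ring.
Qed.

(** * Jets of polynomials *)

(* Lists of coefficients, lowest degree first. *)
Fixpoint peval (l : list R) (z : R) : R :=
  match l with nil => 0 | c :: l' => c + z * peval l' z end.

Fixpoint padd (l k : list R) : list R :=
  match l, k with
  | nil, _ => k
  | _, nil => l
  | a :: l', b :: k' => (a + b) :: padd l' k'
  end.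

Definition pscale (a : R) (l : list R) : list R := map (Rmult a) l.

Fixpoint pmul (l k : list R) : list R :=
  match l with nil => nil | a :: l' => padd (pscale a k) (0 :: pmul l' k) end.

Lemma peval_add l k z : peval (padd l k) z = peval l z + peval k z.
Proof.
  revert k. induction l as [|a l IH]; intros [|b k]; simpl; try ring.
  rewrite IH. ring.
Qed.

Lemma peval_scale a l z : peval (pscale a l) z = a * peval l z.
Proof. unfold pscale. induction l as [|b l IH]; simpl; [|rewrite IH]; ring. Qed.

Lemma peval_mul l k z : peval (pmul l k) z = peval l z * peval k z.
Proof.
  induction l as [|a l IH]; simpl; [ring|].
  rewrite peval_add, peval_scale. simpl. rewrite IH. ring.
Qed.

Lemma peval_bounded (l : list R) : exists C, 0 <= C /\ forall z, Rabs z <= 1 -> Rabs (peval l z) <= C.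
Proof.
  induction l as [|a l [C [HC IH]]]; simpl.
  - exists 0. split; [lra|]. intros. rewrite Rabs_R0. lra.
  - exists (Rabs a + C). pose proof (Rabs_pos a). split; [lra|]. intros z Hz.
    eapply Rle_trans; [apply Rabs_triang|]. rewrite Rabs_mult.
    specialize (IH z Hz). pose proof (Rabs_pos z). pose proof (Rabs_pos (peval l z)). nra.
Qed.

Lemma peval_flat (n : nat) (l : list R) : (forall k, (k < n)%nat -> nth k l 0 = 0) ->
  exists C, 0 <= C /\ forall z, Rabs z <= 1 -> Rabs (peval l z) <= C * Rabs z ^ n.
Proof.
  revert l. induction n as [|n IH]; intros l Hl.
  - destruct (peval_bounded l) as [C [HC H]]. exists C. split; [easy|].
    intros z Hz. rewrite pow_O, Rmult_1_r. now apply H.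
  - destruct l as [|a l].
    + exists 0. split; [lra|]. intros z _. simpl. rewrite Rabs_R0. lra.
    + destruct (IH l) as [C [HC H]].
      * intros k Hk. apply (Hl (S k)). lia.
      * exists C. split; [easy|]. intros z Hz. simpl.
        specialize (Hl O ltac:(lia)). simpl in Hl. rewrite Hl, Rplus_0_l, Rabs_mult.
        specialize (H z Hz). pose proof (Rabs_pos z). nra.
Qed.

(** * The normalizing coordinate and the sign of the odd part *)

Section Jets.
Variables al be ga : R.

(* The substitution [x = z * peval norm_coord z] turns the primitive of
   [x^5 / (1 - al x - be x^2)] into [z^6 / 6], up to order 12. *)
Definition norm_coord : list R :=
  [ 1;
    - 1 / 7 * al;
    - 13 / 392 * al ^ 2 - 1 / 8 * be;
    - 127 / 12348 * al ^ 3 - 11 / 252 * al * be;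
    - 46201 / 13829760 * al ^ 4 - 2461 / 141120 * al ^ 2 * be - 9 / 640 * be ^ 2;
    - 45487 / 44370480 * al ^ 5 - 969 / 150920 * al ^ 3 * be - 167 / 18480 * al * be ^ 2 ].

(* The same substitution turns [x^4 (1 + ga x) / (1 - al x - be x^2)] into
   [z^4 * peval phi_jet z], up to order 10. *)
Definition phi_jet1 : R := 3 / 7 * al + ga.
Definition phi_jet2 : R := 27 / 98 * al ^ 2 + 2 / 7 * al * ga + 1 / 2 * be.
Definition phi_jet3 : R :=
  4573 / 24696 * al ^ 3 + 71 / 392 * al ^ 2 * ga + 281 / 504 * al * be + 3 / 8 * be * ga.
Definition phi_jet4 : R :=
  10247 / 82320 * al ^ 4 + 107 / 882 * al ^ 3 * ga + 437 / 840 * al ^ 2 * be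
  + 7 / 18 * al * be * ga + 23 / 80 * be ^ 2.
Definition phi_jet5 : R :=
  280053 / 3380608 * al ^ 5 + 10687 / 131712 * al ^ 4 * ga + 45811 / 103488 * al ^ 3 * be
  + 475 / 1344 * al ^ 2 * be * ga + 14593 / 29568 * al * be ^ 2 + 27 / 128 * be ^ 2 * ga.
Definition phi_jet : list R := [1; phi_jet1; phi_jet2; phi_jet3; phi_jet4; phi_jet5].

Definition coord (z : R) : R := z * peval norm_coord z.
Definition qf (x : R) : R := 1 - al * x - be * x ^ 2.

(** The coefficients of the derivative of [z ^ n * peval l z], with the factor [z ^ (n - 1)] taken
    out. *)
Fixpoint pder (n : nat) (l : list R) : list R :=
  match l with nil => nil | c :: l' => INR n * c :: pder (S n) l' end.

Lemma is_derive_peval (n : nat) (l : list R) (z : R) :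
  is_derive (fun z => z ^ S n * peval l z) z (z ^ n * peval (pder (S n) l) z).
Proof.
  revert n. induction l as [|c l IH]; intros n; cbn [peval pder].
  - eapply is_derive_eq; [|symmetry; apply Rmult_0_r].
    apply (is_derive_ext (fun _ => 0)); [intros; symmetry; apply Rmult_0_r|]. apply (is_derive_const 0 z).
  - apply (is_derive_ext (fun z => c * z ^ S n + z ^ S (S n) * peval l z));
      [intros; simpl; ring|].
    eapply is_derive_eq.
    + apply (is_derive_plus (V := R_NormedModule)); [|apply IH].
      apply is_derive_scal, (is_derive_pow (fun z => z)), is_derive_id.
    + unfold plus, one; cbn -[INR pow]. rewrite <- (tech_pow_Rmult z n). ring.
Qed.

Lemma coord_derive (z : R) : is_derive coord z (peval (pder 1 norm_coord) z).
Proof.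
  eapply is_derive_eq.
  - apply (is_derive_ext (fun z => z ^ 1 * peval norm_coord z));
      [intros; unfold coord; simpl; ring|]. apply (is_derive_peval 0).
  - ring.
Qed.

Definition qf_jet : list R :=
  padd [1] (padd (pscale (- al) (0 :: norm_coord))
    (pscale (- be) (0 :: 0 :: pmul norm_coord norm_coord))).

Lemma qf_jet_eval (z : R) : peval qf_jet z = qf (coord z).
Proof.
  unfold qf_jet, qf, coord. rewrite !peval_add, !peval_scale.
  cbn [peval]. rewrite peval_mul. ring.
Qed.

Ltac first_six := intros k Hk; do 6 (destruct k as [|k]; [cbn; unfold phi_jet1, phi_jet2, phi_jet3, phi_jet4, phi_jet5; field|]); lia.

(** The left side is [qf (coord z)] times the derivative of [G (coord z) - z^6 / 6] when
    [G' = x^5 / qf]. Clearing the denominator leaves a polynomial, of which [norm_coord] is designed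
    to cancel the first six coefficients after the factor [z^5]. *)
Lemma norm_coord_flat : exists C, 0 <= C /\ forall z, Rabs z <= 1 ->
  Rabs (coord z ^ 5 * peval (pder 1 norm_coord) z - z ^ 5 * qf (coord z)) <= C * Rabs z ^ 11.
Proof.
  set (n2 := pmul norm_coord norm_coord).
  destruct (peval_flat 6 (padd (pmul (pmul norm_coord (pmul n2 n2)) (pder 1 norm_coord))
     (pscale (-1) qf_jet))) as [C [HC H]].
  - first_six.
  - exists C. split; [easy|]. intros z Hz. specialize (H z Hz).
    rewrite peval_add, peval_scale, qf_jet_eval in H. unfold n2 in H. rewrite !peval_mul in H.
    replace (coord z ^ 5 * peval (pder 1 norm_coord) z - z ^ 5 * qf (coord z)) with
      (z ^ 5 * (peval norm_coord z * (peval norm_coord z * peval norm_coord z *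
        (peval norm_coord z * peval norm_coord z)) * peval (pder 1 norm_coord) z
        + -1 * qf (coord z))) by (unfold coord; ring).
    rewrite Rabs_mult, <- RPow_abs.
    replace (C * Rabs z ^ 11) with (Rabs z ^ 5 * (C * Rabs z ^ 6)) by ring.
    apply Rmult_le_compat_l; [apply pow_le, Rabs_pos | exact H].
Qed.

Lemma phi_jet_flat : exists C, 0 <= C /\ forall z, Rabs z <= 1 ->
  Rabs (coord z ^ 4 * (1 + ga * coord z) - z ^ 4 * peval phi_jet z * qf (coord z))
    <= C * Rabs z ^ 10.
Proof.
  set (n2 := pmul norm_coord norm_coord).
  destruct (peval_flat 6 (padd (pmul (pmul n2 n2) (padd [1] (pscale ga (0 :: norm_coord))))
     (pscale (-1) (pmul phi_jet qf_jet)))) as [C [HC H]].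
  - first_six.
  - exists C. split; [easy|]. intros z Hz. specialize (H z Hz).
    unfold n2 in H. rewrite !peval_add, !peval_scale, !peval_mul, qf_jet_eval, peval_add, peval_scale in H.
    replace (coord z ^ 4 * (1 + ga * coord z) - z ^ 4 * peval phi_jet z * qf (coord z)) with
      (z ^ 4 * (peval norm_coord z * peval norm_coord z *
        (peval norm_coord z * peval norm_coord z) *
        (peval [1] z + ga * peval (0 :: norm_coord) z)
        + -1 * (peval phi_jet z * qf (coord z))))
      by (cbn [peval]; unfold coord; ring).
    rewrite Rabs_mult, <- RPow_abs.
    replace (C * Rabs z ^ 10) with (Rabs z ^ 4 * (C * Rabs z ^ 6)) by ring.
    apply Rmult_le_compat_l; [apply pow_le, Rabs_pos | exact H].
Qed.

(** The first equation determines [ga] from [al]. The second is then [al] times a combination of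
    [al^2] and [be], and determines [be]. Substituted into [phi_jet5], both leave a nonzero multiple
    of [al^5]. *)
Lemma phi_jets_nonzero : al <> 0 \/ ga <> 0 ->
  phi_jet1 <> 0 \/ phi_jet3 <> 0 \/ phi_jet5 <> 0.
Proof.
  intros H.
  destruct (Req_dec phi_jet1 0) as [H1|]; [|now left].
  destruct (Req_dec phi_jet3 0) as [H3|]; [|now right; left].
  right; right. intros H5. unfold phi_jet1 in H1.
  assert (Hga : ga = - 3 / 7 * al) by lra.
  assert (Hal : al <> 0) by (destruct H as [|H]; [easy | intros ->; apply H; lra]).
  assert (Hbe : be = - 332 / 1225 * al ^ 2).
  { unfold phi_jet3 in H3. rewrite Hga in H3.
    apply (Rmult_eq_reg_l al); [|easy]. lra. }
  unfold phi_jet5 in H5. rewrite Hga, Hbe in H5.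
  assert (al ^ 5 <> 0) by now apply pow_nonzero. lra.
Qed.

Lemma pow_diff_le (m x y : R) (n : nat) : Rabs x <= m -> Rabs y <= m ->
  Rabs (x ^ S n - y ^ S n) <= INR (S n) * m ^ n * Rabs (x - y).
Proof.
  intros Hx Hy. assert (Hm : 0 <= m) by (pose proof (Rabs_pos x); lra).
  induction n as [|n IH].
  - simpl. rewrite !Rmult_1_r, Rmult_1_l. lra.
  - replace (x ^ S (S n) - y ^ S (S n)) with (x * (x ^ S n - y ^ S n) + y ^ S n * (x - y))
      by (simpl; ring).
    eapply Rle_trans; [apply Rabs_triang|]. rewrite !Rabs_mult, <- RPow_abs.
    assert (A : Rabs x * Rabs (x ^ S n - y ^ S n)
      <= m * (INR (S n) * m ^ n * Rabs (x - y))) by (apply Rmult_le_compat; auto using Rabs_pos).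
    assert (B : Rabs y ^ S n * Rabs (x - y) <= m ^ S n * Rabs (x - y)).
    { apply Rmult_le_compat_r; [apply Rabs_pos|]. apply pow_incr. auto using Rabs_pos. }
    rewrite (S_INR (S n)). simpl pow in *. lra.
Qed.

(** [s] is the sign of [a], and [d] is small enough for the perturbation [T] to consume at most half
    of the main term. *)
Lemma dominant_sign (a K : R) : a <> 0 -> exists s d, (s = 1 \/ s = -1) /\ 0 < d <= 1 /\
  forall m S T, 0 < m <= d -> 0 <= S -> Rabs T <= K * m * S ->
    Rabs a / 2 * S <= s * (a * S + T).
Proof.
  intros Ha. pose proof (Rabs_pos_lt a Ha) as Hp. pose proof (Rabs_pos K).
  set (d := Rmin 1 (Rabs a / (2 * (1 + Rabs K)))).
  assert (Hd : 0 < d <= 1).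
  { unfold d. split; [apply Rmin_glb_lt; [lra|]; apply Rdiv_lt_0_compat; lra | apply Rmin_l]. }
  assert (HKd : Rabs K * d <= Rabs a / 2).
  { apply Rle_trans with (Rabs K * (Rabs a / (2 * (1 + Rabs K)))).
    - apply Rmult_le_compat_l; [easy | apply Rmin_r].
    - apply (Rmult_le_reg_r (2 * (1 + Rabs K))); [lra|].
      replace (Rabs K * (Rabs a / (2 * (1 + Rabs K))) * (2 * (1 + Rabs K)))
        with (Rabs K * Rabs a) by (field; lra). lra. }
  assert (Hs : exists s, (s = 1 \/ s = -1) /\ s * a = Rabs a).
  { destruct (Rle_dec 0 a).
    - exists 1. rewrite Rabs_right by lra. split; [now left | ring].
    - exists (-1). rewrite Rabs_left by lra. split; [now right | ring]. }
  destruct Hs as [s [Hs1 Hsa]].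
  exists s, d. split; [easy|]. split; [easy|]. intros m S T Hm HS HT.
  replace (s * (a * S + T)) with (s * a * S + s * T) by ring. rewrite Hsa.
  assert (Rabs (s * T) <= K * m * S).
  { rewrite Rabs_mult. replace (Rabs s) with 1
      by (destruct Hs1; subst; [rewrite Rabs_R1 | rewrite Rabs_left]; lra). lra. }
  assert (K * m <= Rabs a / 2).
  { apply Rle_trans with (Rabs K * d); [|easy].
    apply Rle_trans with (Rabs K * m); [apply Rmult_le_compat_r; [lra | apply Rle_abs]|].
    apply Rmult_le_compat_l; lra. }
  assert (K * m * S <= Rabs a / 2 * S) by (apply Rmult_le_compat_r; lra).
  pose proof (Rabs_maj2 (s * T)). lra.
Qed.

(** The first nonzero coefficient dominates. The bound [m^9] covers all three cases and still beats
    the error of order 10 in the expansions; it needs one of [z1], [z2] to be [m] itself. *)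
Lemma odd_part_sign : al <> 0 \/ ga <> 0 ->
  exists s c d, (s = 1 \/ s = -1) /\ 0 < c /\ 0 < d <= 1 /\
  forall m z1 z2, 0 < m <= d -> 0 < z1 <= m -> 0 < z2 <= m -> z1 = m \/ z2 = m ->
    c * m ^ 9 <= s * (phi_jet1 * (z1 ^ 5 + z2 ^ 5) + phi_jet3 * (z1 ^ 7 + z2 ^ 7)
                      + phi_jet5 * (z1 ^ 9 + z2 ^ 9)).
Proof.
  intros H.
  assert (Sle : forall m z1 z2 n, 0 < m <= 1 -> 0 < z1 <= m -> 0 < z2 <= m ->
    0 <= z1 ^ S (S n) + z2 ^ S (S n) <= m * (z1 ^ n + z2 ^ n)).
  { intros m z1 z2 n Hm H1 H2.
    pose proof (pow_lt z1 n ltac:(lra)). pose proof (pow_lt z2 n ltac:(lra)).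
    assert (z1 ^ 2 <= m) by nra. assert (z2 ^ 2 <= m) by nra.
    change (S (S n)) with (2 + n)%nat. rewrite !pow_add. split; [pose proof (pow2_ge_0 z1); pose proof (pow2_ge_0 z2); nra | nra]. }
  assert (Sge : forall m z1 z2 n, 0 < m <= 1 -> 0 < z1 <= m -> 0 < z2 <= m ->
    z1 = m \/ z2 = m -> (n <= 9)%nat -> m ^ 9 <= z1 ^ n + z2 ^ n).
  { intros m z1 z2 n Hm H1 H2 Hz Hn.
    pose proof (pow_lt z1 n ltac:(lra)). pose proof (pow_lt z2 n ltac:(lra)).
    assert (m ^ 9 <= m ^ n).
    { replace 9%nat with (n + (9 - n))%nat by lia. rewrite pow_add.
      pose proof (pow_lt m n ltac:(lra)).
      assert (m ^ (9 - n) <= 1) by (rewrite <- (pow1 (9 - n)); apply pow_incr; lra). nra. }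
    destruct Hz; subst; lra. }
  (* The cases differ only in the exponent [n] of the first nonzero coefficient [a]; [T] gathers the
     later terms, smaller by a factor [m]. *)
  assert (F : forall a T n, (n <= 9)%nat -> a <> 0 ->
    (exists K, forall m z1 z2, 0 < m <= 1 -> 0 < z1 <= m -> 0 < z2 <= m ->
       Rabs (T z1 z2) <= K * m * (z1 ^ n + z2 ^ n)) ->
    exists s c d, (s = 1 \/ s = -1) /\ 0 < c /\ 0 < d <= 1 /\
    forall m z1 z2, 0 < m <= d -> 0 < z1 <= m -> 0 < z2 <= m -> z1 = m \/ z2 = m ->
      c * m ^ 9 <= s * (a * (z1 ^ n + z2 ^ n) + T z1 z2)).
  { intros a T n Hn Ha [K HK].
    destruct (dominant_sign a K Ha) as [s [d [Hs [Hd D]]]].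
    pose proof (Rabs_pos_lt a Ha).
    exists s, (Rabs a / 2), d. split; [easy|]. split; [lra|]. split; [easy|].
    intros m z1 z2 Hm H1 H2 Hz.
    pose proof (pow_lt z1 n ltac:(lra)). pose proof (pow_lt z2 n ltac:(lra)).
    eapply Rle_trans; [|apply (D m); [easy | lra | apply HK; lra]].
    apply Rmult_le_compat_l; [lra|]. apply Sge; auto; lra. }
  destruct (Req_dec phi_jet1 0) as [E1|N1]; [destruct (Req_dec phi_jet3 0) as [E3|N3]|].
  - assert (N5 : phi_jet5 <> 0) by (destruct (phi_jets_nonzero H) as [|[|]]; easy).
    destruct (F phi_jet5 (fun _ _ => 0) 9%nat) as [s [c [d [Hs [Hc [Hd D]]]]]]; auto.
    { exists 0. intros. rewrite Rabs_R0. lra. }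
    exists s, c, d. split; [easy|]. split; [easy|]. split; [easy|]. intros m z1 z2 h1 h2 h3 h4.
    rewrite E1, E3. specialize (D m z1 z2 h1 h2 h3 h4). lra.
  - destruct (F phi_jet3 (fun z1 z2 => phi_jet5 * (z1 ^ 9 + z2 ^ 9)) 7%nat)
      as [s [c [d [Hs [Hc [Hd D]]]]]]; [lia | exact N3 | |].
    { exists (Rabs phi_jet5). intros m z1 z2 h1 h2 h3. rewrite Rabs_mult.
      destruct (Sle m z1 z2 7%nat h1 h2 h3) as [P Q].
      rewrite (Rabs_right (z1 ^ 9 + z2 ^ 9)) by lra. rewrite Rmult_assoc.
      apply Rmult_le_compat_l; [apply Rabs_pos | lra]. }
    exists s, c, d. split; [easy|]. split; [easy|]. split; [easy|]. intros m z1 z2 h1 h2 h3 h4.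
    rewrite E1. specialize (D m z1 z2 h1 h2 h3 h4). cbv beta in D. lra.
  - destruct (F phi_jet1 (fun z1 z2 => phi_jet3 * (z1 ^ 7 + z2 ^ 7) + phi_jet5 * (z1 ^ 9 + z2 ^ 9)) 5%nat)
      as [s [c [d [Hs [Hc [Hd D]]]]]]; [lia | easy | |].
    { exists (Rabs phi_jet3 + Rabs phi_jet5). intros m z1 z2 h1 h2 h3.
      destruct (Sle m z1 z2 5%nat h1 h2 h3) as [P Q].
      destruct (Sle m z1 z2 7%nat h1 h2 h3) as [P' Q'].
      eapply Rle_trans; [apply Rabs_triang|]. rewrite !Rabs_mult.
      rewrite (Rabs_right (z1 ^ 7 + z2 ^ 7)), (Rabs_right (z1 ^ 9 + z2 ^ 9)) by lra.
      pose proof (pow_le z1 5 ltac:(lra)). pose proof (pow_le z2 5 ltac:(lra)).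
      set (S5 := z1 ^ 5 + z2 ^ 5) in *. set (S7 := z1 ^ 7 + z2 ^ 7) in *.
      set (S9 := z1 ^ 9 + z2 ^ 9) in *.
      assert (HS5 : 0 <= S5) by (unfold S5; lra).
      assert (S7 <= S5) by nra. assert (S9 <= m * S5) by nra.
      rewrite !Rmult_plus_distr_r, !Rmult_assoc.
      apply Rplus_le_compat; apply Rmult_le_compat_l; auto using Rabs_pos. }
    exists s, c, d. split; [easy|]. split; [easy|]. split; [easy|]. intros m z1 z2 h1 h2 h3 h4.
    specialize (D m z1 z2 h1 h2 h3 h4). cbv beta in D. lra.
Qed.

Lemma coord_near_identity : exists d, 0 < d <= 1 /\
  forall z, Rabs z <= d -> Rabs (coord z - z) <= Rabs z / 2.
Proof.
  destruct (peval_flat 1 (padd norm_coord [-1])) as [C [HC H]].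
  { intros k Hk. destruct k; [|lia]. cbn. ring. }
  exists (/ (2 * (1 + C))). split.
  { split; [apply Rinv_0_lt_compat; lra|].
    rewrite <- Rinv_1. apply Rinv_le_contravar; lra. }
  intros z Hz.
  assert (Hz' : Rabs z * (2 * (1 + C)) <= 1).
  { apply (Rmult_le_reg_r (/ (2 * (1 + C)))); [apply Rinv_0_lt_compat; lra|].
    replace (Rabs z * (2 * (1 + C)) * / (2 * (1 + C))) with (Rabs z) by (field; lra). lra. }
  pose proof (Rabs_pos z). assert (Hz1 : Rabs z <= 1) by nra.
  specialize (H z Hz1). rewrite peval_add in H. cbn [peval] in H.
  unfold coord. replace (z * peval norm_coord z - z)
    with (z * (peval norm_coord z + (-1 + z * 0))) by ring.
  rewrite Rabs_mult. nra.
Qed.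

Lemma coord_continuous (z : R) : continuity_pt coord z.
Proof. eapply is_derive_continuity_pt, coord_derive. Qed.

(** This is [phi / a40] for the Lienard system with [al = a11], [be = a21], [ga = a50 / a40]. *)
Definition psi (x : R) : R := x ^ 4 * (1 + ga * x) / qf x.

Section SignLemma.

Variables (G : R -> R) (rho : R).
Hypothesis rho_pos : 0 < rho.
Hypothesis G_derive : forall x, Rabs x <= rho -> is_derive G x (x ^ 5 / qf x).
Hypothesis G_zero : G 0 = 0.
Hypothesis qf_ge : forall x, Rabs x <= rho -> / 2 <= qf x.

Lemma primitive_jet : exists C d, 0 <= C /\ 0 < d <= 1 /\
  (forall z, Rabs z <= d -> Rabs (coord z - z) <= Rabs z / 2 /\ Rabs (coord z) <= rho) /\
  (forall z, Rabs z <= d -> Rabs (G (coord z) - z ^ 6 / 6) <= C * Rabs z ^ 12) /\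
  (forall z, Rabs z <= d -> Rabs (psi (coord z) - z ^ 4 * peval phi_jet z) <= C * Rabs z ^ 10).
Proof.
  destruct coord_near_identity as [d0 [Hd0 Hid]].
  destruct norm_coord_flat as [C1 [HC1 H1]]. destruct phi_jet_flat as [C2 [HC2 H2]].
  set (d := Rmin d0 (rho / 2)).
  assert (Hd : 0 < d /\ d <= d0 /\ d <= rho / 2).
  { unfold d. split; [apply Rmin_glb_lt; lra | split; [apply Rmin_l | apply Rmin_r]]. }
  assert (Hin : forall z, Rabs z <= d -> Rabs (coord z - z) <= Rabs z / 2 /\ Rabs (coord z) <= rho).
  { intros z Hz. specialize (Hid z ltac:(lra)). split; [easy|].
    replace (coord z) with (z + (coord z - z)) by ring.
    eapply Rle_trans; [apply Rabs_triang | lra]. }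
  assert (Hquot : forall a z C n, Rabs z <= d -> Rabs a <= C * Rabs z ^ n ->
    Rabs (a / qf (coord z)) <= 2 * C * Rabs z ^ n).
  { intros a z C n Hz Ha. pose proof (qf_ge (coord z) (proj2 (Hin z Hz))) as Q.
    unfold Rdiv. rewrite Rabs_mult, Rabs_inv, (Rabs_right (qf _)) by lra.
    assert (0 < / qf (coord z) <= 2).
    { split; [apply Rinv_0_lt_compat; lra|]. replace 2 with (/ / 2) by field.
      apply Rinv_le_contravar; lra. }
    pose proof (Rabs_pos a). nra. }
  exists (2 * (C1 + C2)), d. split; [lra|]. split; [lra|]. split; [exact Hin|]. split.
  - intros z Hz.
    set (D z := G (coord z) - z ^ 6 / 6).
    (* The derivative of [D], of order 11 by [norm_coord_flat]; the mean value theorem turns this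
       into order 12 for [D]. *)
    set (dD z := (coord z ^ 5 * peval (pder 1 norm_coord) z - z ^ 5 * qf (coord z)) / qf (coord z)).
    assert (HD : forall w, Rabs w <= d -> is_derive D w (dD w)).
    { intros w Hw. pose proof (qf_ge (coord w) (proj2 (Hin w Hw))) as Q.
      eapply is_derive_eq.
      - apply (is_derive_minus (V := R_NormedModule)).
        + apply (is_derive_comp G coord); [apply G_derive, Hin, Hw | apply coord_derive].
        + instantiate (1 := w ^ 5). auto_derive; [auto | field].
      - unfold dD, minus, plus, opp, scal; simpl; unfold mult; cbn -[pow peval pder].
        field. lra. }
    destruct (MVT_gen D 0 z dD) as [c [Hc E]].
    + intros w Hw. apply HD. apply Rle_trans with (Rabs z); [|easy].
      destruct (Rle_dec 0 z).
      * rewrite Rmin_left, Rmax_right in Hw by lra. rewrite !Rabs_right; lra.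
      * rewrite Rmin_right, Rmax_left in Hw by lra. rewrite !Rabs_left1; lra.
    + intros w Hw. eapply is_derive_continuity_pt, HD. apply Rle_trans with (Rabs z); [|easy].
      destruct (Rle_dec 0 z).
      * rewrite Rmin_left, Rmax_right in Hw by lra. rewrite !Rabs_right; lra.
      * rewrite Rmin_right, Rmax_left in Hw by lra. rewrite !Rabs_left1; lra.
    + assert (Hcz : Rabs c <= Rabs z).
      { destruct (Rle_dec 0 z).
        - rewrite Rmin_left, Rmax_right in Hc by lra. rewrite !Rabs_right; lra.
        - rewrite Rmin_right, Rmax_left in Hc by lra. rewrite !Rabs_left1; lra. }
      assert (D0 : D 0 = 0).
      { unfold D. replace (coord 0) with 0 by (unfold coord; ring). rewrite G_zero. field. }
      change (Rabs (D z) <= 2 * (C1 + C2) * Rabs z ^ 12).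
      replace (D z) with (dD c * z) by lra.
      assert (Hdc : Rabs (dD c) <= 2 * C1 * Rabs c ^ 11)
        by (apply Hquot; [lra | apply H1; lra]).
      assert (Hp : Rabs c ^ 11 <= Rabs z ^ 11) by (apply pow_incr; split; [apply Rabs_pos | easy]).
      rewrite Rabs_mult. pose proof (Rabs_pos z). pose proof (pow_le _ 11 (Rabs_pos z)).
      replace (Rabs z ^ 12) with (Rabs z ^ 11 * Rabs z) by ring.
      rewrite <- Rmult_assoc. apply Rmult_le_compat_r; [easy|]. nra.
  - intros z Hz. pose proof (qf_ge (coord z) (proj2 (Hin z Hz))) as Q.
    replace (psi (coord z) - z ^ 4 * peval phi_jet z) with
      ((coord z ^ 4 * (1 + ga * coord z) - z ^ 4 * peval phi_jet z * qf (coord z)) / qf (coord z))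
      by (unfold psi; field; lra).
    eapply Rle_trans; [apply (Hquot _ z C2 10%nat Hz); apply H2; lra|].
    pose proof (pow_le _ 10 (Rabs_pos z)). nra.
Qed.

(** Since [coord] moves a point by at most half its modulus, [coord (2 * x) >= x] and
    [coord (- (2 * x)) <= - x]; the intermediate value theorem does the rest. *)
Lemma coord_preimage (d x : R) : 0 < d ->
  (forall z, Rabs z <= d -> Rabs (coord z - z) <= Rabs z / 2) ->
  0 < x <= d / 2 ->
  (exists z, 0 < z <= 2 * x /\ coord z = x) /\ (exists z, 0 < z <= 2 * x /\ coord (- z) = - x).
Proof.
  intros Hd H Hx.
  assert (C0 : coord 0 = 0) by (unfold coord; ring).
  split.
  - destruct (ivt_interval coord 0 (2 * x) x) as [z [Hz E]].
    + lra.
    + intros; apply coord_continuous.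
    + rewrite C0. specialize (H (2 * x)). rewrite Rabs_right in H by lra.
      specialize (H ltac:(lra)). apply Rabs_le_between in H. lra.
    + exists z. split; [|easy]. destruct (Req_dec z 0) as [->|]; lra.
  - destruct (ivt_interval (fun z => - coord (- z)) 0 (2 * x) x) as [z [Hz E]].
    + lra.
    + intros z _. apply continuity_pt_opp.
      apply (continuity_pt_comp (fun z => - z) coord); [|apply coord_continuous].
      apply continuity_pt_opp, derivable_continuous_pt, derivable_pt_id.
    + rewrite Ropp_0, C0. specialize (H (- (2 * x))). rewrite Rabs_left in H by lra.
      specialize (H ltac:(lra)). apply Rabs_le_between in H. lra.
    + exists z. split; [|lra]. destruct (Req_dec z 0) as [->|]; [|lra].
      rewrite Ropp_0, C0 in E. lra.
Qed.

(** In the coordinate [z], equal values of [G] make [z1^6] and [z2^6] agree up to order 12, hence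
    [z1] and [z2] up to order 7. The even powers in [psi x1 - psi (- x2)] then cancel up to order
    10, whereas the odd ones add up to at least a multiple of [m^9]. *)
Lemma psi_sign : al <> 0 \/ ga <> 0 ->
  exists s r, (s = 1 \/ s = -1) /\ 0 < r <= rho /\
  forall x1 x2, 0 < x1 <= r -> 0 < x2 <= r -> G x1 = G (- x2) ->
    0 < s * (psi x1 - psi (- x2)).
Proof.
  intros Hne.
  destruct primitive_jet as [C [d [HC [Hd [Hin [HG Hpsi]]]]]].
  destruct (odd_part_sign Hne) as [s [c [d' [Hs [Hc [Hd' Hodd]]]]]].
  (* The factors 4, 6, 8 are the exponents of the even powers; [2 * C] comes from the remainders at
     [z1] and [- z2]. *)
  set (K := 12 * C * (4 + 6 * Rabs phi_jet2 + 8 * Rabs phi_jet4) + 2 * C).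
  assert (HK : 0 <= K).
  { unfold K. pose proof (Rabs_pos phi_jet2). pose proof (Rabs_pos phi_jet4).
    assert (0 <= 12 * C * (4 + 6 * Rabs phi_jet2 + 8 * Rabs phi_jet4))
      by (repeat (lra || apply Rmult_le_pos)). lra. }
  (* The last bound gives [K * m <= c / 2], so the remainder takes at most half of [c * m^9]. *)
  set (d2 := Rmin (Rmin d d') (c / (2 * (1 + K)))).
  assert (Hd2 : 0 < d2 /\ d2 <= d /\ d2 <= d' /\ d2 <= c / (2 * (1 + K))).
  { unfold d2. pose proof (Rmin_l (Rmin d d') (c / (2 * (1 + K)))).
    pose proof (Rmin_l d d'). pose proof (Rmin_r d d').
    split; [|split; [lra | split; [lra | apply Rmin_r]]].
    repeat apply Rmin_glb_lt; try lra. apply Rdiv_lt_0_compat; lra. }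
  exists s, (Rmin rho (d2 / 2)). split; [easy|].
  split; [split; [apply Rmin_glb_lt; lra | apply Rmin_l]|].
  intros x1 x2 Hx1 Hx2 HGx.
  pose proof (Rmin_r rho (d2 / 2)).
  destruct (coord_preimage d2 x1) as [[z1 [Hz1 E1]] _]; [lra | | lra |];
    [intros z Hz; apply Hin; lra|].
  destruct (coord_preimage d2 x2) as [_ [z2 [Hz2 E2]]]; [lra | | lra |];
    [intros z Hz; apply Hin; lra|].
  set (m := Rmax z1 z2).
  assert (Hm : z1 <= m /\ z2 <= m /\ (z1 = m \/ z2 = m)).
  { unfold m. split; [apply Rmax_l | split; [apply Rmax_r|]].
    unfold Rmax. destruct (Rle_dec z1 z2); auto. }
  destruct Hm as [Hm1 [Hm2 Hm]].
  assert (Hmd : 0 < m <= d2) by (destruct Hm; lra).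
  assert (Hpow : forall n, 0 <= z1 ^ n <= m ^ n /\ 0 <= z2 ^ n <= m ^ n).
  { intros n. split; split; try (apply pow_le; lra); apply pow_incr; lra. }
  assert (A1 : Rabs z1 = z1) by (apply Rabs_right; lra).
  assert (A2 : Rabs (- z2) = z2) by (rewrite Rabs_Ropp; apply Rabs_right; lra).
  assert (Hdiff : Rabs (z1 - z2) <= 12 * C * m ^ 7).
  { pose proof (HG z1 ltac:(lra)) as G1. pose proof (HG (- z2) ltac:(lra)) as G2.
    rewrite E1, A1 in G1. rewrite E2, A2 in G2.
    replace ((- z2) ^ 6) with (z2 ^ 6) in G2 by ring.
    assert (D6 : Rabs (z1 ^ 6 - z2 ^ 6) <= 12 * C * m ^ 12).
    { replace (z1 ^ 6 - z2 ^ 6)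
        with (6 * ((G (- x2) - z2 ^ 6 / 6) - (G x1 - z1 ^ 6 / 6))) by (rewrite HGx; field).
      rewrite Rabs_mult, (Rabs_right 6) by lra.
      replace (12 * C * m ^ 12) with (6 * (C * m ^ 12 + C * m ^ 12)) by ring.
      apply Rmult_le_compat_l; [lra|]. unfold Rminus at 1.
      eapply Rle_trans; [apply Rabs_triang|]. rewrite Rabs_Ropp.
      destruct (Hpow 12%nat). apply Rplus_le_compat; eapply Rle_trans; eauto;
        apply Rmult_le_compat_l; lra. }
    (* The cofactor of [z1 - z2] in [z1^6 - z2^6]; one of its terms is [m^5], so dividing by it
       loses five orders. *)
    set (Q := z1 ^ 5 + z1 ^ 4 * z2 + z1 ^ 3 * z2 ^ 2 + z1 ^ 2 * z2 ^ 3 + z1 * z2 ^ 4 + z2 ^ 5).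
    assert (HQ : m ^ 5 <= Q).
    { assert (P : forall i j, 0 <= z1 ^ i * z2 ^ j)
        by (intros; apply Rmult_le_pos; apply pow_le; lra).
      pose proof (P 4%nat 1%nat). pose proof (P 3%nat 2%nat). pose proof (P 2%nat 3%nat).
      pose proof (P 1%nat 4%nat). rewrite !pow_1 in *.
      pose proof (pow_le z1 5 ltac:(lra)). pose proof (pow_le z2 5 ltac:(lra)).
      unfold Q. destruct Hm as [Em|Em]; rewrite <- Em; lra. }
    replace (z1 ^ 6 - z2 ^ 6) with ((z1 - z2) * Q) in D6 by (unfold Q; ring).
    pose proof (pow_lt m 5 ltac:(lra)) as M5.
    rewrite Rabs_mult, (Rabs_right Q) in D6 by lra.
    apply (Rmult_le_reg_r (m ^ 5)); [easy|].
    replace (12 * C * m ^ 7 * m ^ 5) with (12 * C * m ^ 12) by ring.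
    eapply Rle_trans; [|exact D6]. apply Rmult_le_compat_l; [apply Rabs_pos | easy]. }
  assert (Heven : forall n, (4 <= n)%nat -> Rabs (z1 ^ n - z2 ^ n) <= INR n * (12 * C * m ^ 10)).
  { intros n Hn. destruct n as [|n]; [lia|].
    eapply Rle_trans; [apply (pow_diff_le m); [rewrite A1; easy | rewrite Rabs_right; lra]|].
    rewrite Rmult_assoc. apply Rmult_le_compat_l; [apply pos_INR|].
    apply Rle_trans with (m ^ 3 * (12 * C * m ^ 7)); [|right; ring].
    apply Rmult_le_compat; auto using Rabs_pos; [apply pow_le; lra|].
    replace n with (3 + (n - 3))%nat by lia. rewrite pow_add.
    pose proof (pow_lt m 3 ltac:(lra)).
    assert (m ^ (n - 3) <= 1) by (rewrite <- (pow1 (n - 3)); apply pow_incr; lra). nra. }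
  set (odd := phi_jet1 * (z1 ^ 5 + z2 ^ 5) + phi_jet3 * (z1 ^ 7 + z2 ^ 7)
                      + phi_jet5 * (z1 ^ 9 + z2 ^ 9)).
  assert (Hrest : Rabs (psi x1 - psi (- x2) - odd) <= K * m ^ 10).
  { pose proof (Hpsi z1 ltac:(lra)) as P1. pose proof (Hpsi (- z2) ltac:(lra)) as P2.
    rewrite E1, A1 in P1. rewrite E2, A2 in P2.
    replace (psi x1 - psi (- x2) - odd) with
      ((z1 ^ 4 - z2 ^ 4) + phi_jet2 * (z1 ^ 6 - z2 ^ 6) + phi_jet4 * (z1 ^ 8 - z2 ^ 8)
       + ((psi x1 - z1 ^ 4 * peval phi_jet z1)
          - (psi (- x2) - (- z2) ^ 4 * peval phi_jet (- z2))))
      by (unfold odd, phi_jet; cbn [peval]; ring).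
    assert (H4 := Heven 4%nat ltac:(lia)). assert (H6 := Heven 6%nat ltac:(lia)).
    assert (H8 := Heven 8%nat ltac:(lia)).
    replace (INR 4) with 4 in H4 by (simpl; ring). replace (INR 6) with 6 in H6 by (simpl; ring).
    replace (INR 8) with 8 in H8 by (simpl; ring).
    replace (K * m ^ 10) with
      (4 * (12 * C * m ^ 10) + Rabs phi_jet2 * (6 * (12 * C * m ^ 10))
       + Rabs phi_jet4 * (8 * (12 * C * m ^ 10)) + (C * m ^ 10 + C * m ^ 10))
      by (unfold K; ring).
    destruct (Hpow 10%nat) as [Q1 Q2].
    eapply Rle_trans; [apply Rabs_triang|]. apply Rplus_le_compat.
    - eapply Rle_trans; [apply Rabs_triang|]. apply Rplus_le_compat.
      + eapply Rle_trans; [apply Rabs_triang|]. apply Rplus_le_compat; [easy|].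
        rewrite Rabs_mult. apply Rmult_le_compat_l; [apply Rabs_pos | easy].
      + rewrite Rabs_mult. apply Rmult_le_compat_l; [apply Rabs_pos | easy].
    - unfold Rminus at 1. eapply Rle_trans; [apply Rabs_triang|]. rewrite Rabs_Ropp.
      apply Rplus_le_compat; eapply Rle_trans; eauto; apply Rmult_le_compat_l; lra. }
  assert (Ho : c * m ^ 9 <= s * odd) by (apply Hodd; [lra | lra | lra | easy]).
  assert (Hsr : - (K * m ^ 10) <= s * (psi x1 - psi (- x2) - odd))
    by (apply Rabs_le_between in Hrest; destruct Hs; subst s; lra).
  assert (Hfin : K * m ^ 10 <= c / 2 * m ^ 9).
  { replace (K * m ^ 10) with (K * m * m ^ 9) by ring.
    apply Rmult_le_compat_r; [apply pow_le; lra|].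
    apply Rle_trans with (K * (c / (2 * (1 + K)))); [apply Rmult_le_compat_l; lra|].
    apply (Rmult_le_reg_r (2 * (1 + K))); [lra|].
    replace (K * (c / (2 * (1 + K))) * (2 * (1 + K))) with (K * c) by (field; lra). nra. }
  pose proof (pow_lt m 9 ltac:(lra)).
  assert (0 < c / 2 * m ^ 9) by (apply Rmult_lt_0_compat; lra).
  lra.
Qed.

End SignLemma.

End Jets.

(** * Bounds for absolute values *)

Lemma Rabs_mult_le (a b x y : R) : Rabs a <= x -> Rabs b <= y -> Rabs (a * b) <= x * y.
Proof.
  intros Ha Hb. rewrite Rabs_mult.
  apply Rmult_le_compat; auto using Rabs_pos.
Qed.

Lemma Rabs_plus_le (a b x y : R) : Rabs a <= x -> Rabs b <= y -> Rabs (a + b) <= x + y.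
Proof. intros Ha Hb. eapply Rle_trans; [apply Rabs_triang | lra]. Qed.

Lemma Rabs_minus_le (a b x y : R) : Rabs a <= x -> Rabs b <= y -> Rabs (a - b) <= x + y.
Proof.
  intros Ha Hb. unfold Rminus. apply Rabs_plus_le; [easy|]. now rewrite Rabs_Ropp.
Qed.

Lemma Rabs_pow_le1 (a : R) (n : nat) : Rabs a <= 1 -> Rabs (a ^ n) <= 1.
Proof.
  intros H. rewrite <- RPow_abs. rewrite <- (pow1 n).
  apply pow_incr. split; [apply Rabs_pos | easy].
Qed.

Lemma Rabs_cos_le1 (t : R) : Rabs (cos t) <= 1.
Proof. apply Rabs_le, COS_bound. Qed.

Lemma Rabs_sin_le1 (t : R) : Rabs (sin t) <= 1.
Proof. apply Rabs_le, SIN_bound. Qed.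

Lemma cos2_plus_sin2 (t : R) : cos t ^ 2 + sin t ^ 2 = 1.
Proof. pose proof (sin2_cos2 t). unfold Rsqr in *. lra. Qed.

(** * The scalar equation for the radius as a function of the angle *)

Section QuasiPolar.

Variables mu a11 a21 a40 a50 : R.

(* With [x = r c], [y = r^3 s] the field is [(r^3 * xq, r^5 * yq)]. *)
Definition xq (c s r : R) : R :=
  - s + mu * c ^ 3 + r * (a11 * (c * s) + a40 * c ^ 4)
  + r ^ 2 * (a21 * (c ^ 2 * s) + a50 * c ^ 5).
Definition yq (c s : R) : R := c ^ 5 + 3 * mu * (c ^ 2 * s).

(* Writing [c = cos t], [s = sin t]:
   [r' = r^3 * num / (c^2 + 3 s^2)] and [t' = r^2 * den / (c^2 + 3 s^2)]. *)
Definition num (c s r : R) : R := c * xq c s r + s * yq c s.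
Definition den (c s r : R) : R := c * yq c s - 3 * s * xq c s r.
Definition slope (c s r : R) : R := num c s r / den c s r.

Definition coef_norm : R := Rabs a11 + Rabs a40 + Rabs a21 + Rabs a50.

(** The terms of [den] with a positive power of [r] are bounded by [3 * rmax * coef_norm <= / 2] for
    [r <= rmax], half of the lower bound 1 of [den] at [r = 0]. *)
Definition rmax : R := / (6 * (1 + coef_norm)).

Lemma coef_norm_nonneg : 0 <= coef_norm.
Proof.
  unfold coef_norm. pose proof (Rabs_pos a11). pose proof (Rabs_pos a21).
  pose proof (Rabs_pos a40). pose proof (Rabs_pos a50). lra.
Qed.

Lemma rmax_bounds : 0 < rmax <= / 6.
Proof.
  pose proof coef_norm_nonneg. unfold rmax. split.
  - apply Rinv_0_lt_compat. lra.
  - apply Rinv_le_contravar; lra.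
Qed.

Lemma rmax_coef : 6 * rmax * coef_norm <= 1.
Proof.
  pose proof coef_norm_nonneg. unfold rmax.
  replace (6 * / (6 * (1 + coef_norm)) * coef_norm) with (coef_norm / (1 + coef_norm))
    by (field; lra).
  apply Rle_div_l; lra.
Qed.

Section UnitCircle.

Variables c s : R.
Hypothesis cs1 : c ^ 2 + s ^ 2 = 1.

Lemma circle_bounds : Rabs c <= 1 /\ Rabs s <= 1.
Proof. split; apply Rabs_le; nra. Qed.

Lemma monomial_bound (a : R) (i j : nat) : Rabs (a * (c ^ i * s ^ j)) <= Rabs a.
Proof.
  destruct circle_bounds as [Hc Hs].
  replace (Rabs a) with (Rabs a * (1 * 1)) by ring.
  apply Rabs_mult_le; [lra|]. apply Rabs_mult_le; now apply Rabs_pow_le1.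
Qed.

Lemma xq_diff (r r' : R) : 0 <= r <= 1 -> 0 <= r' <= 1 ->
  Rabs (xq c s r - xq c s r') <= 2 * coef_norm * Rabs (r - r').
Proof.
  intros Hr Hr'.
  replace (xq c s r - xq c s r') with
    (((a11 * (c ^ 1 * s ^ 1) + a40 * (c ^ 4 * s ^ 0))
      + (r + r') * (a21 * (c ^ 2 * s ^ 1) + a50 * (c ^ 5 * s ^ 0))) * (r - r'))
    by (unfold xq; ring).
  apply Rabs_mult_le; [|lra].
  pose proof (monomial_bound a11 1 1). pose proof (monomial_bound a40 4 0).
  pose proof (monomial_bound a21 2 1). pose proof (monomial_bound a50 5 0).
  unfold coef_norm.
  apply Rle_trans with ((Rabs a11 + Rabs a40) + 2 * (Rabs a21 + Rabs a50)).
  - apply Rabs_plus_le; [now apply Rabs_plus_le|].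
    apply Rabs_mult_le; [apply Rabs_le; lra | now apply Rabs_plus_le].
  - pose proof (Rabs_pos a11). pose proof (Rabs_pos a40). lra.
Qed.

Lemma xq_bound (r : R) : 0 <= r <= 1 -> Rabs (xq c s r) <= 1 + Rabs mu + 2 * coef_norm.
Proof.
  intros Hr. destruct circle_bounds as [Hc Hs].
  replace (xq c s r) with ((- s + mu * (c ^ 3 * s ^ 0)) + (xq c s r - xq c s 0))
    by (unfold xq; ring).
  apply Rabs_plus_le.
  - apply Rabs_plus_le; [now rewrite Rabs_Ropp | apply monomial_bound].
  - eapply Rle_trans; [apply xq_diff; lra|].
    rewrite Rminus_0_r, Rabs_right by lra. pose proof coef_norm_nonneg. nra.
Qed.

Lemma yq_bound : Rabs (yq c s) <= 1 + 3 * Rabs mu.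
Proof.
  destruct circle_bounds as [Hc Hs]. unfold yq.
  apply Rabs_plus_le; [now apply Rabs_pow_le1|].
  rewrite Rmult_assoc. apply Rabs_mult_le; [rewrite Rabs_right; lra|].
  pose proof (monomial_bound mu 2 1) as H. now rewrite pow_1 in H.
Qed.

Definition num_bound : R := 2 + 4 * Rabs mu + 2 * coef_norm.
Definition den_bound : R := 4 + 6 * Rabs mu + 6 * coef_norm.

Lemma num_le (r : R) : 0 <= r <= 1 -> Rabs (num c s r) <= num_bound.
Proof.
  intros Hr. destruct circle_bounds as [Hc Hs]. unfold num, num_bound.
  replace (2 + 4 * Rabs mu + 2 * coef_norm)
    with (1 * (1 + Rabs mu + 2 * coef_norm) + 1 * (1 + 3 * Rabs mu)) by ring.
  apply Rabs_plus_le; apply Rabs_mult_le; auto using yq_bound, xq_bound.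
Qed.

Lemma den_le (r : R) : 0 <= r <= 1 -> Rabs (den c s r) <= den_bound.
Proof.
  intros Hr. destruct circle_bounds as [Hc Hs]. unfold den, den_bound.
  replace (4 + 6 * Rabs mu + 6 * coef_norm)
    with (1 * (1 + 3 * Rabs mu) + 3 * 1 * (1 + Rabs mu + 2 * coef_norm)) by ring.
  apply Rabs_minus_le; apply Rabs_mult_le; auto using yq_bound, xq_bound.
  apply Rabs_mult_le; [rewrite Rabs_right; lra | easy].
Qed.

Lemma num_diff (r r' : R) : 0 <= r <= 1 -> 0 <= r' <= 1 ->
  Rabs (num c s r - num c s r') <= 2 * coef_norm * Rabs (r - r').
Proof.
  intros Hr Hr'. destruct circle_bounds as [Hc Hs]. unfold num.
  replace (c * xq c s r + s * yq c s - (c * xq c s r' + s * yq c s))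
    with (c * (xq c s r - xq c s r')) by ring.
  rewrite <- (Rmult_1_l (2 * _ * _)). apply Rabs_mult_le; [easy|]. now apply xq_diff.
Qed.

Lemma den_diff (r r' : R) : 0 <= r <= 1 -> 0 <= r' <= 1 ->
  Rabs (den c s r - den c s r') <= 6 * coef_norm * Rabs (r - r').
Proof.
  intros Hr Hr'. destruct circle_bounds as [Hc Hs]. unfold den.
  replace (c * yq c s - 3 * s * xq c s r - (c * yq c s - 3 * s * xq c s r'))
    with (- (3 * s * (xq c s r - xq c s r'))) by ring.
  rewrite Rabs_Ropp.
  replace (6 * coef_norm * Rabs (r - r'))
    with (3 * 1 * (2 * coef_norm * Rabs (r - r'))) by ring.
  apply Rabs_mult_le; [|now apply xq_diff].
  apply Rabs_mult_le; [rewrite Rabs_right; lra | easy].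
Qed.

(** The terms in [mu] cancel and leave [c^6 + 3 s^2]. With [w = c^2] the claim becomes
    [w^3 - 3 w + 2 = (1 - w)^2 (w + 2) >= 0]. *)
Lemma den_zero_ge1 : 1 <= den c s 0.
Proof.
  replace (den c s 0) with (c ^ 6 + 3 * s ^ 2) by (unfold den, xq, yq; ring).
  replace (s ^ 2) with (1 - c ^ 2) by lra.
  replace (c ^ 6) with (c ^ 2 * c ^ 2 * c ^ 2) by ring.
  assert (0 <= c ^ 2 <= 1) by nra.
  generalize dependent (c ^ 2). intros w _ Hw.
  assert (0 <= (1 - w) * (1 - w) * (w + 2)) by (repeat (lra || apply Rmult_le_pos)).
  nra.
Qed.

Lemma den_ge (r : R) : 0 <= r <= rmax -> / 2 <= den c s r.
Proof.
  intros Hr. pose proof rmax_bounds. pose proof den_zero_ge1.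
  replace (den c s r) with (den c s 0 + r * (-3 * s) *
    ((a11 * (c ^ 1 * s ^ 1) + a40 * (c ^ 4 * s ^ 0))
      + r * (a21 * (c ^ 2 * s ^ 1) + a50 * (c ^ 5 * s ^ 0))))
    by (unfold den, xq; ring).
  assert (A : Rabs (r * (-3 * s) *
    ((a11 * (c ^ 1 * s ^ 1) + a40 * (c ^ 4 * s ^ 0))
      + r * (a21 * (c ^ 2 * s ^ 1) + a50 * (c ^ 5 * s ^ 0))))
     <= rmax * (3 * 1) * coef_norm).
  { destruct circle_bounds as [Hc Hs].
    pose proof (monomial_bound a11 1 1). pose proof (monomial_bound a40 4 0).
    pose proof (monomial_bound a21 2 1). pose proof (monomial_bound a50 5 0).
    apply Rabs_mult_le; [apply Rabs_mult_le; [apply Rabs_le; lra|]|].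
    - apply Rabs_mult_le; [apply Rabs_le; lra | easy].
    - replace coef_norm with ((Rabs a11 + Rabs a40) + (Rabs a21 + Rabs a50))
        by (unfold coef_norm; ring).
      apply Rabs_plus_le; [now apply Rabs_plus_le|].
      rewrite <- (Rmult_1_l (Rabs a21 + Rabs a50)).
      apply Rabs_mult_le; [apply Rabs_le; lra | now apply Rabs_plus_le]. }
  pose proof rmax_coef. apply Rabs_le_between in A. lra.
Qed.

Lemma slope_le (r : R) : 0 <= r <= rmax -> Rabs (slope c s r) <= 2 * num_bound.
Proof.
  intros Hr. pose proof rmax_bounds. pose proof (den_ge r Hr).
  unfold slope, Rdiv. rewrite Rmult_comm. apply Rabs_mult_le; [|apply num_le; lra].
  rewrite Rabs_inv, Rabs_right by lra.
  replace 2 with (/ / 2) by field. apply Rinv_le_contravar; lra.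
Qed.

Definition slope_lip : R := 8 * coef_norm * (den_bound + 3 * num_bound).

Lemma slope_diff (r r' : R) : 0 <= r <= rmax -> 0 <= r' <= rmax ->
  Rabs (slope c s r - slope c s r') <= slope_lip * Rabs (r - r').
Proof.
  intros Hr Hr'. pose proof rmax_bounds.
  pose proof (den_ge r Hr). pose proof (den_ge r' Hr').
  unfold slope.
  replace (num c s r / den c s r - num c s r' / den c s r') with
    (((num c s r - num c s r') * den c s r' - num c s r' * (den c s r - den c s r'))
     * (/ den c s r * / den c s r')) by (field; lra).
  replace (slope_lip * Rabs (r - r')) with
    ((2 * coef_norm * Rabs (r - r') * den_bound
      + num_bound * (6 * coef_norm * Rabs (r - r'))) * (2 * 2))
    by (unfold slope_lip; ring).
  apply Rabs_mult_le.
  - apply Rabs_minus_le; apply Rabs_mult_le.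
    + apply num_diff; lra.
    + apply den_le; lra.
    + apply num_le; lra.
    + apply den_diff; lra.
  - apply Rabs_mult_le; rewrite Rabs_inv, Rabs_right by lra;
      (replace 2 with (/ / 2) by field); apply Rinv_le_contravar; lra.
Qed.

End UnitCircle.

Lemma bounds_nonneg : 2 <= num_bound /\ 4 <= den_bound /\ 0 <= slope_lip.
Proof.
  pose proof coef_norm_nonneg. pose proof (Rabs_pos mu).
  unfold slope_lip, num_bound, den_bound. repeat split; try lra.
  repeat (lra || apply Rmult_le_pos).
Qed.

(* The radius is [exp u]; clamping it at [rmax] makes the equation globally
   Lipschitz without changing it near the origin. *)
Definition umax : R := ln rmax.
Definition radius (u : R) : R := exp (Rmin u umax).

Lemma radius_bounds (u : R) : 0 < radius u <= rmax.
Proof.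
  unfold radius. split; [apply exp_pos|].
  rewrite <- (exp_ln rmax) by apply rmax_bounds.
  destruct (Rmin_r u umax) as [H|H]; [left; now apply exp_increasing | now rewrite H; right].
Qed.

Lemma radius_exp (u : R) : u <= umax -> radius u = exp u.
Proof. intros H. unfold radius. now rewrite Rmin_left. Qed.

(** The clamped exponential has values at most [rmax], which is less than 1, and these values bound
    its slopes. *)
Lemma radius_lipschitz (u v : R) : Rabs (radius u - radius v) <= Rabs (u - v).
Proof.
  assert (A : forall u v, u <= v -> 0 <= radius v - radius u <= v - u).
  { intros a b Hab. pose proof (radius_bounds b) as Hb. pose proof rmax_bounds.
    unfold radius in *.
    assert (0 <= Rmin b umax - Rmin a umax <= b - a).
    { unfold Rmin. destruct (Rle_dec a umax); destruct (Rle_dec b umax); lra. }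
    pose proof (exp_ineq1_le (Rmin a umax - Rmin b umax)) as E.
    replace (Rmin a umax) with (Rmin b umax + (Rmin a umax - Rmin b umax)) by ring.
    rewrite exp_plus.
    assert (exp (Rmin a umax - Rmin b umax) <= 1).
    { rewrite <- exp_0. destruct (Req_dec (Rmin a umax - Rmin b umax) 0) as [->|]; [lra|].
      left. apply exp_increasing. lra. }
    nra. }
  destruct (Rle_dec u v).
  - specialize (A u v r). rewrite Rabs_minus_sym, (Rabs_minus_sym u).
    rewrite !Rabs_right; lra.
  - specialize (A v u ltac:(lra)). rewrite !Rabs_right; lra.
Qed.

Lemma radius_continuous (u : R) : continuous radius u.
Proof.
  apply continuity_pt_filterlim. intros eps Heps. exists eps. split; [easy|].
  intros x [_ Hx]. simpl in *. unfold R_dist in *.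
  eapply Rle_lt_trans; [apply radius_lipschitz | easy].
Qed.

Definition field (t u : R) : R := slope (cos t) (sin t) (radius u).

Lemma field_bound (t u : R) : Rabs (field t u) <= 2 * num_bound.
Proof.
  apply slope_le; [apply cos2_plus_sin2|].
  pose proof (radius_bounds u). lra.
Qed.

Lemma field_lipschitz (t u v : R) :
  Rabs (field t u - field t v) <= (1 + slope_lip) * Rabs (u - v).
Proof.
  pose proof (radius_bounds u). pose proof (radius_bounds v).
  eapply Rle_trans; [apply slope_diff; [apply cos2_plus_sin2 | lra | lra]|].
  destruct bounds_nonneg as [_ [_ HL]].
  pose proof (radius_lipschitz u v). pose proof (Rabs_pos (u - v)). nra.
Qed.

Definition den_at (t u : R) : R := den (cos t) (sin t) (radius u).

Lemma den_at_bounds (t u : R) : / 2 <= den_at t u <= den_bound.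
Proof.
  pose proof (radius_bounds u). pose proof rmax_bounds. split.
  - apply den_ge; [apply cos2_plus_sin2 | lra].
  - eapply Rle_trans; [apply Rle_abs|].
    apply den_le; [apply cos2_plus_sin2 | lra].
Qed.

Lemma continuous_pow (f : R -> R) (n : nat) (t : R) :
  continuous f t -> continuous (fun s => f s ^ n) t.
Proof.
  intros Hf. induction n; simpl; [apply continuous_const|].
  now apply (continuous_mult (K := R_AbsRing)).
Qed.

Ltac continuity_tac :=
  repeat lazymatch goal with
    | |- continuous (fun _ => ?c) _ => apply continuous_const
    | |- continuous (fun x => cos x) _ => apply continuous_cos
    | |- continuous (fun x => sin x) _ => apply continuous_sin
    | |- continuous (fun x => @?f x ^ ?n) _ => apply (continuous_pow f n)
    | |- continuous (fun x => @?f x + @?g x) _ =>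
        apply (continuous_plus (V := R_NormedModule) f g)
    | |- continuous (fun x => @?f x - @?g x) _ =>
        apply (continuous_minus (V := R_NormedModule) f g)
    | |- continuous (fun x => @?f x * @?g x) _ =>
        apply (continuous_mult (K := R_AbsRing) f g)
    | |- continuous (fun x => - @?f x) _ =>
        apply (continuous_opp (V := R_NormedModule) f)
    | |- continuous (fun x => ?f x) _ => assumption
    | |- _ => assumption
    end.

Lemma xq_continuous (c s r : R -> R) (t : R) :
  continuous c t -> continuous s t -> continuous r t ->
  continuous (fun x => xq (c x) (s x) (r x)) t.
Proof. intros Hc Hs Hr. unfold xq. continuity_tac. Qed.

Lemma yq_continuous (c s : R -> R) (t : R) :
  continuous c t -> continuous s t -> continuous (fun x => yq (c x) (s x)) t.
Proof. intros Hc Hs. unfold yq. continuity_tac. Qed.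

Lemma radius_comp_continuous (v : R -> R) (t : R) :
  continuous v t -> continuous (fun x => radius (v x)) t.
Proof. intros H. apply (continuous_comp v radius); [easy | apply radius_continuous]. Qed.

Lemma den_at_continuous (v : R -> R) (t : R) :
  continuous v t -> continuous (fun x => den_at x (v x)) t.
Proof.
  intros Hv. unfold den_at, den.
  pose proof (xq_continuous cos sin (fun x => radius (v x)) t (continuous_cos t)
    (continuous_sin t) (radius_comp_continuous v t Hv)).
  pose proof (yq_continuous cos sin t (continuous_cos t) (continuous_sin t)).
  continuity_tac.
Qed.

Lemma field_continuous (v : R -> R) (t : R) :
  continuous v t -> continuous (fun x => field x (v x)) t.
Proof.
  intros Hv. unfold field, slope, Rdiv.
  apply (continuous_mult (K := R_AbsRing)).
  - pose proof (xq_continuous cos sin (fun x => radius (v x)) t (continuous_cos t)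
      (continuous_sin t) (radius_comp_continuous v t Hv)).
    pose proof (yq_continuous cos sin t (continuous_cos t) (continuous_sin t)).
    unfold num. continuity_tac.
  - apply continuous_Rinv_comp; [now apply den_at_continuous|].
    pose proof (den_at_bounds t (v t)) as B. unfold den_at in B. lra.
Qed.

(** Solutions of the clamped equation, defined for all angles. They carry orbits of the system where
    [u t <= umax]. *)
Definition angular (u : R -> R) : Prop := forall t, is_derive u t (field t (u t)).

Lemma angular_exists (t0 u0 : R) : exists u, u t0 = u0 /\ angular u.
Proof.
  apply (ode_existence field (2 * num_bound) (1 + slope_lip)).
  - pose proof bounds_nonneg. lra.
  - intros v Hv t. apply field_continuous, Hv.
  - apply field_bound.
  - apply field_lipschitz.
Qed.

Lemma angular_unique (u v : R -> R) (t0 : R) :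
  angular u -> angular v -> u t0 = v t0 -> forall t, u t = v t.
Proof. apply ode_uniqueness with (1 := field_lipschitz). Qed.

Lemma angular_growth (u : R -> R) (s t : R) :
  angular u -> Rabs (u t - u s) <= 2 * num_bound * Rabs (t - s).
Proof.
  intros Hu. apply (derive_bounded_lipschitz u (fun x => field x (u x)));
    [exact Hu | intros; apply field_bound].
Qed.

(* Angular velocity of the orbit carried by [u]. *)
Definition speed (u : R -> R) (t : R) : R :=
  radius (u t) ^ 2 * den_at t (u t) / (cos t ^ 2 + 3 * sin t ^ 2).

Lemma speed_bounds (u : R -> R) (t : R) : 0 < speed u t <= den_bound.
Proof.
  pose proof (radius_bounds (u t)) as Hr. pose proof rmax_bounds.
  pose proof (den_at_bounds t (u t)) as Hd. pose proof (cos2_plus_sin2 t).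
  assert (0 <= sin t ^ 2) by apply pow2_ge_0.
  assert (0 < radius (u t) ^ 2 <= 1) by nra.
  unfold speed. split.
  - apply Rdiv_lt_0_compat; [|lra]. apply Rmult_lt_0_compat; lra.
  - apply Rle_div_l; [lra|]. pose proof bounds_nonneg. nra.
Qed.

Lemma speed_continuous (u : R -> R) (t : R) : continuous u t -> continuous (speed u) t.
Proof.
  intros Hu. unfold speed, Rdiv.
  pose proof (cos2_plus_sin2 t). pose proof (pow2_ge_0 (sin t)).
  apply (continuous_mult (K := R_AbsRing)); [apply (continuous_mult (K := R_AbsRing))|].
  - apply continuous_pow, radius_comp_continuous, Hu.
  - now apply den_at_continuous.
  - apply continuous_Rinv_comp; [continuity_tac | lra].
Qed.

(** Solving for the velocity amounts to the identities [c * num - s * den = (c^2 + 3 s^2) * xq] and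
    [3 * s * num + c * den = (c^2 + 3 s^2) * yq]. *)
Lemma quasipolar_derive (u : R -> R) (t : R) :
  angular u -> u t <= umax ->
  is_derive (fun z => exp (u z) * cos z) t
    (xdot mu a11 a21 a40 a50 (exp (u t) * cos t) (exp (u t) ^ 3 * sin t) / speed u t) /\
  is_derive (fun z => exp (u z) ^ 3 * sin z) t
    (ydot mu (exp (u t) * cos t) (exp (u t) ^ 3 * sin t) / speed u t).
Proof.
  intros Hu Hle. specialize (Hu t).
  pose proof (cos2_plus_sin2 t) as Hcs. pose proof (pow2_ge_0 (sin t)).
  pose proof (den_at_bounds t (u t)) as Hd.
  pose proof (exp_pos (u t)) as Hr.
  unfold speed, field, slope, den_at in *. rewrite (radius_exp _ Hle) in *.
  set (c := cos t) in *. set (s := sin t) in *. set (r := exp (u t)) in *.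
  assert (He : is_derive (fun z => exp (u z)) t (r * (num c s r / den c s r))).
  { eapply is_derive_eq.
    - apply (is_derive_comp exp u); [apply is_derive_exp | exact Hu].
    - unfold scal; simpl; unfold mult; simpl. fold r. ring. }
  split.
  - eapply is_derive_eq.
    + apply (is_derive_mult (fun z => exp (u z)) cos);
        [exact He | apply is_derive_cos | intros; apply Rmult_comm].
    + unfold plus, mult; cbn -[pow INR]. fold c s r.
      replace (xdot mu a11 a21 a40 a50 (r * c) (r ^ 3 * s)) with (r ^ 3 * xq c s r)
        by (unfold xdot, xq; ring).
      apply (Rmult_eq_reg_r (den c s r)); [|lra].
      replace ((r * (num c s r / den c s r) * c + r * - s) * den c s r)
        with (r * (num c s r * c - s * den c s r)) by (field; lra).
      replace (r ^ 3 * xq c s r / (r ^ 2 * den c s r / (c ^ 2 + 3 * s ^ 2)) * den c s r)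
        with (r * xq c s r * (c ^ 2 + 3 * s ^ 2)) by (field; lra).
      unfold num, den. ring.
  - eapply is_derive_eq.
    + apply (is_derive_mult (fun z => exp (u z) ^ 3) sin);
        [apply (is_derive_pow _ 3 _ _ He) | apply is_derive_sin | intros; apply Rmult_comm].
    + unfold plus, mult; cbn -[pow INR]. replace (INR 3) with 3 by (simpl; ring).
      fold c s r.
      replace (ydot mu (r * c) (r ^ 3 * s)) with (r ^ 5 * yq c s)
        by (unfold ydot, yq; ring).
      apply (Rmult_eq_reg_r (den c s r)); [|lra].
      replace ((3 * (r * (num c s r / den c s r)) * r ^ 2 * s + r ^ 3 * c) * den c s r)
        with (r ^ 3 * (3 * num c s r * s + c * den c s r)) by (field; lra).
      replace (r ^ 5 * yq c s / (r ^ 2 * den c s r / (c ^ 2 + 3 * s ^ 2)) * den c s r)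
        with (r ^ 3 * yq c s * (c ^ 2 + 3 * s ^ 2)) by (field; lra).
      unfold num, den. ring.
Qed.

(** * Quasi-polar coordinates *)

Lemma quasipolar_exists (x y : R) : (x, y) <> (0, 0) ->
  exists r t, 0 < r /\ 0 < t <= 2 * PI /\ x = r * cos t /\ y = r ^ 3 * sin t.
Proof.
  intros Hxy.
  (* This is [(x / r)^2 + (y / r^3)^2 = 1] multiplied by [r^6]. For [y = 0] it also has the root 0,
     hence the separate case. *)
  assert (Hr : exists r, 0 < r /\ r ^ 6 = x ^ 2 * r ^ 4 + y ^ 2).
  { destruct (Req_dec y 0) as [->|Hy].
    - exists (Rabs x). split.
      + apply Rabs_pos_lt. intros ->. now apply Hxy.
      + rewrite <- (pow2_abs x). ring.
    - set (M := 1 + x ^ 2 + y ^ 2).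
      assert (HM : 1 <= M) by (unfold M; pose proof (pow2_ge_0 x); pose proof (pow2_ge_0 y); lra).
      assert (HM4 : 1 <= M ^ 4) by now apply pow_R1_Rle.
      assert (HM2 : 1 <= M ^ 2) by now apply pow_R1_Rle.
      destruct (ivt_interval (fun r => r ^ 6 - x ^ 2 * r ^ 4) 0 M (y ^ 2)) as [r [Hr E]].
      + lra.
      + intros z _. apply derivable_continuous_pt. reg.
      + split; [pose proof (pow2_ge_0 y); lra|].
        replace (M ^ 6 - x ^ 2 * M ^ 4) with (M ^ 4 * (M ^ 2 - x ^ 2)) by ring.
        assert (y ^ 2 <= M ^ 2 - x ^ 2).
        { replace (M ^ 2) with (M * M) by ring.
          assert (M * 1 <= M * M) by (apply Rmult_le_compat_l; lra). unfold M in *. lra. }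
        pose proof (pow2_ge_0 y). nra.
      + exists r. split; [|lra].
        destruct (Req_dec r 0) as [->|]; [|lra].
        exfalso. apply Hy. rewrite !pow_i in E by lia. nra. }
  destruct Hr as [r [Hr E]].
  destruct (angle_exists (x / r) (y / r ^ 3)) as [t [Ht [Hc Hs]]].
  - apply (Rmult_eq_reg_r (r ^ 6)); [|apply pow_nonzero; lra].
    transitivity (x ^ 2 * r ^ 4 + y ^ 2); [field; lra | lra].
  - exists r, t. rewrite Hc, Hs. repeat split; try easy; field; lra.
Qed.

(** If [r >= e], both the cosine and the sine would be below [/ 2] in absolute value. *)
Lemma quasipolar_small (r t e : R) : 0 < e ->
  Rabs (r * cos t) < e / 2 -> Rabs (r ^ 3 * sin t) < (e / 2) ^ 3 -> 0 < r -> r < e.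
Proof.
  intros He Hc Hs Hr. destruct (Rlt_dec r e) as [|N]; [easy|]. exfalso.
  rewrite Rabs_mult, Rabs_right in Hc by lra.
  rewrite Rabs_mult, Rabs_right in Hs by (left; now apply pow_lt).
  assert (Hr3 : e ^ 3 <= r ^ 3) by (apply pow_incr; lra).
  assert (He3 : 0 < e ^ 3) by now apply pow_lt.
  replace ((e / 2) ^ 3) with (e ^ 3 / 8) in Hs by field.
  pose proof (Rabs_pos (cos t)). pose proof (Rabs_pos (sin t)).
  assert (C : Rabs (cos t) < / 2) by nra.
  assert (S : Rabs (sin t) < / 2) by nra.
  pose proof (cos2_plus_sin2 t) as P. rewrite <- (pow2_abs (cos t)), <- (pow2_abs (sin t)) in P.
  nra.
Qed.

(** If [k = r / r'] were less than 1, the dilation by [(k, k^3)] would send a point of the unit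
    circle to another one, although it shrinks the squared norm at least by the factor [k^2]. *)
Lemma quasipolar_radius_le (r r' s t : R) : 0 < r -> 0 < r' ->
  r * cos s = r' * cos t -> r ^ 3 * sin s = r' ^ 3 * sin t -> r' <= r.
Proof.
  intros Hr Hr' Hc Hs. destruct (Rle_dec r' r) as [|N]; [easy|]. exfalso.
  pose proof (cos2_plus_sin2 s) as P. pose proof (cos2_plus_sin2 t) as P'.
  set (k := r / r').
  assert (Hk : 0 < k < 1).
  { unfold k. split; [apply Rdiv_lt_0_compat; lra | apply Rlt_div_l; lra]. }
  replace (cos t) with (k * cos s) in P'
    by (unfold k; apply (Rmult_eq_reg_l r'); [rewrite <- Hc; field|]; lra).
  assert (Hr3 : r' ^ 3 <> 0) by (apply pow_nonzero; lra).
  replace (sin t) with (k ^ 3 * sin s) in P'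
    by (unfold k; apply (Rmult_eq_reg_l (r' ^ 3)); [rewrite <- Hs; field|]; lra).
  assert (Hk2 : k ^ 2 < 1) by nra.
  assert (Hk4 : k ^ 4 <= 1) by (rewrite <- (pow1 4); apply pow_incr; lra).
  assert ((k * cos s) ^ 2 + (k ^ 3 * sin s) ^ 2 <= k ^ 2 * 1).
  { rewrite <- P. replace ((k ^ 3 * sin s) ^ 2) with (k ^ 2 * (k ^ 4 * sin s ^ 2)) by ring.
    replace ((k * cos s) ^ 2) with (k ^ 2 * cos s ^ 2) by ring.
    rewrite <- Rmult_plus_distr_l. apply Rmult_le_compat_l; [apply pow2_ge_0|].
    pose proof (pow2_ge_0 (sin s)). nra. }
  lra.
Qed.

Lemma quasipolar_unique (r r' s t : R) : 0 < r -> 0 < r' ->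
  r * cos s = r' * cos t -> r ^ 3 * sin s = r' ^ 3 * sin t ->
  r = r' /\ exists k : Z, s = t + IZR k * (2 * PI).
Proof.
  intros Hr Hr' Hc Hs.
  assert (E : r = r').
  { apply Rle_antisym.
    - now apply (quasipolar_radius_le r' r t s).
    - now apply (quasipolar_radius_le r r' s t). }
  split; [easy|]. subst r'. apply angle_unique.
  - apply (Rmult_eq_reg_l r); lra.
  - apply (Rmult_eq_reg_l (r ^ 3)); [easy | apply pow_nonzero; lra].
Qed.

(* The true polar angle minus the quasi-polar angle. *)
Definition angle_defect (r t : R) : R :=
  atan ((r ^ 2 - 1) * (sin t * cos t) / (cos t ^ 2 + r ^ 2 * sin t ^ 2)).

Lemma angle_defect_den (r t : R) : 0 < r -> 0 < cos t ^ 2 + r ^ 2 * sin t ^ 2.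
Proof.
  intros Hr. pose proof (cos2_plus_sin2 t). assert (0 < r ^ 2) by now apply pow_lt.
  pose proof (pow2_ge_0 (cos t)). pose proof (pow2_ge_0 (sin t)).
  destruct (Req_dec (cos t ^ 2) 0); nra.
Qed.

Lemma quasipolar_pos (r t : R) : 0 < r -> 0 < (r * cos t) ^ 2 + (r ^ 3 * sin t) ^ 2.
Proof.
  intros Hr.
  replace ((r * cos t) ^ 2 + (r ^ 3 * sin t) ^ 2)
    with (r ^ 2 * (cos t ^ 2 + (r ^ 2) ^ 2 * sin t ^ 2)) by ring.
  apply Rmult_lt_0_compat; [now apply pow_lt|].
  apply angle_defect_den. now apply pow_lt.
Qed.

(** The tangent of the polar angle is [r^2 * tan t], and the argument of [atan] in [angle_defect] is
    the subtraction formula for tangents. Its denominator never vanishes, so the defect is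
    continuous and stays within a quarter turn. *)
Lemma quasipolar_polar (r t : R) : 0 < r ->
  let R := sqrt ((r * cos t) ^ 2 + (r ^ 3 * sin t) ^ 2) in
  r * cos t = R * cos (t + angle_defect r t) /\
  r ^ 3 * sin t = R * sin (t + angle_defect r t).
Proof.
  intros Hr R.
  pose proof (cos2_plus_sin2 t) as P. pose proof (angle_defect_den r t Hr) as Hw.
  set (c := cos t) in *. set (s := sin t) in *.
  set (w := c ^ 2 + r ^ 2 * s ^ 2) in *.
  set (k := (r ^ 2 - 1) * (s * c) / w).
  assert (HR : 0 < R) by (apply sqrt_lt_R0, quasipolar_pos, Hr).
  assert (HR2 : R ^ 2 = (r * c) ^ 2 + (r ^ 3 * s) ^ 2)
    by (apply pow2_sqrt; left; apply quasipolar_pos, Hr).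
  assert (Hk : sqrt (1 + Rsqr k) = R / (r * w)).
  { apply sqrt_lem_1.
    - pose proof (Rle_0_sqr k). lra.
    - apply Rle_mult_inv_pos; [lra | now apply Rmult_lt_0_compat].
    - replace (R / (r * w) * (R / (r * w))) with (R ^ 2 / (r * w) ^ 2) by (field; lra).
      rewrite HR2. unfold Rsqr, k.
      apply (Rmult_eq_reg_r (w ^ 2)); [|apply pow_nonzero; lra].
      replace (((r * c) ^ 2 + (r ^ 3 * s) ^ 2) / (r * w) ^ 2 * w ^ 2)
        with ((c ^ 2 + r ^ 4 * s ^ 2) * 1) by (field; lra).
      replace ((1 + (r ^ 2 - 1) * (s * c) / w * ((r ^ 2 - 1) * (s * c) / w)) * w ^ 2)
        with (w ^ 2 + (r ^ 2 - 1) ^ 2 * (s * c) ^ 2) by (field; lra).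
      transitivity ((c ^ 2 + r ^ 4 * s ^ 2) * (c ^ 2 + s ^ 2));
        [now rewrite P | unfold w; ring]. }
  assert (Hcos : cos (angle_defect r t) = r * w / R).
  { unfold angle_defect. fold c s w k. rewrite cos_atan, Hk. field. lra. }
  assert (Hsin : sin (angle_defect r t) = (r ^ 2 - 1) * (s * c) * r / R).
  { unfold angle_defect. fold c s w k. rewrite sin_atan, Hk. unfold k. field. lra. }
  rewrite cos_plus, sin_plus, Hcos, Hsin. fold c s. split.
  - replace (R * (c * (r * w / R) - s * ((r ^ 2 - 1) * (s * c) * r / R)))
      with (r * c * (w - (r ^ 2 - 1) * s ^ 2)) by (field; lra).
    replace (w - (r ^ 2 - 1) * s ^ 2) with (c ^ 2 + s ^ 2) by (unfold w; ring).
    rewrite P. ring.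
  - replace (R * (s * (r * w / R) + c * ((r ^ 2 - 1) * (s * c) * r / R)))
      with (r * s * (w + (r ^ 2 - 1) * c ^ 2)) by (field; lra).
    replace (w + (r ^ 2 - 1) * c ^ 2) with (r ^ 2 * (c ^ 2 + s ^ 2)) by (unfold w; ring).
    rewrite P. ring.
Qed.

Lemma angle_defect_continuous (r th : R -> R) (t : R) :
  (forall x, 0 < r x) -> continuous r t -> continuous th t ->
  continuous (fun x => angle_defect (r x) (th x)) t.
Proof.
  intros Hr Hrc Hth. unfold angle_defect.
  assert (Hc : continuous (fun x => cos (th x)) t) by now apply continuous_cos_comp.
  assert (Hs : continuous (fun x => sin (th x)) t) by now apply continuous_sin_comp.
  apply (continuous_comp _ atan); [|apply continuous_atan].
  apply (continuous_mult (K := R_AbsRing)); [continuity_tac|].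
  apply continuous_Rinv_comp; [continuity_tac|].
  pose proof (angle_defect_den (r t) (th t) (Hr t)). lra.
Qed.

(** * Orbits *)

(** [tau] is the time as a function of the angle, the integral of [1 / speed]; [Th] is its inverse.
    The upper bound on the speed makes [tau] onto, so the angle is defined for all times. *)
Lemma time_change (u : R -> R) (t0 : R) : angular u ->
  exists tau Th : R -> R,
    tau t0 = 0 /\ (forall a, is_derive tau a (/ speed u a)) /\
    (forall t, tau (Th t) = t) /\ (forall a, Th (tau a) = a) /\
    (forall t, is_derive Th t (speed u (Th t))).
Proof.
  intros Hu.
  assert (Huc : forall a, continuous u a) by (intros a; eapply is_derive_continuous, Hu).
  set (tau := RInt (fun a => / speed u a) t0).
  assert (Htau : forall a, is_derive tau a (/ speed u a)).
  { intros a. apply (is_derive_RInt_continuous (fun a => / speed u a)). intros b.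
    apply continuous_Rinv_comp; [now apply speed_continuous|].
    pose proof (speed_bounds u b). lra. }
  pose proof bounds_nonneg as B.
  destruct (increasing_inverse tau (fun a => / speed u a) (/ den_bound))
    as [Th [H1 [H2 H3]]].
  - apply Rinv_0_lt_compat. lra.
  - exact Htau.
  - intros a. pose proof (speed_bounds u a). apply Rinv_le_contravar; lra.
  - exists tau, Th. split; [exact (RInt_point t0 _)|].
    split; [exact Htau|]. split; [exact H1|]. split; [exact H2|].
    intros t. eapply is_derive_eq; [apply H3 | apply Rinv_inv].
Qed.

Lemma time_change_increasing (u Th : R -> R) (s t : R) :
  (forall t, is_derive Th t (speed u (Th t))) -> s < t -> Th s < Th t.
Proof.
  intros H Hst. apply (derive_pos_lt Th (fun t => speed u (Th t))); auto.
  - intros x _. eapply is_derive_continuity_pt, H.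
  - intros x _. apply speed_bounds.
Qed.

Lemma orbit_derive (u Th : R -> R) (t : R) :
  angular u -> is_derive Th t (speed u (Th t)) -> u (Th t) <= umax ->
  is_derive (fun z => exp (u (Th z)) * cos (Th z)) t
    (xdot mu a11 a21 a40 a50 (exp (u (Th t)) * cos (Th t)) (exp (u (Th t)) ^ 3 * sin (Th t))) /\
  is_derive (fun z => exp (u (Th z)) ^ 3 * sin (Th z)) t
    (ydot mu (exp (u (Th t)) * cos (Th t)) (exp (u (Th t)) ^ 3 * sin (Th t))).
Proof.
  intros Hu HTh Hle. pose proof (speed_bounds u (Th t)).
  destruct (quasipolar_derive u (Th t) Hu Hle) as [Hx Hy]. split.
  - eapply is_derive_eq.
    + apply (is_derive_comp (fun z => exp (u z) * cos z) Th); [exact Hx | exact HTh].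
    + unfold scal; simpl; unfold mult; cbn -[pow]. field. lra.
  - eapply is_derive_eq.
    + apply (is_derive_comp (fun z => exp (u z) ^ 3 * sin z) Th); [exact Hy | exact HTh].
    + unfold scal; simpl; unfold mult; cbn -[pow]. field. lra.
Qed.

Lemma orbit_polar_angle (D : R -> Prop) (u Th : R -> R) :
  angular u -> (forall t, is_derive Th t (speed u (Th t))) ->
  polar_angle D (fun z => exp (u (Th z)) * cos (Th z))
    (fun z => exp (u (Th z)) ^ 3 * sin (Th z))
    (fun z => Th z + angle_defect (exp (u (Th z))) (Th z)).
Proof.
  intros Hu HTh t _. split; [apply quasipolar_pos, exp_pos|]. split.
  - assert (Hc : continuous Th t) by (eapply is_derive_continuous, HTh).
    apply (continuous_plus (V := R_NormedModule)); [exact Hc|].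
    apply (angle_defect_continuous (fun z => exp (u (Th z))) Th);
      [intros; apply exp_pos | | exact Hc].
    apply continuous_exp_comp, (continuous_comp Th u); [exact Hc|].
    eapply is_derive_continuous, Hu.
  - apply quasipolar_polar, exp_pos.
Qed.

Lemma returns_decreasing (u : R -> R) (e : R) (n : nat) (t : R) :
  (forall t, u (t + e * (2 * PI)) <= u t) -> u (t + e * (INR n * (2 * PI))) <= u t.
Proof.
  intros H. induction n as [|n IH].
  - simpl. right. f_equal. ring.
  - rewrite S_INR.
    replace (t + e * ((INR n + 1) * (2 * PI)))
      with (t + e * (INR n * (2 * PI)) + e * (2 * PI)) by ring.
    eapply Rle_trans; [apply H | exact IH].
Qed.

(** Removing whole turns brings [t] within one turn of [t0] without decreasing [u]. The sign [e] is
    the direction in which the returns do not increase. *)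
Lemma returns_bound (u : R -> R) (e t0 t : R) :
  e = 1 \/ e = -1 -> angular u -> (forall t, u (t + e * (2 * PI)) <= u t) ->
  0 <= e * (t - t0) -> u t <= u t0 + 2 * num_bound * (2 * PI).
Proof.
  intros He Hu Hdec Ht.
  destruct (turns_exist _ Ht) as [n Hn].
  assert (Hee : e * e = 1) by (destruct He; subst; ring).
  set (t' := t - e * (INR n * (2 * PI))).
  replace t with (t' + e * (INR n * (2 * PI))) by (unfold t'; ring).
  eapply Rle_trans; [now apply returns_decreasing|].
  pose proof (angular_growth u t0 t' Hu) as G. pose proof (Rle_abs (u t' - u t0)).
  assert (Rabs (t' - t0) <= 2 * PI).
  { replace (t' - t0) with (e * (e * (t - t0) - INR n * (2 * PI))).
    - rewrite Rabs_mult. replace (Rabs e) with 1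
        by (destruct He; subst; [rewrite Rabs_R1 | rewrite Rabs_left]; lra).
      rewrite Rabs_right; lra.
    - unfold t'. replace (e * (e * (t - t0) - INR n * (2 * PI)))
        with (e * e * (t - t0) - e * (INR n * (2 * PI))) by ring. rewrite Hee. ring. }
  pose proof bounds_nonneg.
  assert (2 * num_bound * Rabs (t' - t0) <= 2 * num_bound * (2 * PI))
    by (apply Rmult_le_compat_l; lra).
  lra.
Qed.

Lemma periodic_bound (u : R -> R) (t0 t : R) :
  angular u -> (forall t, u (t + 2 * PI) = u t) ->
  u t <= u t0 + 2 * num_bound * (2 * PI).
Proof.
  intros Hu Hp. destruct (Rle_dec t0 t).
  - apply (returns_bound u 1); auto; [|lra].
    intros s. rewrite Rmult_1_l, Hp. lra.
  - apply (returns_bound u (-1)); auto; [|lra].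
    intros s. rewrite <- (Hp (s + -1 * (2 * PI))).
    right. f_equal. ring.
Qed.

Lemma periodic_orbit (u : R -> R) (t0 : R) :
  angular u -> (forall t, u (t + 2 * PI) = u t) -> (forall t, u t <= umax) ->
  periodic_orbit_around_origin (xdot mu a11 a21 a40 a50) (ydot mu)
    (exp (u t0) * cos t0) (exp (u t0) ^ 3 * sin t0).
Proof.
  intros Hu Hp Hle. pose proof PI_RGT_0.
  destruct (time_change u t0 Hu) as [tau [Th [Htau0 [Htau [H1 [H2 HTh]]]]]].
  assert (HTh0 : Th 0 = t0) by (rewrite <- Htau0; apply H2).
  set (T := tau (t0 + 2 * PI)).
  (* The speed along a periodic [u] is periodic, so every turn takes the same time [T]. *)
  assert (HT : forall a, tau (a + 2 * PI) = tau a + T).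
  { intros a.
    assert (D : forall a, is_derive (fun a => tau (a + 2 * PI) - tau a) a 0).
    { intros b. eapply is_derive_eq.
      - apply (is_derive_minus (V := R_NormedModule)); [|apply Htau].
        apply (is_derive_comp tau (fun a => a + 2 * PI)); [apply Htau|].
        auto_derive; [auto | reflexivity].
      - unfold speed, den_at. rewrite Hp, cos_plus, sin_plus, cos_2PI, sin_2PI.
        unfold minus, plus, opp, scal; simpl; unfold mult; simpl.
        rewrite !Rmult_1_r, !Rmult_0_r, Rminus_0_r, Rplus_0_r. ring. }
    pose proof (derive_zero_const _ a t0 D) as E. simpl in E. fold T in E. lra. }
  assert (HThT : forall t, Th (t + T) = Th t + 2 * PI).
  { intros t. rewrite <- (H2 (Th t + 2 * PI)), HT, H1. reflexivity. }
  assert (HTpos : 0 < T).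
  { destruct (Rlt_dec 0 T) as [|N]; [easy|].
    assert (Th T <= Th 0).
    { destruct (Req_dec T 0) as [->|]; [lra|].
      left. apply (time_change_increasing u); [exact HTh | lra]. }
    pose proof (HThT 0) as E. rewrite Rplus_0_l in E. lra. }
  exists (fun z => exp (u (Th z)) * cos (Th z)), (fun z => exp (u (Th z)) ^ 3 * sin (Th z)),
    (fun z => Th z + angle_defect (exp (u (Th z))) (Th z)), T.
  assert (Hper : forall a, cos (a + 2 * PI) = cos a /\ sin (a + 2 * PI) = sin a).
  { intros a. rewrite cos_plus, sin_plus, cos_2PI, sin_2PI. split; ring. }
  split; [exact HTpos|]. split; [|split; [|split; [|split; [|split; [|split]]]]].
  - intros t. apply orbit_derive; auto.
  - now rewrite HTh0.
  - now rewrite HTh0.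
  - intros t. rewrite HThT, Hp. destruct (Hper (Th t)) as [-> ->]. easy.
  (* An earlier passage through the initial point would need an integer number of turns strictly
     between 0 and 1. *)
  - intros t Ht E. injection E as Ex Ey.
    apply quasipolar_unique in Ex as [_ [k Hk]]; auto using exp_pos.
    pose proof (time_change_increasing u Th 0 t HTh ltac:(lra)) as I1.
    pose proof (time_change_increasing u Th t T HTh ltac:(lra)) as I2.
    pose proof (HThT 0) as E. rewrite Rplus_0_l in E.
    rewrite HTh0 in *. rewrite E, Hk in I2. rewrite Hk in I1.
    assert (0 < IZR k < 1) as [K1 K2] by (split; nra).
    apply lt_IZR in K1. apply lt_IZR in K2. lia.
  - now apply orbit_polar_angle.
  - pose proof (HThT 0) as E. rewrite Rplus_0_l in E. rewrite E, HTh0.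
    unfold angle_defect. rewrite Hp. destruct (Hper t0) as [-> ->].
    replace (t0 + 2 * PI + _ - _) with (2 * PI) by ring.
    apply Rabs_right. lra.
Qed.

Lemma locally_2d_quasipolar (P : R -> R -> Prop) (e : R) : 0 < e ->
  (forall r t, 0 < r < e -> 0 < t <= 2 * PI -> P (r * cos t) (r ^ 3 * sin t)) ->
  locally_2d (fun x y => (x, y) <> (0, 0) -> P x y) 0 0.
Proof.
  intros He H.
  assert (Hd : 0 < Rmin (e / 2) ((e / 2) ^ 3)) by (apply Rmin_glb_lt; [|apply pow_lt]; lra).
  exists (mkposreal _ Hd). simpl. intros x y Hx Hy Hxy.
  rewrite Rminus_0_r in Hx, Hy.
  destruct (quasipolar_exists x y Hxy) as [r [t [Hr [Ht [-> ->]]]]].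
  apply H; [|easy]. split; [easy|].
  apply (quasipolar_small r t); auto; (eapply Rlt_le_trans; [eassumption|]);
    [apply Rmin_l | apply Rmin_r].
Qed.

(** * Sufficiency of the conditions *)

Lemma center_of_periodic :
  (forall u, angular u -> forall t, u (t + 2 * PI) = u t) ->
  is_center (xdot mu a11 a21 a40 a50) (ydot mu).
Proof.
  intros Hp.
  (* A periodic [u] exceeds any of its values by at most [2 * num_bound * (2 * PI)]; starting this
     far below [umax] keeps the clamp inactive. *)
  apply (locally_2d_quasipolar _ (exp (umax - 2 * num_bound * (2 * PI)))); [apply exp_pos|].
  intros r t [Hr Hre] _.
  destruct (angular_exists t (ln r)) as [u [Hu0 Hu]].
  assert (Hr' : exp (u t) = r) by (rewrite Hu0; now apply exp_ln).
  rewrite <- Hr'. apply periodic_orbit; auto.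
  intros s. eapply Rle_trans; [apply (periodic_bound u t); auto|].
  apply ln_increasing in Hre; [|easy]. rewrite ln_exp in Hre. lra.
Qed.

Lemma angular_shift (u : R -> R) : angular u -> angular (fun t => u (t + 2 * PI)).
Proof.
  intros Hu t. eapply is_derive_eq.
  - apply (is_derive_comp u (fun t => t + 2 * PI)); [apply Hu|].
    auto_derive; [auto | reflexivity].
  - unfold field. rewrite cos_plus, sin_plus, cos_2PI, sin_2PI.
    unfold scal; simpl; unfold mult; simpl.
    rewrite !Rmult_1_r, !Rmult_0_r, Rminus_0_r, Rplus_0_r. ring.
Qed.

(** By uniqueness at the fixed point [a / 2] of the reflection, [u (a - t) = u t]. At
    [t = a / 2 - PI] this says that [u] and its shift by [2 * PI] agree, hence they agree
    everywhere. *)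
Lemma reversible_periodic (a : R) (u : R -> R) :
  (forall t v, field (a - t) v = - field t v) ->
  angular u -> forall t, u (t + 2 * PI) = u t.
Proof.
  intros Hs Hu.
  assert (Hr : angular (fun t => u (a - t))).
  { intros t. eapply is_derive_eq.
    - apply (is_derive_comp u (fun t => a - t)); [apply Hu|].
      auto_derive; [auto | reflexivity].
    - rewrite Hs. unfold scal; simpl; unfold mult; simpl. ring. }
  assert (E : forall t, u (a - t) = u t).
  { apply (angular_unique _ _ (a / 2) Hr Hu). f_equal. field. }
  apply (angular_unique _ _ (a / 2 - PI) (angular_shift u Hu) Hu).
  rewrite <- E. f_equal. field.
Qed.

Lemma periodic_of_conditions : mu = 0 -> a11 * a40 = 0 -> a50 = 0 ->
  forall u, angular u -> forall t, u (t + 2 * PI) = u t.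
Proof.
  intros Hmu H Ha50 u Hu.
  apply Rmult_integral in H as [Ha|Ha].
  - apply (reversible_periodic PI); [|exact Hu]. intros t v. unfold field, slope.
    rewrite cos_minus, sin_minus, cos_PI, sin_PI.
    set (r := radius v). set (c := cos t). set (s := sin t).
    replace (-1 * c + 0 * s) with (- c) by ring.
    replace (0 * c - -1 * s) with s by ring.
    replace (num (- c) s r) with (- num c s r)
      by (unfold num, xq, yq; rewrite Hmu, Ha, Ha50; ring).
    replace (den (- c) s r) with (den c s r)
      by (unfold den, xq, yq; rewrite Hmu, Ha, Ha50; ring).
    unfold Rdiv. ring.
  - apply (reversible_periodic 0); [|exact Hu]. intros t v. unfold field, slope.
    rewrite Rminus_0_l, cos_neg, sin_neg.
    set (r := radius v). set (c := cos t). set (s := sin t).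
    replace (num c (- s) r) with (- num c s r)
      by (unfold num, xq, yq; rewrite Hmu, Ha, Ha50; ring).
    replace (den c (- s) r) with (den c s r)
      by (unfold den, xq, yq; rewrite Hmu, Ha, Ha50; ring).
    unfold Rdiv. ring.
Qed.

(** * Monodromy *)

Definition turn_growth : R := exp (2 * num_bound * (2 * PI)).

Lemma turn_growth_ge1 : 1 <= turn_growth.
Proof.
  unfold turn_growth. pose proof bounds_nonneg. pose proof PI_RGT_0.
  pose proof (exp_ineq1_le (2 * num_bound * (2 * PI))).
  assert (0 <= 2 * num_bound * (2 * PI)) by (repeat (lra || apply Rmult_le_pos)). lra.
Qed.

Lemma radius_growth (u : R -> R) (t0 t : R) :
  angular u -> Rabs (t - t0) <= 2 * PI -> exp (u t) <= turn_growth * exp (u t0).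
Proof.
  intros Hu Ht. unfold turn_growth. rewrite <- exp_plus.
  pose proof (angular_growth u t0 t Hu) as G. pose proof (Rle_abs (u t - u t0)).
  pose proof bounds_nonneg.
  assert (2 * num_bound * Rabs (t - t0) <= 2 * num_bound * (2 * PI))
    by (apply Rmult_le_compat_l; lra).
  destruct (Req_dec (u t) (2 * num_bound * (2 * PI) + u t0)) as [->|]; [lra|].
  left. apply exp_increasing. lra.
Qed.

Lemma exp_le_umax (v : R) : exp v <= rmax -> v <= umax.
Proof.
  intros H. unfold umax. rewrite <- (ln_exp v).
  destruct H as [H| ->]; [|lra]. left. apply ln_increasing; [apply exp_pos | easy].
Qed.

(** The section is the positive [x] axis, reached at the angle [2 * PI]. With [t0 = 0] this is the
    full turn of the return map; for other [t0] it brings nearby points to the section. The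
    smallness of [turn_growth * r] serves both to keep the clamp inactive and to stay in the
    ball. *)
Lemma orbit_to_section (r t0 eta : R) :
  0 <= t0 <= 2 * PI -> 0 < r -> turn_growth * r < Rmin rmax eta ->
  exists (u Th : R -> R) (T : R),
    0 <= T /\ Th 0 = t0 /\ Th T = 2 * PI /\ angular u /\ exp (u t0) = r /\
    (forall t, is_derive Th t (speed u (Th t))) /\
    let x := fun z => exp (u (Th z)) * cos (Th z) in
    let y := fun z => exp (u (Th z)) ^ 3 * sin (Th z) in
    solution_on (xdot mu a11 a21 a40 a50) (ydot mu) T x y /\
    x 0 = r * cos t0 /\ y 0 = r ^ 3 * sin t0 /\
    x T = exp (u (2 * PI)) /\ y T = 0 /\
    exp (u (2 * PI)) <= turn_growth * r /\
    stays_within eta T x y.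
Proof.
  intros Ht0 Hr Hsmall.
  destruct (angular_exists t0 (ln r)) as [u [Hu0 Hu]].
  assert (Hur : exp (u t0) = r) by (rewrite Hu0; now apply exp_ln).
  destruct (time_change u t0 Hu) as [tau [Th [Htau0 [Htau [H1 [H2 HTh]]]]]].
  assert (HTh0 : Th 0 = t0) by (rewrite <- Htau0; apply H2).
  set (T := tau (2 * PI)).
  assert (HThT : Th T = 2 * PI) by apply H2.
  assert (Hmono : forall s t, s <= t -> Th s <= Th t).
  { intros s t [Hst| ->]; [|lra]. left. now apply (time_change_increasing u). }
  assert (HT : 0 <= T).
  { destruct (Rle_dec 0 T) as [|N]; [easy|].
    pose proof (time_change_increasing u Th T 0 HTh ltac:(lra)). lra. }
  assert (Hgrow : forall t, t0 <= t <= 2 * PI -> exp (u t) <= turn_growth * r).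
  { intros t Ht. rewrite <- Hur. apply radius_growth; [easy|].
    rewrite Rabs_right; lra. }
  assert (Hin : forall t, 0 <= t <= T -> t0 <= Th t <= 2 * PI).
  { intros t Ht. rewrite <- HTh0, <- HThT. split; apply Hmono; lra. }
  pose proof (Rmin_l rmax eta). pose proof (Rmin_r rmax eta).
  exists u, Th, T. split; [exact HT|]. split; [exact HTh0|]. split; [exact HThT|].
  split; [exact Hu|]. split; [exact Hur|]. split; [exact HTh|]. cbv zeta.
  split; [|split; [|split; [|split; [|split; [|split]]]]].
  - intros t Ht. apply orbit_derive; auto.
    apply exp_le_umax. specialize (Hgrow _ (Hin t Ht)). lra.
  - now rewrite HTh0, Hur.
  - now rewrite HTh0, Hur.
  - rewrite HThT, cos_2PI. ring.
  - rewrite HThT, sin_2PI. ring.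
  - apply Hgrow. lra.
  - intros t Ht. specialize (Hgrow _ (Hin t Ht)).
    pose proof (exp_pos (u (Th t))) as Hp. pose proof rmax_bounds.
    set (q := exp (u (Th t))) in *.
    pose proof (cos2_plus_sin2 (Th t)) as P. pose proof (pow2_ge_0 (sin (Th t))).
    replace ((q * cos (Th t)) ^ 2 + (q ^ 3 * sin (Th t)) ^ 2)
      with (q ^ 2 * (cos (Th t) ^ 2 + q ^ 4 * sin (Th t) ^ 2)) by ring.
    assert (q ^ 4 <= 1) by (rewrite <- (pow1 4); apply pow_incr; lra).
    assert (cos (Th t) ^ 2 + q ^ 4 * sin (Th t) ^ 2 <= 1) by nra.
    assert (q ^ 2 < eta ^ 2) by nra.
    pose proof (pow2_ge_0 q). nra.
Qed.

Lemma monodromic : is_monodromic (xdot mu a11 a21 a40 a50) (ydot mu).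
Proof.
  pose proof rmax_bounds as Hrm. pose proof turn_growth_ge1 as HM. pose proof PI_RGT_0.
  exists rmax, (fun s => s), (fun _ => 0), (fun _ => 0), 1.
  split; [now left|]. split; [|split].
  - assert (Dx : forall s, Derive (fun s : R => s) s = 1) by apply Derive_id.
    assert (Dy : forall s, Derive (fun _ : R => 0) s = 0) by (intros; apply Derive_const).
    split; [lra|]. split; [easy|]. split; [easy|]. split; [|split; [|split]].
    + intros s _. split; [apply ex_derive_id|]. split; [apply ex_derive_const|]. split.
      * apply continuous_ext with (fun _ => 1); [intros; now rewrite Dx | apply continuous_const].
      * apply continuous_ext with (fun _ => 0); [intros; now rewrite Dy | apply continuous_const].
    + rewrite Dx. intros E. injection E. lra.
    + now intros.
    + intros s Hs. rewrite Dx, Dy. unfold ydot.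
      assert (0 < s ^ 5) by (apply pow_lt; lra). lra.
  - intros s Hs. rewrite cos_0, sin_0, pow_i, Rplus_0_r by lia.
    rewrite sqrt_pow2 by lra. split; [apply pow_lt; lra|].
    split; [apply continuous_const | lra].
  - intros eta Heta.
    assert (Hm : 0 < Rmin rmax eta <= rmax) by (split; [apply Rmin_glb_lt | apply Rmin_l]; lra).
    set (delta := Rmin rmax eta / turn_growth).
    assert (Hd : turn_growth * delta = Rmin rmax eta) by (unfold delta; field; lra).
    assert (Hdp : 0 < delta) by (unfold delta; apply Rdiv_lt_0_compat; lra).
    exists delta. split; [split; [exact Hdp | nra]|]. split.
    + intros s Hs.
      destruct (orbit_to_section s 0 eta) as
        [u [Th [T [HT [HTh0 [HThT [Hu [Hur [HTh [Hsol [Hx0 [Hy0 [HxT [HyT [Hle Hst]]]]]]]]]]]]]]];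
        [lra | lra | nra |].
      exists (exp (u (2 * PI))). pose proof (exp_pos (u (2 * PI))).
      split; [split; [easy | nra]|].
      exists (fun z => exp (u (Th z)) * cos (Th z)), (fun z => exp (u (Th z)) ^ 3 * sin (Th z)),
        (fun z => Th z + angle_defect (exp (u (Th z))) (Th z)), T.
      assert (HT' : 0 < T) by (destruct HT as [|E]; [easy | rewrite <- E in HThT; lra]).
      split; [exact HT'|]. split; [exact Hsol|].
      split; [rewrite Hx0, cos_0; ring|]. split; [rewrite Hy0, sin_0; ring|].
      split; [exact HxT|]. split; [exact HyT|]. split; [|split; [exact Hst|split; [|split]]].
      (* Strictly between the angles 0 and [2 * PI] the ordinate vanishes only at [PI], where the
         abscissa is negative: the section is not met earlier. *)
      * intros t v Ht Hv E. injection E as Ex Ey.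
        pose proof (time_change_increasing u Th 0 t HTh ltac:(lra)) as I1.
        pose proof (time_change_increasing u Th t T HTh ltac:(lra)) as I2.
        rewrite HTh0 in I1. rewrite HThT in I2. pose proof (exp_pos (u (Th t))) as Hp.
        apply Rmult_integral in Ey as [Ey|Ey];
          [pose proof (pow_lt _ 3 Hp) as P3; simpl in P3; lra|].
        apply sin_eq_O_2PI_0 in Ey as [Ey|[Ey|Ey]]; try lra.
        rewrite Ey, cos_PI in Ex. rewrite Ey in Hp. lra.
      * now apply orbit_polar_angle.
      * rewrite HTh0. unfold angle_defect. rewrite sin_0, Rmult_0_l, Rmult_0_r.
        unfold Rdiv. rewrite Rmult_0_l, atan_0. ring.
      * rewrite HThT. unfold angle_defect. rewrite sin_2PI, Rmult_0_l, Rmult_0_r.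
        unfold Rdiv. rewrite Rmult_0_l, atan_0. ring.
    + apply (locally_2d_quasipolar (fun x0 y0 => exists (x y : R -> R) (T s : R),
            0 <= T /\ 0 < s < delta /\
            solution_on (xdot mu a11 a21 a40 a50) (ydot mu) T x y /\
            x 0 = x0 /\ y 0 = y0 /\ x T = s /\ y T = 0 /\
            stays_within eta T x y) (delta / turn_growth)); [apply Rdiv_lt_0_compat; lra|].
      intros r t [Hr Hrd] Ht. apply Rlt_div_r in Hrd; [|lra].
      destruct (orbit_to_section r t eta) as
        [u [Th [T [HT [HTh0 [HThT [Hu [Hur [HTh [Hsol [Hx0 [Hy0 [HxT [HyT [Hle Hst]]]]]]]]]]]]]]];
        [lra | lra | nra |].
      exists (fun z => exp (u (Th z)) * cos (Th z)), (fun z => exp (u (Th z)) ^ 3 * sin (Th z)),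
        T, (exp (u (2 * PI))).
      pose proof (exp_pos (u (2 * PI))).
      split; [exact HT|]. split; [lra|]. split; [exact Hsol|]. auto 6.
Qed.

(** * Centers have periodic radius *)

Lemma field_loc_lipschitz :
  loc_lipschitz (xdot mu a11 a21 a40 a50) /\ loc_lipschitz (ydot mu).
Proof.
  split; unfold xdot, ydot; simpl;
    repeat first [apply loc_lipschitz_plus | apply loc_lipschitz_opp | apply loc_lipschitz_mult];
    auto using loc_lipschitz_const, loc_lipschitz_fst, loc_lipschitz_snd.
Qed.

Lemma angular_order (u v : R -> R) (t0 : R) :
  angular u -> angular v -> u t0 < v t0 -> forall t, u t < v t.
Proof.
  intros Hu Hv H t. destruct (Rlt_dec (u t) (v t)) as [|N]; [easy|]. exfalso.
  assert (Hc : forall s, continuity_pt (fun s => v s - u s) s).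
  { intros s. apply continuity_pt_minus;
      [eapply is_derive_continuity_pt, Hv | eapply is_derive_continuity_pt, Hu]. }
  destruct (IVT_gen (fun s => v s - u s) t0 t 0) as [s [_ Hs]].
  - intros s. apply Hc.
  - rewrite Rmin_right, Rmax_left; lra.
  - pose proof (angular_unique u v s Hu Hv ltac:(lra) t0). lra.
Qed.

(** If [u] is not periodic, its successive returns decrease strictly in one direction. In that
    direction the orbit keeps the clamp inactive, so it is a true solution and coincides with the
    periodic one given by the center. The latter comes back to the initial radius after a whole
    number of turns, at least one, which contradicts the decrease. *)
Lemma periodic_of_center : is_center (xdot mu a11 a21 a40 a50) (ydot mu) ->
  exists r0, 0 < r0 /\ forall u t0, angular u -> exp (u t0) < r0 ->
    forall t, u (t + 2 * PI) = u t.
Proof.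
  intros [d Hd]. pose proof turn_growth_ge1 as HM. pose proof rmax_bounds as Hrm.
  pose proof PI_RGT_0.
  assert (Hq : 0 < rmax / turn_growth) by (apply Rdiv_lt_0_compat; lra).
  exists (Rmin d (rmax / turn_growth)).
  split; [apply Rmin_glb_lt; [apply cond_pos | easy]|].
  intros u t0 Hu Hr.
  pose proof (Rmin_l d (rmax / turn_growth)). pose proof (Rmin_r d (rmax / turn_growth)).
  assert (Hrd : exp (u t0) < d) by lra.
  assert (Hrm' : turn_growth * exp (u t0) < rmax).
  { apply Rlt_le_trans with (turn_growth * (rmax / turn_growth)).
    - apply Rmult_lt_compat_l; lra.
    - right. field. lra. }
  pose proof (exp_pos (u t0)) as Hp.
  destruct (Req_dec (u (t0 + 2 * PI)) (u t0)) as [E|E];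
    [now apply (angular_unique _ _ t0 (angular_shift u Hu) Hu)|].
  exfalso.
  (* The orbit is followed backwards if its returns increase, since growth could carry it beyond
     [umax]. Order preservation extends the inequality from [t0] to all angles. *)
  assert (Hdec : exists e, (e = 1 \/ e = -1) /\ forall t, u (t + e * (2 * PI)) < u t).
  { destruct (Rlt_dec (u (t0 + 2 * PI)) (u t0)) as [H3|H3].
    - exists 1. split; [now left|]. intros t. rewrite Rmult_1_l.
      exact (angular_order _ _ t0 (angular_shift u Hu) Hu H3 t).
    - exists (-1). split; [now right|]. intros t.
      pose proof (angular_order _ _ t0 Hu (angular_shift u Hu) ltac:(lra)
        (t + -1 * (2 * PI))) as H4. simpl in H4.
      now replace (t + -1 * (2 * PI) + 2 * PI) with t in H4 by ring. }
  destruct Hdec as [e [He Hdec]].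
  assert (Hb : forall t, 0 <= e * (t - t0) -> u t <= umax).
  { intros t Ht.
    pose proof (returns_bound u e t0 t He Hu (fun s => Rlt_le _ _ (Hdec s)) Ht) as B.
    apply exp_le_umax. apply Rle_trans with (exp (u t0 + 2 * num_bound * (2 * PI))).
    - destruct B as [B| ->]; [left; now apply exp_increasing | lra].
    - rewrite exp_plus, Rmult_comm. fold turn_growth. lra. }
  destruct (time_change u t0 Hu) as [tau [Th [Htau0 [Htau [_ [HThtau HTh]]]]]].
  assert (HTh0 : Th 0 = t0) by (rewrite <- Htau0; apply HThtau).
  destruct (Hd (exp (u t0) * cos t0) (exp (u t0) ^ 3 * sin t0))
    as [x [y [_ [T [HT [Hsol [Hx0 [Hy0 [Hper _]]]]]]]]].
  { rewrite Rminus_0_r, Rabs_mult, Rabs_right by lra.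
    pose proof (Rabs_cos_le1 t0). nra. }
  { rewrite Rminus_0_r, Rabs_mult, Rabs_right by (left; now apply pow_lt).
    pose proof (Rabs_sin_le1 t0). pose proof (Rabs_pos (sin t0)).
    assert (exp (u t0) ^ 2 <= 1) by nra.
    assert (exp (u t0) ^ 3 <= exp (u t0)) by (simpl in *; nra).
    assert (0 < exp (u t0) ^ 3) by now apply pow_lt. nra. }
  { intros Exy. injection Exy as Ex Ey.
    pose proof (quasipolar_pos (exp (u t0)) t0 Hp) as Q. simpl pow at 2 in Q.
    rewrite Ex, Ey in Q. lra. }
  assert (Hsign : forall t, 0 <= e * t -> 0 <= e * (Th t - t0)).
  { intros t Ht. rewrite <- HTh0.
    destruct (Req_dec t 0) as [->|]; [rewrite Rminus_diag; lra|].
    destruct He as [-> | ->].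
    - pose proof (time_change_increasing u Th 0 t HTh ltac:(lra)). lra.
    - pose proof (time_change_increasing u Th t 0 HTh ltac:(lra)). lra. }
  assert (Hend : x (e * T) = x 0 /\ y (e * T) = y 0).
  { destruct He as [-> | ->].
    - specialize (Hper 0). rewrite Rplus_0_l in Hper. now rewrite Rmult_1_l.
    - specialize (Hper (-1 * T)). replace (-1 * T + T) with 0 in Hper by ring. easy. }
  destruct (planar_uniqueness (xdot mu a11 a21 a40 a50) (ydot mu)
     (Rmin 0 (e * T)) (Rmax 0 (e * T)) 0
     (fun z => exp (u (Th z)) * cos (Th z)) (fun z => exp (u (Th z)) ^ 3 * sin (Th z))
     x y) with (t := e * T) as [Fx Fy].
  - apply field_loc_lipschitz.
  - apply field_loc_lipschitz.
  - split; [apply Rmin_l | apply Rmax_l].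
  - intros t Ht. apply orbit_derive; [easy | apply HTh |]. apply Hb, Hsign.
    destruct He as [-> | ->].
    + rewrite Rmin_left, Rmax_right in Ht; lra.
    + rewrite Rmin_right, Rmax_left in Ht; lra.
  - intros t _. apply Hsol.
  - now rewrite HTh0.
  - now rewrite HTh0.
  - split; [apply Rmin_r | apply Rmax_r].
  - destruct Hend as [Ex Ey]. rewrite Ex, Hx0 in Fx. rewrite Ey, Hy0 in Fy.
    destruct (quasipolar_unique _ _ _ _ (exp_pos _) Hp Fx Fy) as [Er [k Hk]].
    apply exp_inv in Er.
    assert (Hstrict : 0 < e * (Th (e * T) - t0)).
    { rewrite <- HTh0. destruct He as [-> | ->].
      - pose proof (time_change_increasing u Th 0 (1 * T) HTh ltac:(lra)). lra.
      - pose proof (time_change_increasing u Th (-1 * T) 0 HTh ltac:(lra)). lra. }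
    (* [n] counts the turns after the first one: the first decreases [u] strictly, the others at
       least weakly. *)
    assert (Hn : exists n, Th (e * T) = t0 + e * (2 * PI) + e * (INR n * (2 * PI))).
    { rewrite Hk in *. destruct He as [-> | ->].
      - assert (0 < IZR k) as K by nra. apply lt_IZR in K.
        exists (Z.to_nat (k - 1)). rewrite INR_IZR_INZ, Z2Nat.id, minus_IZR by lia. ring.
      - assert (IZR k < 0) as K by nra. apply lt_IZR in K.
        exists (Z.to_nat (- k - 1)).
        rewrite INR_IZR_INZ, Z2Nat.id, minus_IZR, opp_IZR by lia. ring. }
    destruct Hn as [n Hn]. rewrite Hn in Er.
    pose proof (returns_decreasing u e n (t0 + e * (2 * PI)) (fun s => Rlt_le _ _ (Hdec s))).
    specialize (Hdec t0). lra.
Qed.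

(** * Obstructions to a center *)

Lemma small_periodic_orbit (eps : R) : 0 < eps ->
  is_center (xdot mu a11 a21 a40 a50) (ydot mu) ->
  exists u, angular u /\ (forall t, u (t + 2 * PI) = u t) /\
    forall t, exp (u t) < eps /\ u t <= umax.
Proof.
  intros Heps Hc. destruct (periodic_of_center Hc) as [r0 [Hr0 Hper]].
  pose proof turn_growth_ge1 as HM. pose proof rmax_bounds.
  set (m := Rmin r0 (Rmin eps rmax)).
  assert (Hm : 0 < m /\ m <= r0 /\ m <= eps /\ m <= rmax).
  { unfold m. pose proof (Rmin_r r0 (Rmin eps rmax)).
    pose proof (Rmin_l eps rmax). pose proof (Rmin_r eps rmax).
    split; [repeat apply Rmin_glb_lt; lra | split; [apply Rmin_l | lra]]. }
  set (r := m / (2 * turn_growth)).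
  assert (Hr : turn_growth * r = m / 2) by (unfold r; field; lra).
  assert (Hrp : 0 < r) by (unfold r; apply Rdiv_lt_0_compat; lra).
  destruct (angular_exists 0 (ln r)) as [u [Hu0 Hu]].
  assert (Hur : exp (u 0) = r) by (rewrite Hu0; now apply exp_ln).
  assert (Hp : forall t, u (t + 2 * PI) = u t) by (apply (Hper u 0 Hu); rewrite Hur; nra).
  exists u. split; [easy|]. split; [easy|]. intros t.
  assert (exp (u t) <= m / 2).
  { rewrite <- Hr, <- Hur. unfold turn_growth. rewrite <- exp_plus.
    destruct (periodic_bound u 0 t Hu Hp) as [L| ->].
    - left. apply exp_increasing. lra.
    - rewrite Rplus_comm. lra. }
  split; [lra|]. apply exp_le_umax. lra.
Qed.

(** The leading rate [mu x^2 (x^6 + 3 y^2)] is [mu x^2 r^6 * den c s 0], bounded below by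
    [den_zero_ge1]. The other terms also contain [x^2] and have higher weight, so they lose for
    [r < eps]. The factor [mu] in [h] makes the leading term positive. *)
Lemma center_mu_zero : is_center (xdot mu a11 a21 a40 a50) (ydot mu) -> mu = 0.
Proof.
  intros Hc. destruct (Req_dec mu 0) as [|Hmu]; [easy|]. exfalso.
  pose proof (Rabs_pos_lt mu Hmu) as Hmu'. pose proof coef_norm_nonneg as HA.
  set (eps := Rabs mu / (1 + coef_norm)).
  assert (Heps : 0 < eps) by (apply Rdiv_lt_0_compat; lra).
  destruct (small_periodic_orbit eps Heps Hc) as [u [Hu [Hp Hle]]].
  set (x := fun t => exp (u t) * cos t). set (y := fun t => exp (u t) ^ 3 * sin t).
  set (h := fun t => mu * (x t ^ 6 / 6 + y t ^ 2 / 2)).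
  set (dh := fun t => mu * (x t ^ 5 * xdot mu a11 a21 a40 a50 (x t) (y t)
                            + y t * ydot mu (x t) (y t)) / speed u t).
  assert (Hh : forall t, is_derive h t (dh t)).
  { intros t. destruct (quasipolar_derive u t Hu (proj2 (Hle t))) as [Dx Dy].
    pose proof (speed_bounds u t).
    eapply is_derive_eq.
    - apply is_derive_scal, (is_derive_plus (V := R_NormedModule)).
      + apply (is_derive_ext (fun t => / 6 * x t ^ 6)); [intros; simpl; field|].
        apply is_derive_scal, is_derive_pow, Dx.
      + apply (is_derive_ext (fun t => / 2 * y t ^ 2)); [intros; simpl; field|].
        apply is_derive_scal, is_derive_pow, Dy.
    - unfold dh, plus; cbn -[pow INR]. fold (x t) (y t).
      replace (INR 6) with 6 by (simpl; ring). replace (INR 2) with 2 by (simpl; ring).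
      rewrite pow_1. field. lra. }
  assert (Hpos : forall t, 0 <= dh t /\ (cos t <> 0 -> 0 < dh t)).
  { intros t. pose proof (speed_bounds u t) as Hs. destruct (Hle t) as [Hr Hru].
    pose proof (exp_pos (u t)) as Hr0. set (r := exp (u t)) in *.
    pose proof (cos2_plus_sin2 t) as P. pose proof (den_zero_ge1 _ _ P) as D0.
    assert (Hr1 : r <= 1).
    { pose proof (radius_bounds (u t)). rewrite radius_exp in * by easy.
      pose proof rmax_bounds. fold r in H. lra. }
    set (c := cos t) in *. set (s := sin t) in *.
    set (E := (a11 * (c ^ 4 * s ^ 1) + a40 * (c ^ 7 * s ^ 0))
              + r * (a21 * (c ^ 5 * s ^ 1) + a50 * (c ^ 8 * s ^ 0))).
    assert (HE : Rabs E <= coef_norm).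
    { replace coef_norm with ((Rabs a11 + Rabs a40) + 1 * (Rabs a21 + Rabs a50))
        by (unfold coef_norm; ring).
      apply Rabs_plus_le; [apply Rabs_plus_le; now apply monomial_bound|].
      apply Rabs_mult_le; [apply Rabs_le; lra|].
      apply Rabs_plus_le; now apply monomial_bound. }
    assert (Hd : dh t = c ^ 2 * (r ^ 8 * (mu ^ 2 * den c s 0 + mu * (r * E)) / speed u t)).
    { unfold dh, x, y. fold c s r. unfold xdot, ydot, den, xq, yq, E. field. lra. }
    assert (HrE : r * coef_norm < Rabs mu).
    { apply Rle_lt_trans with (eps * coef_norm); [apply Rmult_le_compat_r; lra|].
      unfold eps. replace (Rabs mu / (1 + coef_norm) * coef_norm)
        with (Rabs mu * (coef_norm / (1 + coef_norm))) by (field; lra).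
      assert (coef_norm / (1 + coef_norm) < 1) by (apply Rlt_div_l; lra). nra. }
    assert (HmE : Rabs (mu * (r * E)) < mu ^ 2).
    { rewrite <- (pow2_abs mu), !Rabs_mult, (Rabs_right r) by lra.
      apply Rle_lt_trans with (Rabs mu * (r * coef_norm)).
      - apply Rmult_le_compat_l; [lra|]. apply Rmult_le_compat_l; [lra | easy].
      - simpl. rewrite Rmult_1_r. now apply Rmult_lt_compat_l. }
    apply Rabs_lt_between in HmE. pose proof (pow2_ge_0 mu).
    assert (Hbr : 0 < r ^ 8 * (mu ^ 2 * den c s 0 + mu * (r * E)) / speed u t).
    { apply Rdiv_lt_0_compat; [|lra]. apply Rmult_lt_0_compat; [now apply pow_lt | nra]. }
    rewrite Hd. split.
    - apply Rmult_le_pos; [apply pow2_ge_0 | lra].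
    - intros Hcn. apply Rmult_lt_0_compat; [|easy]. now apply pow2_gt_0. }
  assert (Hcont : forall t, continuity_pt h t)
    by (intros t; eapply is_derive_continuity_pt, Hh).
  pose proof PI_RGT_0.
  (* The rate vanishes on the [y] axis; a strict increase over the first quarter turn already
     contradicts periodicity. *)
  assert (A1 : h 0 < h (PI / 2)).
  { apply (derive_pos_lt h dh); auto; [lra|]. intros t Ht. apply Hpos.
    apply Rgt_not_eq, cos_gt_0; lra. }
  assert (A2 : h (PI / 2) <= h (0 + 2 * PI)).
  { apply (derive_nonneg_le h dh); auto; [lra|]. intros t Ht. apply Hpos. }
  assert (A3 : h (0 + 2 * PI) = h 0).
  { unfold h, x, y. rewrite Hp, cos_plus, sin_plus, cos_2PI, sin_2PI, cos_0, sin_0.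
    f_equal. f_equal; f_equal; ring. }
  lra.
Qed.

(** * The Lienard system in the case [mu = 0] *)

Definition lphi (x : R) : R := (a40 * x ^ 4 + a50 * x ^ 5) / qf a11 a21 x.
Definition ldphi (x : R) : R :=
  ((4 * a40 * x ^ 3 + 5 * a50 * x ^ 4) * qf a11 a21 x
   + (a40 * x ^ 4 + a50 * x ^ 5) * (a11 + 2 * a21 * x)) / qf a11 a21 x ^ 2.
Definition lg (x : R) : R := x ^ 5 / qf a11 a21 x.

(* The maximum keeps the integrand continuous away from the origin. *)
Definition lG : R -> R := RInt (fun x => x ^ 5 / Rmax (qf a11 a21 x) (/ 2)) 0.

Definition qrad : R := / (2 * (1 + Rabs a11 + Rabs a21)).

Lemma qrad_bounds : 0 < qrad <= 1 /\
  forall x, Rabs x <= qrad -> / 2 <= qf a11 a21 x <= 2.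
Proof.
  pose proof (Rabs_pos a11). pose proof (Rabs_pos a21).
  assert (H1 : 0 < qrad <= 1).
  { unfold qrad. split; [apply Rinv_0_lt_compat; lra|].
    rewrite <- Rinv_1. apply Rinv_le_contravar; lra. }
  split; [easy|]. intros x Hx. unfold qf.
  assert (Hq : qrad * (Rabs a11 + Rabs a21) <= / 2).
  { unfold qrad. apply (Rmult_le_reg_r (2 * (1 + Rabs a11 + Rabs a21))); [lra|].
    replace (/ (2 * (1 + Rabs a11 + Rabs a21)) * (Rabs a11 + Rabs a21)
      * (2 * (1 + Rabs a11 + Rabs a21))) with (Rabs a11 + Rabs a21) by (field; lra). lra. }
  assert (E1 : Rabs (a11 * x) <= Rabs a11 * qrad) by (apply Rabs_mult_le; lra).
  assert (E2 : Rabs (a21 * x ^ 2) <= Rabs a21 * (qrad * 1)).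
  { apply Rabs_mult_le; [lra|]. replace (x ^ 2) with (x * x) by ring.
    apply Rabs_mult_le; lra. }
  apply Rabs_le_between in E1, E2. lra.
Qed.

Lemma lG_derive (x : R) : Rabs x <= qrad -> is_derive lG x (lg x).
Proof.
  intros Hx. destruct qrad_bounds as [_ Hq]. specialize (Hq x Hx).
  eapply is_derive_eq.
  - apply (is_derive_RInt_continuous (fun x => x ^ 5 / Rmax (qf a11 a21 x) (/ 2))).
    intros t. apply (continuous_mult (K := R_AbsRing)); [apply continuous_pow, continuous_id|].
    apply continuous_Rinv_comp; [|pose proof (Rmax_r (qf a11 a21 t) (/ 2)); lra].
    apply continuity_pt_filterlim.
    apply (continuity_pt_comp (qf a11 a21) (fun z => Rmax z (/ 2))).
    + apply derivable_continuous_pt. unfold qf. reg.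
    + intros e He. exists e. split; [easy|]. intros z [_ Hz]. simpl in *. unfold R_dist in *.
      eapply Rle_lt_trans; [|exact Hz].
      unfold Rmax. destruct (Rle_dec z (/ 2)), (Rle_dec (qf a11 a21 t) (/ 2));
        unfold Rabs; repeat destruct (Rcase_abs _); lra.
  - unfold lg. now rewrite Rmax_left by lra.
Qed.

Lemma lG_zero : lG 0 = 0.
Proof. exact (RInt_point 0 _). Qed.

Lemma lphi_derive (x : R) : Rabs x <= qrad -> is_derive lphi x (ldphi x).
Proof.
  intros Hx. destruct qrad_bounds as [_ Hq]. specialize (Hq x Hx). unfold qf in Hq.
  unfold lphi, ldphi, qf. auto_derive; [lra | field; lra].
Qed.

(** If [a40 = 0], then [lphi] is [a50 * x^5] over a positive function and changes sign with [x].
    Otherwise it is [a40 * psi], and the hypothesis becomes [a11 <> 0] or [ga <> 0]. *)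
Lemma lphi_sign : a50 <> 0 \/ a11 * a40 <> 0 ->
  exists s r, (s = 1 \/ s = -1) /\ 0 < r <= qrad /\
  forall x1 x2, 0 < x1 <= r -> 0 < x2 <= r -> lG x1 = lG (- x2) ->
    0 < s * (lphi x1 - lphi (- x2)).
Proof.
  intros H. destruct qrad_bounds as [Hr Hq].
  assert (Hsgn : forall a, a <> 0 -> exists s, (s = 1 \/ s = -1) /\ 0 < s * a).
  { intros a Ha. destruct (Rlt_dec 0 a).
    - exists 1. split; [now left | lra].
    - exists (-1). split; [now right | lra]. }
  destruct (Req_dec a40 0) as [Ha|Ha].
  - assert (H5 : a50 <> 0) by (destruct H as [|H]; [easy | exfalso; apply H; rewrite Ha; ring]).
    destruct (Hsgn a50 H5) as [s [Hs Hsa]].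
    exists s, qrad. split; [easy|]. split; [lra|]. intros x1 x2 H1 H2 _.
    pose proof (Hq x1 ltac:(rewrite Rabs_right; lra)) as Q1.
    pose proof (Hq (- x2) ltac:(rewrite Rabs_left; lra)) as Q2.
    replace (s * (lphi x1 - lphi (- x2))) with
      (s * a50 * (x1 ^ 5 / qf a11 a21 x1 + x2 ^ 5 / qf a11 a21 (- x2)))
      by (unfold lphi; rewrite Ha; field; lra).
    apply Rmult_lt_0_compat; [easy|].
    apply Rplus_lt_0_compat; (apply Rdiv_lt_0_compat; [apply pow_lt|]; lra).
  - set (ga := a50 / a40).
    assert (Hne : a11 <> 0 \/ ga <> 0).
    { destruct H as [H|H].
      - right. unfold ga. apply Rmult_integral_contrapositive_currified;
          [easy | now apply Rinv_neq_0_compat].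
      - left. intros E. apply H. rewrite E. ring. }
    destruct (psi_sign a11 a21 ga lG qrad) as [s [r [Hs [Hrr Hsign]]]]; auto.
    + apply Hr.
    + apply lG_derive.
    + apply lG_zero.
    + intros x Hx. apply Hq, Hx.
    + destruct (Hsgn a40 Ha) as [s' [Hs' Hsa]].
      exists (s * s'), r. split; [destruct Hs, Hs'; subst; lra|]. split; [easy|].
      intros x1 x2 H1 H2 E. specialize (Hsign x1 x2 H1 H2 E).
      pose proof (Hq x1 ltac:(rewrite Rabs_right; lra)) as Q1.
      pose proof (Hq (- x2) ltac:(rewrite Rabs_left; lra)) as Q2.
      replace (s * s' * (lphi x1 - lphi (- x2)))
        with (s' * a40 * (s * (psi a11 a21 ga x1 - psi a11 a21 ga (- x2)))).
      * now apply Rmult_lt_0_compat.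
      * unfold psi, lphi, ga. field. lra.
Qed.

Lemma ldphi_bound : exists C, forall x, Rabs x <= qrad -> Rabs (ldphi x) <= C * Rabs x ^ 3.
Proof.
  destruct qrad_bounds as [Hr Hq].
  exists (((4 * Rabs a40 + 5 * Rabs a50) * 2 + (Rabs a40 + Rabs a50) * (Rabs a11 + 2 * Rabs a21)) * 4).
  intros x Hx. specialize (Hq x Hx).
  assert (H1 : Rabs x <= 1) by lra.
  assert (H2 : Rabs (x ^ 2) <= 1) by now apply Rabs_pow_le1.
  unfold ldphi, Rdiv.
  replace (((4 * a40 * x ^ 3 + 5 * a50 * x ^ 4) * qf a11 a21 x
    + (a40 * x ^ 4 + a50 * x ^ 5) * (a11 + 2 * a21 * x)) * / qf a11 a21 x ^ 2)
    with (((4 * a40 + 5 * a50 * x) * qf a11 a21 x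
      + (a40 * x + a50 * x ^ 2) * (a11 + 2 * a21 * x)) * / qf a11 a21 x ^ 2 * x ^ 3)
    by (field; lra).
  rewrite RPow_abs. apply Rabs_mult_le; [|lra].
  apply Rabs_mult_le.
  - apply Rabs_plus_le; apply Rabs_mult_le.
    + apply Rabs_plus_le.
      * apply Rabs_mult_le; [rewrite Rabs_right; lra | lra].
      * rewrite <- (Rmult_1_r (5 * Rabs a50)). apply Rabs_mult_le; [|easy].
        apply Rabs_mult_le; [rewrite Rabs_right; lra | lra].
    + rewrite Rabs_right; lra.
    + rewrite <- (Rmult_1_r (Rabs a40)), <- (Rmult_1_r (Rabs a50)).
      apply Rabs_plus_le; apply Rabs_mult_le; lra.
    + apply Rabs_plus_le; [lra|].
      rewrite <- (Rmult_1_r (2 * Rabs a21)). apply Rabs_mult_le; [|easy].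
      apply Rabs_mult_le; [rewrite Rabs_right; lra | lra].
  - assert ((/ 2) ^ 2 <= qf a11 a21 x ^ 2) by (apply pow_incr; lra).
    rewrite Rabs_inv, Rabs_right by (apply Rle_ge, pow2_ge_0).
    replace 4 with (/ ((/ 2) ^ 2)) by field. apply Rinv_le_contravar; [apply pow_lt; lra | easy].
Qed.

Lemma half_lienard_right (r : R) : r <= qrad -> half_lienard r lphi ldphi lg lG.
Proof.
  intros Hr. destruct qrad_bounds as [_ Hq]. split.
  - intros x Hx. apply lG_derive. rewrite Rabs_right; lra.
  - apply lG_zero.
  - intros x Hx. specialize (Hq x ltac:(rewrite Rabs_right; lra)).
    pose proof (pow_lt x 5 ltac:(lra)). unfold lg. split.
    + apply (Rmult_le_reg_r (qf a11 a21 x)); [lra|].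
      replace (x ^ 5 / qf a11 a21 x * qf a11 a21 x) with (x ^ 5) by (field; lra). nra.
    + apply Rle_div_l; [lra | nra].
  - intros x Hx. apply lphi_derive. rewrite Rabs_right; lra.
  - unfold lphi. rewrite !pow_i by lia. unfold Rdiv. ring.
  - destruct ldphi_bound as [C HC]. exists C. intros x Hx.
    specialize (HC x). rewrite (Rabs_right x) in HC by lra. apply HC. lra.
Qed.

(** The substitution of [- x] for [x] moves the left half to the right. The sign in front of [lg]
    keeps it positive; it amounts to a reversal of time, so that [y] increases along this half as
    well. *)
Lemma half_lienard_left (r : R) : r <= qrad ->
  half_lienard r (fun x => lphi (- x)) (fun x => - ldphi (- x)) (fun x => - lg (- x))
    (fun x => lG (- x)).
Proof.
  intros Hr. destruct qrad_bounds as [_ Hq].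
  assert (Hneg : forall f l x, is_derive f (- x) l -> is_derive (fun x => f (- x)) x (- l)).
  { intros f l x H. eapply is_derive_eq.
    - apply (is_derive_comp f (fun x => - x)); [exact H|]. auto_derive; [auto | reflexivity].
    - unfold scal; simpl; unfold mult; simpl. ring. }
  split.
  - intros x Hx. apply Hneg, lG_derive. rewrite Rabs_left1; lra.
  - rewrite Ropp_0. apply lG_zero.
  - intros x Hx. specialize (Hq (- x) ltac:(rewrite Rabs_left; lra)).
    pose proof (pow_lt x 5 ltac:(lra)). unfold lg.
    replace (- ((- x) ^ 5 / qf a11 a21 (- x))) with (x ^ 5 / qf a11 a21 (- x)) by (field; lra).
    split.
    + apply (Rmult_le_reg_r (qf a11 a21 (- x))); [lra|].
      replace (x ^ 5 / qf a11 a21 (- x) * qf a11 a21 (- x)) with (x ^ 5) by (field; lra). nra.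
    + apply Rle_div_l; [lra | nra].
  - intros x Hx. apply Hneg, lphi_derive. rewrite Rabs_left1; lra.
  - rewrite Ropp_0. unfold lphi. rewrite !pow_i by lia. unfold Rdiv. ring.
  - destruct ldphi_bound as [C HC]. exists C. intros x Hx.
    specialize (HC (- x)). rewrite Rabs_Ropp, (Rabs_right x) in HC by lra.
    rewrite Rabs_Ropp. apply HC. lra.
Qed.

(** Used with [v = u] for the right half of an orbit and with [v t = u (PI - t)] for the reflected
    left half. *)
Lemma quasipolar_arc (v P Q phi g : R -> R) (r : R) :
  (forall t, continuous v t) -> (forall t, exp (v t) <= r) ->
  (forall t, is_derive (fun t => exp (v t) * cos t) t (P t)) ->
  (forall t, is_derive (fun t => exp (v t) ^ 3 * sin t) t (Q t)) ->
  (forall t, - (PI / 2) < t < PI / 2 -> 0 < Q t /\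
     let x := exp (v t) * cos t in let y := exp (v t) ^ 3 * sin t in
     P t / Q t = (phi x - y) / g x) ->
  exists U, lienard_arc r (- exp (v (- (PI / 2))) ^ 3) (exp (v (PI / 2)) ^ 3) phi g U.
Proof.
  intros Hv Hr HP HQ Hsys. pose proof PI_RGT_0.
  destruct (curve_as_graph (fun t => exp (v t) * cos t) (fun t => exp (v t) ^ 3 * sin t) P Q
    (- (PI / 2)) (PI / 2)) as [U [Uc [Ua [Ub Ud]]]].
  - lra.
  - intros t _. eapply is_derive_continuity_pt, HP.
  - intros t _. eapply is_derive_continuity_pt, HQ.
  - intros t Ht. split; [apply HP|]. split; [apply HQ|]. now apply Hsys.
  - cbv beta in *. rewrite sin_neg, sin_PI2, cos_neg, cos_PI2, ?Rmult_0_r in *.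
    replace (exp (v (- (PI / 2))) ^ 3 * - (1)) with (- exp (v (- (PI / 2))) ^ 3) in * by ring.
    rewrite Rmult_1_r in *.
    exists U. split; auto.
    + intros y Hy. destruct (Ud y Hy) as [t [Ht [_ [-> _]]]].
      assert (0 < cos t) by (apply cos_gt_0; lra).
      pose proof (exp_pos (v t)). pose proof (COS_bound t). specialize (Hr t). nra.
    + intros y Hy. destruct (Ud y Hy) as [t [Ht [Ey [Eu D]]]].
      destruct (Hsys t Ht) as [_ E]. cbv zeta in E. rewrite E, Ey, <- Eu in D. exact D.
Qed.

Lemma center_odd_part_zero : is_center (xdot mu a11 a21 a40 a50) (ydot mu) ->
  ~ (a50 <> 0 \/ a11 * a40 <> 0).
Proof.
  intros Hc Hne. pose proof (center_mu_zero Hc) as Hmu. pose proof PI_RGT_0.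
  destruct (lphi_sign Hne) as [s [r [Hs [Hr Hsign]]]].
  destruct (small_periodic_orbit r (proj1 Hr) Hc) as [u [Hu [Hp Hle]]].
  destruct qrad_bounds as [_ Hq].
  set (X t := xdot mu a11 a21 a40 a50 (exp (u t) * cos t) (exp (u t) ^ 3 * sin t)).
  set (Y t := ydot mu (exp (u t) * cos t) (exp (u t) ^ 3 * sin t)).
  assert (HY : forall t, Y t = (exp (u t) * cos t) ^ 5)
    by (intros t; unfold Y, ydot; rewrite Hmu; ring).
  (* Here [x^5 / lg x] is the divisor [q]: the division by [q] changes the time but not the quotient
     of the components, which is all that the arcs retain. *)
  assert (HX : forall t, let x := exp (u t) * cos t in cos t <> 0 ->
    X t = (lphi x - exp (u t) ^ 3 * sin t) / lg x * x ^ 5).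
  { intros t x Hcos. pose proof (exp_pos (u t)) as He.
    assert (Hx : x <> 0) by (apply Rmult_integral_contrapositive_currified; lra).
    assert (Hxr : Rabs x <= qrad).
    { unfold x. rewrite Rabs_mult, Rabs_right by lra. destruct (Hle t).
      pose proof (Rabs_cos_le1 t). pose proof (Rabs_pos (cos t)). nra. }
    specialize (Hq x Hxr). unfold X, xdot. fold x. rewrite Hmu.
    unfold lphi, lg. set (y := exp (u t) ^ 3 * sin t).
    transitivity (a40 * x ^ 4 + a50 * x ^ 5 - y * qf a11 a21 x);
      [unfold qf; ring | field; lra]. }
  assert (Huc : forall t, continuous u t) by (intros t; eapply is_derive_continuous, Hu).
  assert (Hcos : forall t, - (PI / 2) < t < PI / 2 -> 0 < cos t)
    by (intros t Ht; apply cos_gt_0; lra).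
  destruct (quasipolar_arc u (fun t => X t / speed u t) (fun t => Y t / speed u t)
    lphi lg r) as [U1 arc1].
  { exact Huc. }
  { intros t. destruct (Hle t). lra. }
  { intros t. apply quasipolar_derive; [easy | apply Hle]. }
  { intros t. apply quasipolar_derive; [easy | apply Hle]. }
  { intros t Ht. specialize (Hcos t Ht). pose proof (speed_bounds u t).
    pose proof (Rmult_lt_0_compat _ _ (exp_pos (u t)) Hcos) as Hx.
    pose proof (pow_lt _ 5 Hx) as Hx5. rewrite HY. split; [apply Rdiv_lt_0_compat; lra|].
    cbv zeta. rewrite (HX t) by lra. set (x := exp (u t) * cos t) in *.
    set (q := (lphi _ - _) / lg _). field. lra. }
  set (v t := u (PI - t)).
  assert (Hrefl : forall f l t, is_derive f (PI - t) l -> is_derive (fun t => f (PI - t)) t (- l)).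
  { intros f l t Hf. eapply is_derive_eq.
    - apply (is_derive_comp f (fun t => PI - t)); [exact Hf|]. auto_derive; [auto | reflexivity].
    - unfold scal; simpl; unfold mult; simpl. ring. }
  assert (Hcpi : forall t, cos (PI - t) = - cos t)
    by (intros t; rewrite cos_minus, cos_PI, sin_PI; ring).
  assert (Hspi : forall t, sin (PI - t) = sin t)
    by (intros t; rewrite sin_minus, cos_PI, sin_PI; ring).
  destruct (quasipolar_arc v (fun t => X (PI - t) / speed u (PI - t))
    (fun t => - (Y (PI - t) / speed u (PI - t)))
    (fun x => lphi (- x)) (fun x => - lg (- x)) r) as [U2 arc2].
  { intros t. apply (continuous_comp (fun t => PI - t) u); [|apply Huc].
    apply (continuous_minus (V := R_NormedModule)); [apply continuous_const | apply continuous_id]. }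
  { intros t. unfold v. destruct (Hle (PI - t)). lra. }
  { intros t. rewrite <- (Ropp_involutive (X (PI - t) / speed u (PI - t))).
    apply (is_derive_ext (fun t => - (exp (u (PI - t)) * cos (PI - t)))).
    - intros z. unfold v. rewrite Hcpi. simpl. ring.
    - apply (is_derive_opp (V := R_NormedModule)), (Hrefl (fun t => exp (u t) * cos t)).
      apply quasipolar_derive; [easy | apply Hle]. }
  { intros t. apply (is_derive_ext (fun t => exp (u (PI - t)) ^ 3 * sin (PI - t))).
    - intros z. unfold v. now rewrite Hspi.
    - apply (Hrefl (fun t => exp (u t) ^ 3 * sin t)).
      apply quasipolar_derive; [easy | apply Hle]. }
  { intros t Ht. specialize (Hcos t Ht). pose proof (speed_bounds u (PI - t)).
    pose proof (Rmult_lt_0_compat _ _ (exp_pos (u (PI - t))) Hcos) as Hx.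
    pose proof (pow_lt _ 5 Hx) as Hx5.
    assert (E : exp (u (PI - t)) * cos (PI - t) = - (exp (v t) * cos t))
      by (unfold v; rewrite Hcpi; ring).
    fold (v t) in Hx, Hx5. set (x := exp (v t) * cos t) in *.
    rewrite HY, E. replace (- ((- x) ^ 5 / speed u (PI - t))) with (x ^ 5 / speed u (PI - t))
      by (field; lra).
    split; [apply Rdiv_lt_0_compat; lra|].
    cbv zeta. rewrite (HX (PI - t)) by (rewrite Hcpi; lra). rewrite E, Hspi. fold (v t).
    unfold Rdiv. rewrite Rinv_opp.
    set (q := (lphi _ - _)). set (w := / lg (- x)). field. lra. }
  (* Periodicity enters here: the left half ends at the angle [3 * PI / 2], so it shares its lower
     end point with the right half. *)
  assert (Ev1 : v (- (PI / 2)) = u (- (PI / 2))).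
  { unfold v. rewrite <- (Hp (- (PI / 2))). f_equal. field. }
  assert (Ev2 : v (PI / 2) = u (PI / 2)) by (unfold v; f_equal; field).
  rewrite Ev1, Ev2 in arc2.
  pose proof (pow_lt _ 3 (exp_pos (u (- (PI / 2))))). pose proof (pow_lt _ 3 (exp_pos (u (PI / 2)))).
  assert (HAB : - exp (u (- (PI / 2))) ^ 3 < 0 < exp (u (PI / 2)) ^ 3) by lra.
  pose proof (half_lienard_right r (proj2 Hr)) as HR.
  pose proof (half_lienard_left r (proj2 Hr)) as HL.
  (* The sign decides which half plays the part of the first arc. *)
  destruct Hs as [-> | ->].
  - apply (lienard_arcs_incompatible _ _ _ _ _ _ _ _ _ _ _ _ _ HAB HR HL arc1 arc2).
    intros x1 x2 h1 h2 E. specialize (Hsign x1 x2 h1 h2 E). lra.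
  - apply (lienard_arcs_incompatible _ _ _ _ _ _ _ _ _ _ _ _ _ HAB HL HR arc2 arc1).
    intros x2 x1 h2 h1 E. symmetry in E. specialize (Hsign x1 x2 h1 h2 E). lra.
Qed.

Lemma center_iff : is_center (xdot mu a11 a21 a40 a50) (ydot mu) <->
  mu = 0 /\ a11 * a40 = 0 /\ a50 = 0.
Proof.
  split.
  - intros Hc. split; [now apply center_mu_zero|].
    pose proof (center_odd_part_zero Hc) as N.
    destruct (Req_dec a50 0); [|tauto]. destruct (Req_dec (a11 * a40) 0); tauto.
  - intros [Hmu [H1 H5]]. apply center_of_periodic. intros u Hu.
    now apply periodic_of_conditions.
Qed.

End QuasiPolar.

(** * Nilpotency and Andreev number *)

Lemma differentiable_of_quadratic (f : R -> R -> R) (a b K : R) :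
  (forall x y, Rabs x <= 1 -> Rabs y <= 1 ->
    Rabs (f x y - f 0 0 - (a * x + b * y)) <= K * Rmax (Rabs x) (Rabs y) ^ 2) ->
  differentiable_pt_lim f 0 0 a b.
Proof.
  intros H eps. pose proof (Rabs_pos K).
  assert (Hd : 0 < Rmin 1 (eps / (1 + Rabs K))).
  { apply Rmin_glb_lt; [lra | apply Rdiv_lt_0_compat; [apply cond_pos | lra]]. }
  exists (mkposreal _ Hd). simpl. intros x y Hx Hy. rewrite !Rminus_0_r in *.
  pose proof (Rmin_l 1 (eps / (1 + Rabs K))). pose proof (Rmin_r 1 (eps / (1 + Rabs K))).
  eapply Rle_trans; [apply H; lra|].
  assert (Hm : 0 <= Rmax (Rabs x) (Rabs y) <= eps / (1 + Rabs K)).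
  { split; [eapply Rle_trans; [apply Rabs_pos | apply Rmax_l] | apply Rmax_lub; lra]. }
  set (m := Rmax (Rabs x) (Rabs y)) in *.
  replace (K * m ^ 2) with (K * m * m) by ring. apply Rmult_le_compat_r; [lra|].
  apply Rle_trans with ((1 + Rabs K) * m).
  - apply Rmult_le_compat_r; [lra|]. pose proof (Rle_abs K). lra.
  - apply Rle_trans with ((1 + Rabs K) * (eps / (1 + Rabs K)));
      [apply Rmult_le_compat_l; lra | right; field; lra].
Qed.

Lemma monomial_quadratic (c x y : R) (i j : nat) : (2 <= i + j)%nat ->
  Rabs x <= 1 -> Rabs y <= 1 ->
  Rabs (c * (x ^ i * y ^ j)) <= Rabs c * Rmax (Rabs x) (Rabs y) ^ 2.
Proof.
  intros Hij Hx Hy. rewrite Rabs_mult. apply Rmult_le_compat_l; [apply Rabs_pos|].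
  rewrite Rabs_mult, <- !RPow_abs.
  pose proof (Rmax_l (Rabs x) (Rabs y)). pose proof (Rmax_r (Rabs x) (Rabs y)).
  assert (Rmax (Rabs x) (Rabs y) <= 1) by now apply Rmax_lub.
  pose proof (Rabs_pos x). pose proof (Rabs_pos y).
  set (m := Rmax (Rabs x) (Rabs y)) in *.
  apply Rle_trans with (m ^ i * m ^ j).
  - apply Rmult_le_compat; try (apply pow_le; lra); apply pow_incr; lra.
  - rewrite <- pow_add. replace (i + j)%nat with (2 + (i + j - 2))%nat by lia. rewrite pow_add.
    assert (m ^ (i + j - 2) <= 1) by (rewrite <- (pow1 (i + j - 2)); apply pow_incr; lra).
    pose proof (pow2_ge_0 m). nra.
Qed.

Lemma analytic_polynomial (h : R -> R -> R) (c : nat -> nat -> R) (N : nat) :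
  (forall k l, (N < k + l)%nat -> c k l = 0) ->
  (forall x y, h x y = sum_f_R0 (fun n =>
     sum_f_R0 (fun k => c k (n - k)%nat * x ^ k * y ^ (n - k)) n) N) ->
  analytic_at_origin h.
Proof.
  intros Hc Hh.
  assert (Hfin : forall a : nat -> R, (forall n, (N < n)%nat -> a n = 0) ->
    is_series a (sum_f_R0 a N)).
  { intros a Ha. change (is_lim_seq (sum_n a) (sum_f_R0 a N)).
    apply (is_lim_seq_ext_loc (fun _ => sum_f_R0 a N) (sum_n a));
      [|apply is_lim_seq_const].
    exists N. intros n Hn. rewrite sum_n_Reals. induction Hn as [|n Hn IH]; [easy|].
    simpl. rewrite <- IH, Ha by lia. ring. }
  assert (Hzero : forall (b : nat -> R) n, (forall k, (k <= n)%nat -> b k = 0) -> sum_f_R0 b n = 0).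
  { intros b n Hb. rewrite <- (sum_eq_R0 b n); [easy | intros; apply Hb; lia]. }
  exists c, (mkposreal 1 Rlt_0_1). intros x y _ _. split.
  - eexists. apply Hfin. intros n Hn. apply Hzero. intros k Hk.
    rewrite Hc by lia. rewrite !Rmult_0_l. apply Rabs_R0.
  - rewrite Hh. apply Hfin. intros n Hn. apply Hzero. intros k Hk.
    rewrite Hc by lia. ring.
Qed.

Lemma nilpotent (mu a11 a21 a40 a50 : R) :
  nilpotent_singular_point (xdot mu a11 a21 a40 a50) (ydot mu).
Proof.
  split; [unfold xdot; ring|]. split; [unfold ydot; ring|].
  exists 0, (-1), 0, 0. split; [|split; [|split]].
  - apply (differentiable_of_quadratic _ _ _
      (Rabs mu + Rabs a11 + Rabs a21 + Rabs a40 + Rabs a50)).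
    intros x y Hx Hy.
    replace (xdot mu a11 a21 a40 a50 x y - xdot mu a11 a21 a40 a50 0 0 - (0 * x + -1 * y))
      with (mu * (x ^ 3 * y ^ 0) + a11 * (x ^ 1 * y ^ 1) + a21 * (x ^ 2 * y ^ 1)
            + a40 * (x ^ 4 * y ^ 0) + a50 * (x ^ 5 * y ^ 0)) by (unfold xdot; ring).
    rewrite !Rmult_plus_distr_r.
    repeat apply Rabs_plus_le; apply monomial_quadratic; auto; lia.
  - apply (differentiable_of_quadratic _ _ _ (Rabs 1 + Rabs (3 * mu))). intros x y Hx Hy.
    replace (ydot mu x y - ydot mu 0 0 - (0 * x + 0 * y))
      with (1 * (x ^ 5 * y ^ 0) + (3 * mu) * (x ^ 2 * y ^ 1)) by (unfold ydot; ring).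
    rewrite !Rmult_plus_distr_r.
    apply Rabs_plus_le; apply monomial_quadratic; auto; lia.
  - lra.
  - intros l [u [v [Huv [E1 E2]]]].
    destruct (Ceq_dec l 0) as [|Hl]; [easy|]. exfalso.
    assert (Hv : v = 0).
    { destruct (Ceq_dec v 0) as [|Hv]; [easy|]. exfalso.
      apply (Cmult_neq_0 l v Hl Hv). rewrite <- E2. ring. }
    apply Huv. rewrite Hv in *. f_equal.
    destruct (Ceq_dec u 0) as [|Hu]; [easy|]. exfalso.
    apply (Cmult_neq_0 l u Hl Hu). rewrite <- E1. ring.
Qed.

Lemma andreev (mu a11 a21 a40 a50 : R) :
  has_andreev_number (xdot mu a11 a21 a40 a50) (ydot mu) 3.
Proof.
  split; [lia|].
  set (P x y := mu * x ^ 3 - a11 * x * y - a21 * x ^ 2 * y + a40 * x ^ 4 + a50 * x ^ 5).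
  set (Q x y := - x ^ 5 + 3 * mu * x ^ 2 * y).
  (* [Y + P(X, Y)] is affine in [Y] with slope [qf], so the implicit function is explicit. *)
  set (F x := - (mu * x ^ 3 + a40 * x ^ 4 + a50 * x ^ 5) / qf a11 a21 x).
  destruct (qrad_bounds a11 a21) as [Hr Hq]. set (r := qrad a11 a21) in *.
  assert (Hloc : forall S : R -> Prop, (forall x, Rabs x <= r -> S x) -> locally 0 S).
  { intros S HS. exists (mkposreal r (proj1 Hr)). intros x Hx. apply HS.
    unfold ball in Hx; simpl in Hx; unfold AbsRing_ball, abs, minus, plus, opp in Hx; simpl in Hx.
    rewrite Ropp_0, Rplus_0_r in Hx. lra. }
  (* With [F x = - mu x^3 + O(x^4)], the term [3 mu x^2 F x] adds [- 3 mu^2 x^5] to [- x^5]. *)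
  exists P, Q, F, (- (1 + 3 * mu ^ 2)).
  split; [|split; [|split; [|split; [|split; [|split; [|split; [|split; [|split]]]]]]]].
  - apply (analytic_polynomial _ (fun k l => match k, l with
      | 3%nat, 0%nat => mu | 1%nat, 1%nat => - a11 | 2%nat, 1%nat => - a21
      | 4%nat, 0%nat => a40 | 5%nat, 0%nat => a50 | _, _ => 0 end) 5).
    + intros k l Hkl. do 6 (destruct k as [|k]; [do 6 (destruct l as [|l]; [lia || easy|]); lia || easy|]).
      easy.
    + intros x y. unfold P. simpl. ring.
  - apply (analytic_polynomial _ (fun k l => match k, l with
      | 5%nat, 0%nat => -1 | 2%nat, 1%nat => 3 * mu | _, _ => 0 end) 5).
    + intros k l Hkl. do 6 (destruct k as [|k]; [do 6 (destruct l as [|l]; [lia || easy|]); lia || easy|]).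
      easy.
    + intros x y. unfold Q. simpl. ring.
  - split; [unfold P; ring|].
    apply (differentiable_of_quadratic _ _ _
      (Rabs mu + Rabs (- a11) + Rabs (- a21) + Rabs a40 + Rabs a50)).
    intros x y Hx Hy.
    replace (P x y - P 0 0 - (0 * x + 0 * y))
      with (mu * (x ^ 3 * y ^ 0) + - a11 * (x ^ 1 * y ^ 1) + - a21 * (x ^ 2 * y ^ 1)
            + a40 * (x ^ 4 * y ^ 0) + a50 * (x ^ 5 * y ^ 0)) by (unfold P; ring).
    rewrite !Rmult_plus_distr_r.
    repeat apply Rabs_plus_le; apply monomial_quadratic; auto; lia.
  - split; [unfold Q; ring|].
    apply (differentiable_of_quadratic _ _ _ (Rabs (-1) + Rabs (3 * mu))). intros x y Hx Hy.
    replace (Q x y - Q 0 0 - (0 * x + 0 * y))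
      with (-1 * (x ^ 5 * y ^ 0) + (3 * mu) * (x ^ 2 * y ^ 1)) by (unfold Q; ring).
    rewrite !Rmult_plus_distr_r.
    apply Rabs_plus_le; apply monomial_quadratic; auto; lia.
  (* The change of variables is [X = x], [Y = - y], which turns the linear part [- y] into [Y]. *)
  - exists 1, 0, 0, (-1). split; [lra|].
    exists (mkposreal 1 Rlt_0_1). intros x y _ _. unfold P, Q, xdot, ydot. split; ring.
  - unfold F, qf. field.
  - apply (ex_derive_continuous (V := R_NormedModule)). unfold F, qf. auto_derive. lra.
  - apply Hloc. intros x Hx. specialize (Hq x Hx). unfold F, P.
    unfold qf in *. field. lra.
  - pose proof (pow2_ge_0 mu). lra.
  - exists (3 * Rabs mu * (Rabs mu * (Rabs a11 + Rabs a21) + Rabs a40 + Rabs a50) * 2).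
    apply Hloc. intros x Hx. specialize (Hq x Hx).
    change (2 * 3 - 1)%nat with 5%nat. change (2 * 3)%nat with 6%nat.
    replace (Q x (F x) - - (1 + 3 * mu ^ 2) * x ^ 5)
      with (3 * - mu * (mu * (a11 + a21 * x) + a40 + a50 * x) * / qf a11 a21 x * x ^ 6)
      by (unfold Q, F; unfold qf in *; field; lra).
    rewrite RPow_abs. apply Rabs_mult_le; [|lra].
    assert (Hx1 : forall a, Rabs (a * x) <= Rabs a).
    { intros a. rewrite <- (Rmult_1_r (Rabs a)). apply Rabs_mult_le; lra. }
    apply Rabs_mult_le; [apply Rabs_mult_le|].
    + apply Rabs_mult_le; [rewrite Rabs_right; lra | rewrite Rabs_Ropp; lra].
    + apply Rabs_plus_le; [|easy]. apply Rabs_plus_le; [|lra].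
      apply Rabs_mult_le; [lra|]. apply Rabs_plus_le; [lra | easy].
    + rewrite Rabs_inv, Rabs_right by lra. replace 2 with (/ / 2) by field.
      apply Rinv_le_contravar; lra.
Qed.

Theorem theorem10 (mu a11 a21 a40 a50 : R) :
  (nilpotent_singular_point (xdot mu a11 a21 a40 a50) (ydot mu) /\
   is_monodromic (xdot mu a11 a21 a40 a50) (ydot mu) /\
   has_andreev_number (xdot mu a11 a21 a40 a50) (ydot mu) 3) /\
  (nilpotent_center (xdot mu a11 a21 a40 a50) (ydot mu) <->
   mu = 0 /\ a11 * a40 = 0 /\ a50 = 0).
Proof.
  split; [split; [apply nilpotent | split; [apply monodromic | apply andreev]]|].
  split.
  - intros [_ Hc]. now apply center_iff in Hc.
  - intros H. split; [apply nilpotent | now apply center_iff].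
Qed.
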